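(* Let $N\geqslant1$ be an integer and let $G$ be a finite group. Then the partition wreath product $G\wr H_N^+$ is isomorphic, as a compact quantum group, to the partition wreath product $(G\times\mathbb{Z}_2)\wr S_N^+$.
   Context: Partitions. $P(k,l)$ is the set of partitions of $k+l$ points, drawn as a row of $k$ upper points and a row of $l$ lower points; $NC(k,l)$ is the subset of non-crossing partitions and $NC_{ev}(k,l)$ the subset of non-crossing partitions all of whose blocks have even size. $NC$ and $NC_{ev}$ are categories of partitions, i.e. they contain the identity partition $\vert\in P(1,1)$ and are stable under horizontal concatenation, vertical concatenation (composition), upside-down flip and rotation of extreme points from one row to the other. For a category of partitions $\mathcal{C}$ and a basis $(e_1,\dots,e_N)$ of $\mathbb{C}^N$, $T_p:(\mathbb{C}^N)^{\otimes k}\to(\mathbb{C}^N)^{\otimes l}$ ($p\in\mathcal{C}(k,l)$) is $T_p(e_{\boldsymbol i})=\sum_{\boldsymbol j}\delta_p(\boldsymbol i,\boldsymbol j)e_{\boldsymbol j}$, with $\delta_p(\boldsymbol i,\boldsymbol j)=1$ if, writing the indices $\boldsymbol i$ on the upper and $\boldsymbol j$ on the lower points of $p$, indices in the same block are equal, and $0$ otherwise. $\mathbb{G}_N(\mathcal{C})$ is the unique compact quantum group (in the sense of Woronowicz) with a unitary representation $u$ on $\mathbb{C}^N$ whose coefficients generate a dense subalgebra and with $\mathrm{Hom}(u^{\otimes k},u^{\otimes l})=\mathrm{Span}\{T_p:p\in\mathcal{C}(k,l)\}$. One has $S_N^+=\mathbb{G}_N(NC)$ (free permutation quantum group) and $H_N^+=\mathbb{G}_N(NC_{ev})$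 (quantum hyperoctahedral group). Partition wreath product. For a finite group $K$, $\mathcal{C}^K(k,l)$ is the set of partitions in $\mathcal{C}(k,l)$ with an element of $K$ (colour) attached to each point. Let $V=\bigoplus_{g\in K}V^g$, where $V^g$ is a copy of $\mathbb{C}^N$ with basis $(e_i^g)_{1\leqslant i\leqslant N}$ (all $e_i^g$ orthonormal). If $p\in\mathcal{C}^K(k,l)$ has upper colours $g_1,\dots,g_k$ and lower colours $h_1,\dots,h_l$, then $T_p:V^{g_1}\otimes\dots\otimes V^{g_k}\to V^{h_1}\otimes\dots\otimes V^{h_l}$ is given by $T_p(e_{i_1}^{g_1}\otimes\dots\otimes e_{i_k}^{g_k})=\sum_{j_1,\dots,j_l=1}^N\delta_p(\boldsymbol i,\boldsymbol j)\,e_{j_1}^{h_1}\otimes\dots\otimes e_{j_l}^{h_l}$, where $\delta_p(\boldsymbol i,\boldsymbol j)$ is computed from the underlying uncoloured partition of $p$ ($1$ if indices in the same block are equal, $0$ otherwise), extended by $0$ on the other summands of $V^{\otimes k}$. Let $b(p)$ be the number of blocks of $p$, ordered by leftmost point; $(g_1,\dots,g_{b(p)}).p$ is obtained from $p$ by multiplying on the left by $g_i$ all the colours of the points of the $i$-th block. Set $M_p=\sum_{(g_1,\dots,g_{b(p)})\in K^{b(p)}}T_{(g_1,\dots,g_{b(p)}).p}$. The partition wreath product $K\wr\mathbb{G}_N(\mathcal{C})$ is the compact quantum group given by Tannaka-Krein duality, having a fundamental unitary representation $\mathcal{V}$ on $V$, whose coefficients generate a dense subalgebra, with $\mathrm{Hom}(\mathcal{V}^{\otimes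 k},\mathcal{V}^{\otimes l})=\mathrm{Span}\{M_p:p\in\mathcal{C}^K(k,l)\}$ for all $k,l\in\mathbb{N}$. Isomorphisms of compact quantum groups are $*$-isomorphisms of the universal function C*-algebras intertwining the coproducts. *)

(* Defs.v *)
(* The complex numbers are R[i], for an arbitrary R : realType. *)
From HB Require Import structures.
From mathcomp Require Import all_boot all_order all_algebra all_fingroup.
From mathcomp Require Import complex.
From mathcomp Require Import boolp classical_sets functions reals.

Set Implicit Arguments.
Unset Strict Implicit.
Unset Printing Implicit Defensive.

Import GRing.Theory Num.Theory.

Local Open Scope ring_scope.
Local Open Scope complex_scope.

(* Unital C*-algebras.  The norm is a field of the structure because the
   library has no type that is both a ring and a normed module other than the
   numeric domains.  [algType] excludes the zero algebra; this is harmless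
   below, where the other C*-algebras over which one quantifies are codomains
   of unital homomorphisms. *)
HB.mixin Record isCStarAlgebra (R : realType) A of GRing.Algebra R[i] A := {
  star : A -> A;
  starD : forall x y : A, star (x + y) = star x + star y;
  starZ : forall (c : R[i]) (x : A), star (c *: x) = c^* *: star x;
  starM : forall x y : A, star (x * y) = star y * star x;
  starK : forall x : A, star (star x) = x;
  cnorm : A -> R;
  cnorm0_eq0 : forall x : A, cnorm x = 0 -> x = 0;
  cnormD : forall x y : A, cnorm (x + y) <= cnorm x + cnorm y;
  cnormZ : forall (c : R[i]) (x : A),
    (cnorm (c *: x))%:C = `|c| * (cnorm x)%:C;
  cnormM : forall x y : A, cnorm (x * y) <= cnorm x * cnorm y;
  cnorm_star : forall x : A, cnorm (star x * x) = cnorm x ^+ 2;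
  cnorm_complete : forall u : nat -> A,
    (forall e : R, 0 < e -> exists n0 : nat, forall m n : nat,
       (n0 <= m)%N -> (n0 <= n)%N -> cnorm (u m - u n) < e) ->
    exists x : A, forall e : R, 0 < e -> exists n0 : nat, forall n : nat,
       (n0 <= n)%N -> cnorm (u n - x) < e
}.

#[short(type="cstarType")]
HB.structure Definition CStarAlgebra (R : realType) :=
  { A of isCStarAlgebra R A & GRing.Algebra R[i] A }.

Section CStar.
Variable R : realType.
Local Notation C := R[i].

Definition norm_dense (A : cstarType R) (S : set A) : Prop :=
  forall (x : A) (e : R), 0 < e -> exists2 y, S y & cnorm (x - y) < e.

Definition star_subalg (A : cstarType R) (S : set A) : Prop :=
  GRing.subalg_closed [in S] /\ (forall x, S x -> S (star x)).

(* Unital *-homomorphisms on a subset S, applied to unital *-subalgebras. *)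
Definition star_hom_on (A D : cstarType R) (S : set A) (f : A -> D) : Prop :=
  [/\ f 1 = 1,
      forall x y, S x -> S y -> f (x + y) = f x + f y,
      forall (c : C) x, S x -> f (c *: x) = c *: f x,
      forall x y, S x -> S y -> f (x * y) = f x * f y
    & forall x, S x -> f (star x) = star (f x)].

Definition star_hom (A D : cstarType R) (f : A -> D) : Prop :=
  star_hom_on setT f.

Definition lin_indep (A : cstarType R) n (a : 'I_n -> A) : Prop :=
  forall c : 'I_n -> C, \sum_i c i *: a i = 0 -> forall i, c i = 0.

(* i and j embed A and B in T with commuting ranges, and the induced
   *-homomorphism from the algebraic tensor product of A and B to T is
   injective.  Up to passing to a closure, such a T is the same thing as a
   C*-norm on the algebraic tensor product, the norm of sum_m a_m (x) b_m being
   that of sum_m i a_m * j b_m. *)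
Definition tensor_embedding (A B T : cstarType R) (i : A -> T) (j : B -> T)
    : Prop :=
  [/\ star_hom i, star_hom j,
      forall a b, i a * j b = j b * i a
    & forall n (a : 'I_n -> A) (b : 'I_n -> B),
        lin_indep a -> \sum_m i (a m) * j (b m) = 0 -> forall m, b m = 0].

Definition prod_span (A B T : cstarType R) (i : A -> T) (j : B -> T) : set T :=
  [set x | exists n (a : 'I_n -> A) (b : 'I_n -> B),
             x = \sum_m i (a m) * j (b m)]%classic.

(* T, with the embeddings a |-> a (x) 1 and b |-> 1 (x) b, is the completion of
   the algebraic tensor product for its least C*-norm. *)
Definition min_tensor (A B T : cstarType R) (i : A -> T) (j : B -> T) : Prop :=
  [/\ tensor_embedding i j,
      norm_dense (prod_span i j)
    & forall (T' : cstarType R) (i' : A -> T') (j' : B -> T'),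
        tensor_embedding i' j' ->
        forall n (a : 'I_n -> A) (b : 'I_n -> B),
          cnorm (\sum_m i (a m) * j (b m)) <=
          cnorm (\sum_m i' (a m) * j' (b m))].

(* F is the *-homomorphism on the tensor product T (with legs i and j) such
   that F (a (x) b) = f a * g b. *)
Definition hom_with_legs (A B T D : cstarType R) (i : A -> T) (j : B -> T)
    (f : A -> D) (g : B -> D) (F : T -> D) : Prop :=
  [/\ star_hom F, forall a, F (i a) = f a & forall b, F (j b) = g b].

(* qg_alg2 and qg_alg3 are A (x) A and (A (x) A) (x) A, with
   qg_leg1 a = a (x) 1, qg_leg2 a = 1 (x) a,
   qg_leg12 t = t (x) 1 and qg_leg3 a = 1 (x) 1 (x) a. *)
Record compact_quantum_group := CompactQuantumGroup {
  qg_alg :> cstarType R;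
  qg_alg2 : cstarType R;
  qg_alg3 : cstarType R;
  qg_leg1 : qg_alg -> qg_alg2;
  qg_leg2 : qg_alg -> qg_alg2;
  qg_leg12 : qg_alg2 -> qg_alg3;
  qg_leg3 : qg_alg -> qg_alg3;
  qg_coprod : qg_alg -> qg_alg2;
  qg_tensor2 : min_tensor qg_leg1 qg_leg2;
  qg_tensor3 : min_tensor qg_leg12 qg_leg3;
  qg_coprod_hom : star_hom qg_coprod;
  (* leg23 is t |-> 1 (x) t, coprod_id is Delta (x) id and id_coprod is
     id (x) Delta. *)
  qg_coassoc : exists leg23 coprod_id id_coprod : qg_alg2 -> qg_alg3,
    [/\ hom_with_legs qg_leg1 qg_leg2 (qg_leg12 \o qg_leg2) qg_leg3 leg23,
        hom_with_legs qg_leg1 qg_leg2 (qg_leg12 \o qg_coprod) qg_leg3 coprod_id,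
        hom_with_legs qg_leg1 qg_leg2 (qg_leg12 \o qg_leg1)
          (leg23 \o qg_coprod) id_coprod
      & forall a, coprod_id (qg_coprod a) = id_coprod (qg_coprod a)];
  qg_cancel1 : norm_dense (prod_span qg_coprod qg_leg1);
  qg_cancel2 : norm_dense (prod_span qg_coprod qg_leg2)
}.

(* F below is phi (x) phi. *)
Definition cqg_isomorphic (A B : compact_quantum_group) : Prop :=
  exists phi : A -> B,
    [/\ star_hom phi, bijective phi
      & exists2 F : qg_alg2 A -> qg_alg2 B,
          hom_with_legs (@qg_leg1 A) (@qg_leg2 A)
            (@qg_leg1 B \o phi) (@qg_leg2 B \o phi) F
        & forall a, F (qg_coprod a) = qg_coprod (phi a)].

Section Representation.
Variables (A : compact_quantum_group) (I : finType).

(* u is the matrix of a representation on the space with orthonormal basis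
   indexed by I, acting by e_i |-> sum_j e_j (x) u j i. *)
Definition unitary_rep (u : I -> I -> A) : Prop :=
  [/\ forall i j, \sum_m u i m * star (u j m) = (i == j)%:R,
      forall i j, \sum_m star (u m i) * u m j = (i == j)%:R
    & forall i j, qg_coprod (u i j) = \sum_m qg_leg1 (u i m) * qg_leg2 (u m j)].

Definition coefs (u : I -> I -> A) : set A :=
  [set x | exists i j, x = u i j]%classic.

Definition tensor_power (u : I -> I -> A) k (i j : {ffun 'I_k -> I}) : A :=
  \prod_(a < k) u (i a) (j a).

End Representation.

(* Linear maps from the k-th to the l-th tensor power of the space with basis
   I, given by their matrices, the row (output) index coming first. *)
Definition tensor_map (I : finType) (k l : nat) : vectType C :=
  {ffun {ffun 'I_l -> I} * {ffun 'I_k -> I} -> C^o}.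

(* T belongs to Hom (u^(x)k, u^(x)l). *)
Definition intertwiner (A : compact_quantum_group) (I : finType)
    (u : I -> I -> A) k l (T : tensor_map I k l) : Prop :=
  forall (j : {ffun 'I_l -> I}) (i : {ffun 'I_k -> I}),
    \sum_(i' : {ffun 'I_k -> I}) (T (j, i') : C) *: tensor_power u i' i =
    \sum_(j' : {ffun 'I_l -> I}) (T (j', i) : C) *: tensor_power u j j'.

(* The C*-algebra is the universal one (the enveloping C*-algebra of the
   *-algebra generated by the coefficients of u) and not, say, the reduced
   one. *)
Definition universal_for (A : compact_quantum_group) (I : finType)
    (u : I -> I -> A) : Prop :=
  let Pol := smallest (@star_subalg A) (coefs u) in
  forall (D : cstarType R) (f : A -> D), star_hom_on Pol f ->
    exists! F : A -> D, star_hom F /\ (forall x, Pol x -> F x = f x).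

(* A is the universal version of the compact quantum group, given by
   Tannaka-Krein duality, whose fundamental representation acts on the space
   with orthonormal basis I and has Hom spaces spanned by the lists Hom k l. *)
Definition tannaka_krein (I : finType)
    (Hom : forall k l, seq (tensor_map I k l)) (A : compact_quantum_group)
    : Prop :=
  exists u : I -> I -> A,
    [/\ unitary_rep u,
        norm_dense
          (smallest (fun S : set A => GRing.subalg_closed [in S]) (coefs u)),
        forall k l (T : tensor_map I k l),
          intertwiner u T <-> T \in <<Hom k l>>%VS
      & universal_for u].

End CStar.

(* inl a is the a-th upper point and inr b the b-th lower point. *)
Definition point (k l : nat) : finType := ('I_k + 'I_l)%type.

Definition is_partition k l (p : {set {set point k l}}) : bool :=
  finset.partition p [set: point k l].

(* Position of a point when the boundary is read clockwise: upper row from left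
   to right, then lower row from right to left. *)
Definition circ k l (x : point k l) : nat :=
  match x with inl a => a | inr b => (k + (l - b.+1))%N end.

Definition noncrossing k l (p : {set {set point k l}}) : Prop :=
  forall (B B' : {set point k l}) (a b c d : point k l),
    B \in p -> B' \in p -> a \in B -> c \in B -> b \in B' -> d \in B' ->
    (circ a < circ b)%N -> (circ b < circ c)%N -> (circ c < circ d)%N -> B = B'.

Definition partition_family := forall k l, {set {set {set point k l}}}.

Definition NC : partition_family := fun k l =>
  [set p : {set {set point k l}} | is_partition p && `[< noncrossing p >]].

Definition NCev : partition_family := fun k l =>
  [set p in NC k l | [forall B in p, ~~ odd #|B|]].

Section Wreath.
Variables (R : realType) (K : finGroupType) (N : nat).
Local Notation C := R[i].

(* (g, i) is the index of the basis vector e_i^g of V. *)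
Definition wr_index : finType := (K * 'I_N)%type.

Definition colouring k l : finType := {ffun point k l -> K}.

Definition join_index k l (j : {ffun 'I_l -> wr_index})
    (i : {ffun 'I_k -> wr_index}) (x : point k l) : wr_index :=
  match x with inl a => i a | inr b => j b end.

Definition delta k l (p : {set {set point k l}}) (i : point k l -> 'I_N) : bool :=
  [forall B in p, forall x in B, forall y in B, i x == i y].

Definition Tmap k l (p : {set {set point k l}}) (c : colouring k l)
    : tensor_map R wr_index k l :=
  [ffun ji => let w := join_index ji.1 ji.2 in
     ([forall x, (w x).1 == c x] && delta p (fun x => (w x).2))%:R].

Definition block_act k l (p : {set {set point k l}})
    (g : {ffun {set point k l} -> K}) (c : colouring k l) : colouring k l :=
  [ffun x => (g (finset.pblock p x) * c x)%g].

(* The elements of K^b(p) are encoded as the functions on sets of points that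
   take the value 1 off the blocks of p. *)
Definition Mmap k l (p : {set {set point k l}}) (c : colouring k l)
    : tensor_map R wr_index k l :=
  \sum_(g : {ffun {set point k l} -> K}
        | g \in pffun_on 1%g (mem p) (predT : pred K))
    Tmap p (block_act p g c).

(* A is the partition wreath product of K by the quantum group G_N(F). *)
Definition is_partition_wreath (F : partition_family)
    (A : compact_quantum_group R) : Prop :=
  tannaka_krein
    (fun k l => [seq Mmap pc.1 pc.2 |
                 pc <- enum [set pc : {set {set point k l}} * colouring k l |
                             pc.1 \in F k l]])
    A.

End Wreath.

(* Main.v *)
From HB Require Import structures.
From mathcomp Require Import all_boot all_order all_algebra all_fingroup.
From mathcomp Require Import complex ring lra.
From mathcomp Require Import boolp classical_sets functions reals.
Require Import Defs.

(** Let [v] be the fundamental representation of the partition wreath product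
    of [G * Z_2] by [S_N^+].  It commutes with the right translations by the
    group [G * Z_2], in particular by [Z_2], and [w := odd_part v] is its
    restriction to the subspace on which [Z_2] acts by the sign, a space of the
    same dimension as that of the fundamental representation [u] of the partition
    wreath product of [G] by [H_N^+].  The theorem holds because [u] and [w] have
    the same intertwiners, and because [w] generates the same algebra as [v].

    Intertwiners.  Those of [w] are the compressions of those of [v]
    ([intertwiner_odd_map], [intertwiner_even_map]).  Compressing the map of a
    coloured partition [p] amounts to a sum with signs over the ways to give
    parities to the points that are prescribed, up to one parity for each block,
    by the colours.  Flipping the parities of a block of odd size reverses the
    sign, so that the sum vanishes unless all the blocks are even, in which case
    a nonzero multiple of the map of [p] coloured in [G] is left
    ([odd_map_Mmap], [odd_block_weight], [even_weight_neq0]).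

    Generation.  The entries in a column of [v] are orthogonal projections, by
    the intertwiner of the one-block partition with one upper and two lower
    points.  An entry of [w] is the difference of two of them, and its square is
    their sum ([odd_part_recovers]).

    It remains to see that a universal compact quantum group is determined by
    the intertwiners of a representation with self-adjoint entries
    ([universal_isomorphic]).  The point is that the linear relations between
    the coefficients of a unitary representation [W] depend only on its
    self-intertwiners ([relation_transfer]); this is applied to the direct sums
    of tensor powers.  Two facts enter.

    - The Haar state exists on the span of the coefficients: each relation
      [sum c i j *: W i j = 0] implies [sum c i j * P i j = 0], where [P] is the
      orthogonal projection onto the fixed vectors ([haar_projection]).  Since
      the coproduct turns relations into relations, the values of linear forms
      on [W] make up an algebra [L] of matrices, and the claim is that [P]
      belongs to it.  If not, Riesz representation yields a nonzero matrix [m]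
      whose columns are orthogonal to the fixed vectors and with
      [inner (X *m m) m = x * inner m m] whenever [X] in [L] comes from a form
      taking the value [x] at [1].  So [inner (W m) m = inner m m]; as [W] is
      unitary, positivity in the C*-algebra gives [W m = m], whence [m = 0].

    - Applied to the tensor product of [W] with its conjugate, this gives the
      values of the Haar state on all [sum c i j *: (W i j * star (W k l))] in
      terms of the commutant of [W].  If the [c i j] are the coefficients of a
      relation, then these values vanish, which forces
      [sum c i j *: V i j = 0] for any matrix [V] that commutes with the
      commutant of [W].

    The positivity used is that [sum star (d i) * d i = 0] and
    [sum d i * star (d i) = 0] imply [d i = 0] ([sum_star_mul_eq0]); it is
    derived from the C*-identity and from square roots of [1 - x] for [|x| < 1].
    *)

Set Implicit Arguments.
Unset Strict Implicit.
Unset Printing Implicit Defensive.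

Import Order.TTheory GRing.Theory Num.Theory.

Local Open Scope ring_scope.

(** * Positivity in C*-algebras *)

Section CStarNorm.
Variables (R : realType) (A : cstarType R).
Implicit Types (x y a b h : A) (t : R).

Lemma star_is_additive : zmod_morphism (@star R A).
Proof.
have sN (x : A) : star (- x) = - star x by rewrite -scaleN1r starZ rmorphN1 scaleN1r.
by move=> x y; rewrite starD sN.
Qed.

HB.instance Definition _ :=
  GRing.isZmodMorphism.Build A A (@star R A) star_is_additive.

Lemma star1 : star (1 : A) = 1.
Proof. by rewrite -[LHS]mul1r -[X in X * _]starK -starM mul1r starK. Qed.

Lemma cnorm0 : cnorm (0 : A) = 0.
Proof.
have := cnormZ 0 (0 : A); rewrite scale0r normr0 mul0r => h.
by have [] := h.
Qed.

Lemma cnormZr t x : cnorm (t%:C%C *: x) = `|t| * cnorm x.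
Proof.
apply: (@complexI R); rewrite cnormZ /= rmorphM /=; congr (_ * _).
by rewrite normc_def /= expr0n addr0 sqrtr_sqr.
Qed.

Lemma cnormN x : cnorm (- x) = cnorm x.
Proof.
have := cnormZr (-1) x.
by rewrite rmorphN1 scaleN1r normrN normr1 mul1r.
Qed.

Lemma cnorm_ge0 x : 0 <= cnorm x.
Proof. by have := cnormD x (- x); rewrite subrr cnormN cnorm0; lra. Qed.

Lemma cnormB x y : cnorm (x - y) <= cnorm x + cnorm y.
Proof. by rewrite -[cnorm y]cnormN cnormD. Qed.

Lemma cnorm_distC x y : cnorm (x - y) = cnorm (y - x).
Proof. by rewrite -cnormN opprB. Qed.

Lemma cnorm_starE x : cnorm (star x) = cnorm x.
Proof.
suff le (z : A) : cnorm z <= cnorm (star z).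
  by apply/le_anti; rewrite le andbT -[in leRHS](starK x) le.
have := cnormM (star z) z; rewrite cnorm_star expr2.
have := cnorm_ge0 z; rewrite le_eqVlt => /orP[/eqP <- _|zgt0].
  exact: cnorm_ge0.
by rewrite ler_pM2r.
Qed.

Lemma cnorm1 : cnorm (1 : A) = 1.
Proof.
have := cnorm_star (1 : A); rewrite star1 mulr1 expr2 => /esym/eqP.
rewrite -subr_eq0 -{3}[cnorm 1]mulr1 -mulrBr mulf_eq0 => /orP[]/eqP.
  by move=> /cnorm0_eq0/eqP; rewrite oner_eq0.
by move=> /eqP; rewrite subr_eq0 => /eqP.
Qed.

Lemma cnorm_small_eq0 x : (forall e, 0 < e -> cnorm x < e) -> x = 0.
Proof.
move=> h; apply: cnorm0_eq0; apply/eqP; rewrite eq_le cnorm_ge0 andbT leNgt.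
by apply/negP => /h; rewrite ltxx.
Qed.

Lemma starZr t x : star (t%:C%C *: x) = t%:C%C *: star x.
Proof. by rewrite starZ conj_Creal // complex_real. Qed.

Lemma cnorm_selfadj_sqr h : star h = h -> cnorm (h * h) = cnorm h ^+ 2.
Proof. by move=> sh; rewrite -cnorm_star sh. Qed.

(** [a] is the average of [a + i b] and [a - i b], both of which have norm
    [sqrt |a^2 + b^2|] by the C*-identity. *)
Lemma two_squares a b : star a = a -> star b = b -> a * b = b * a ->
  cnorm a ^+ 2 <= cnorm (a * a + b * b).
Proof.
move=> sa sb ab; set M := cnorm (_ + _).
have conj_i : ('i%R : R[i]%C)^* = - 'i%R by rewrite conjCi.
have n1 : cnorm (a + 'i%R *: b) ^+ 2 = M.
  rewrite -cnorm_star starD starZ sa sb conj_i scaleNr /M mulrDl !mulrDr.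
  rewrite !mulNr -!scalerAl -!scalerAr scalerA -(expr2 'i%R) sqrCi ab.
  by rewrite scaleN1r opprK !addrA addrK.
have n2 : cnorm (a - 'i%R *: b) ^+ 2 = M.
  rewrite -n1 -[in LHS]cnorm_starE -[in RHS]cnorm_starE -cnorm_starE starK.
  by rewrite starD sa starZ sb conj_i scaleNr.
have n3 : cnorm (a - 'i%R *: b) = cnorm (a + 'i%R *: b).
  by apply/eqP; rewrite -(@eqrXn2 _ 2) ?cnorm_ge0 // n1 n2.
rewrite -n1 ler_sqr ?nnegrE ?cnorm_ge0 //.
have : cnorm (a + a) <= cnorm (a + 'i%R *: b) + cnorm (a + 'i%R *: b).
  rewrite -{2}n3; apply: le_trans (cnormD _ _); rewrite le_eqVlt; apply/orP.
  by left; apply/eqP; congr cnorm; rewrite addrACA subrr addr0.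
have -> : a + a = (2%:R : R)%:C%C *: a by rewrite rmorph_nat scaler_nat mulr2n.
by rewrite cnormZr ger0_norm ?ler0n //; lra.
Qed.

End CStarNorm.

Section PositiveSquares.
Variables (R : realType) (A : cstarType R).
Implicit Types (x y a b h : A) (q t e : R).

Let cvg_to (u : nat -> A) x := forall e, 0 < e ->
  exists n0 : nat, forall n : nat, (n0 <= n)%N -> cnorm (u n - x) < e.

Lemma expr_small q e : 0 <= q -> q < 1 -> 0 < e -> exists n, q ^+ n < e.
Proof.
move=> q0 q1 e0; have s0 : 0 < 1 - q by lra.
have bern n : q ^+ n * (1 + n%:R * (1 - q)) <= 1.
  elim: n => [|n IH]; first by rewrite expr0; lra.
  apply: le_trans IH; rewrite exprS -mulrA mulrCA.
  apply: ler_wpM2l; first exact: exprn_ge0.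
  rewrite -natr1; have n0 : 0 <= (n%:R : R) by exact: ler0n.
  by have := mulr_ge0 n0 (sqr_ge0 (1 - q)); have := sqr_ge0 (1 - q); lra.
have [n hn] : exists n : nat, e^-1 < 1 + n%:R * (1 - q).
  have ge0 : 0 <= e^-1 / (1 - q) by rewrite divr_ge0 ?invr_ge0 ?ltW.
  exists (Num.bound (e^-1 / (1 - q))).
  by have := archi_boundP ge0; rewrite ltr_pdivrMr //; lra.
exists n; rewrite -[e]invrK -div1r ltr_pdivlMr ?invr_gt0 //.
have := bern n; have [->|qn0] := eqVneq (q ^+ n) 0; first by rewrite mul0r; lra.
have : 0 < q ^+ n by rewrite lt0r qn0 exprn_ge0.
by nra.
Qed.

Lemma geometric_cvg (u : nat -> A) q : 0 <= q -> q < 1 ->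
  (forall n, cnorm (u n.+1 - u n) <= q ^+ n) -> exists x, cvg_to u x.
Proof.
move=> q0 q1 hu; have s0 : 0 < 1 - q by lra.
have bnd n k : (1 - q) * cnorm (u (n + k)%N - u n) <= q ^+ n - q ^+ (n + k).
  elim: k => [|k IH]; first by rewrite addn0 !subrr cnorm0 mulr0.
  have tri : cnorm (u (n + k.+1)%N - u n) <=
      cnorm (u (n + k)%N - u n) + q ^+ (n + k).
    apply: le_trans (lerD (lexx _) (hu _)); apply: le_trans (cnormD _ _).
    by rewrite addnS [X in _ <= cnorm X]addrC addrA subrK.
  by have := ler_wpM2l (ltW s0) tri; rewrite addnS exprS; lra.
apply: cnorm_complete => e e0.
have e1 : 0 < (1 - q) * e / 2 by rewrite divr_gt0 ?mulr_gt0.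
have [n0 hn0] := expr_small q0 q1 e1.
have tail k : cnorm (u (n0 + k)%N - u n0) < e / 2.
  have := bnd n0 k; have : 0 <= q ^+ (n0 + k) by exact: exprn_ge0.
  by nra.
exists n0 => m n /subnKC <- /subnKC <-.
have -> : u (n0 + (m - n0))%N - u (n0 + (n - n0))%N =
  (u (n0 + (m - n0))%N - u n0) - (u (n0 + (n - n0))%N - u n0).
  by rewrite opprB addrA subrK.
apply: le_lt_trans (cnormB _ _) _.
by have := tail (m - n0)%N; have := tail (n - n0)%N; lra.
Qed.

Lemma limit_bound_eq0 (u : nat -> A) x y K : cvg_to u x ->
  (forall n, cnorm y <= K * (cnorm (u n - x) + cnorm (u n.+1 - x))) -> y = 0.
Proof.
move=> hu hy; apply: cnorm_small_eq0 => e e0.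
have K0 : 0 < `|K| + 1 by have := normr_ge0 K; lra.
have [|n hn] := hu (e / (2 * (`|K| + 1))); first by rewrite divr_gt0 ?mulr_gt0.
have h1 := hn n (leqnn n); have h2 := hn n.+1 (leqnSn n).
apply: le_lt_trans (hy n) _.
have s0 := addr_ge0 (cnorm_ge0 (u n - x)) (cnorm_ge0 (u n.+1 - x)).
apply: (@le_lt_trans _ _
  ((`|K| + 1) * (cnorm (u n - x) + cnorm (u n.+1 - x)))).
  by apply: ler_wpM2r => //; have := ler_norm K; lra.
rewrite -ltr_pdivlMl //.
have -> : (`|K| + 1)^-1 * e = e / (2 * (`|K| + 1)) + e / (2 * (`|K| + 1)).
  by field; lra.
exact: ltrD.
Qed.

Let half : R := 2^-1.
Let step x y : A := half%:C%C *: (x + y * y).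

Let half_double (y : A) : half%:C%C *: y + half%:C%C *: y = y.
Proof.
rewrite -scalerDl -rmorphD /= (_ : half + half = 1) ?scale1r //.
by rewrite /half; lra.
Qed.

(** The square root is [1 - y], where [y = (x + y^2) / 2] is the limit of the
    iterates of [y |-> (x + y^2) / 2], a contraction of the ball of radius
    [|x|]. *)
Lemma selfadj_sqrt x : star x = x -> cnorm x < 1 ->
  exists r, [/\ star r = r, r * r = 1 - x
              & forall y, x * y = y * x -> r * y = y * r].
Proof.
move=> sx; set q := cnorm x => q1; have q0 : 0 <= q := cnorm_ge0 x.
pose u n := iter n (step x) 0.
have uS n : u n.+1 = step x (u n) by [].
have su n : star (u n) = u n.
  by elim: n => [|n IH]; rewrite ?raddf0 // uS starZr starD sx starM IH.
have cu n y : x * y = y * x -> u n * y = y * u n.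
  move=> xy; elim: n => [|n IH]; first by rewrite mul0r mulr0.
  rewrite uS /step -scalerAl -scalerAr mulrDl mulrDr xy.
  by rewrite -mulrA IH mulrA IH mulrA.
have cuu m n : u m * u n = u n * u m by apply/cu/esym/cu.
have hn (y : A) : cnorm (half%:C%C *: y) = half * cnorm y.
  by rewrite cnormZr ger0_norm // invr_ge0.
have half2 : half = 1 / 2 by rewrite div1r.
have nu n : cnorm (u n) <= q.
  elim: n => [|n IH]; first by rewrite cnorm0.
  rewrite uS hn half2; have := cnormD x (u n * u n); have := cnormM (u n) (u n).
  by have := cnorm_ge0 (u n); rewrite -/q; nra.
have [n|y hy] := @geometric_cvg u q q0 q1.
  elim: n => [|n IH].
    rewrite /u /= /step mulr0 addr0 subr0 hn expr0 -/q half2; lra.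
  have -> : u n.+2 - u n.+1 =
      half%:C%C *: ((u n.+1 - u n) * (u n.+1 + u n)).
    rewrite uS [in X in _ - X]uS -scalerBr; congr (_ *: _).
    rewrite mulrBl !mulrDr (cuu n.+1 n) [in RHS]opprD addrA addrK.
    by rewrite opprD addrACA subrr add0r.
  have : cnorm ((u n.+1 - u n) * (u n.+1 + u n)) <= q ^+ n * (q + q).
    apply: le_trans (cnormM _ _) _; apply: ler_pM; rewrite ?cnorm_ge0 //.
    by apply: le_trans (cnormD _ _) _; apply: lerD.
  by rewrite hn exprS half2; lra.
have fixy : y = step x y.
  apply/eqP; rewrite -subr_eq0; apply/eqP.
  apply: (@limit_bound_eq0 u y _ (1 + cnorm y)) => // n.
  have -> : y - step x y = half%:C%C *: (u n * (u n - y) + (u n - y) * y)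
                           - (u n.+1 - y).
    have <- : u n.+1 - step x y = half%:C%C *: (u n * (u n - y) + (u n - y) * y).
      rewrite uS /step -scalerBr; congr (_ *: _).
      by rewrite mulrBr mulrBl addrA subrK opprD addrACA subrr add0r.
    by rewrite opprB [RHS]addrC addrA subrK.
  apply: le_trans (cnormB _ _) _; rewrite hn half2.
  have := cnormD (u n * (u n - y)) ((u n - y) * y).
  have := cnormM (u n) (u n - y); have := cnormM (u n - y) y.
  have := nu n; have := cnorm_ge0 (u n - y); have := cnorm_ge0 y.
  have := cnorm_ge0 (u n.+1 - y).
  set a := cnorm _; set b := cnorm _; set c := cnorm _; set d := cnorm _.
  set e := cnorm (_ * _); set f := cnorm (_ * _); set g := cnorm (_ + _).
  by move=> *; nra.
have sy : star y = y.
  apply/eqP; rewrite -subr_eq0; apply/eqP.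
  apply: (@limit_bound_eq0 u y _ 2) => // n.
  have -> : star y - y = (u n - y) - star (u n - y).
    by rewrite raddfB /= su opprB [RHS]addrC addrA subrK.
  apply: le_trans (cnormB _ _) _; rewrite cnorm_starE.
  by have := cnorm_ge0 (u n.+1 - y); lra.
have cy z : x * z = z * x -> y * z = z * y.
  move=> xz; apply/eqP; rewrite -subr_eq0; apply/eqP.
  apply: (@limit_bound_eq0 u y _ (2 * cnorm z)) => // n.
  have -> : y * z - z * y = z * (u n - y) - (u n - y) * z.
    by rewrite mulrBr mulrBl cu // opprB [RHS]addrC addrA subrK.
  apply: le_trans (cnormB _ _) _.
  have := cnormM z (u n - y); have := cnormM (u n - y) z.
  by have := cnorm_ge0 (u n.+1 - y); have := cnorm_ge0 z; nra.
exists (1 - y); split.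
- by rewrite raddfB /= star1 sy.
- have : y + y = x + y * y by rewrite {1 2}fixy half_double.
  move=> yy; have -> : x = y + y - y * y by rewrite yy addrK.
  rewrite mulrBl mul1r mulrBr mulr1 !opprB opprD -addrA.
  by congr (_ + _); rewrite addrCA.
- by move=> z xz; rewrite mulrBl mulrBr mul1r mulr1 cy.
Qed.

(** If [r^2 = 1 - h^2 / t], then [|r|^2 <= |r^2 + h^2 / t| = 1] by [two_squares].
    The conclusion says that [h * h] is positive, in a form that is clearly
    stable under sums. *)
Lemma selfadj_sqr_pos h t : star h = h -> cnorm h ^+ 2 < t ->
  cnorm (t%:C%C *: 1 - h * h) <= t.
Proof.
move=> sh ht; have t0 : 0 < t by apply: le_lt_trans ht; exact: sqr_ge0.
pose s := Num.sqrt t^-1; have ss : s * s = t^-1.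
  by rewrite -expr2 sqr_sqrtr // invr_ge0 ltW.
have hsh : (s%:C%C *: h) * (s%:C%C *: h) = t^-1%:C%C *: (h * h).
  by rewrite -scalerAl -scalerAr scalerA -rmorphM ss.
have [||r [sr rr rc]] := @selfadj_sqrt (t^-1%:C%C *: (h * h)).
- by rewrite starZr starM sh.
- rewrite cnormZr cnorm_selfadj_sqr // ger0_norm ?invr_ge0 1?ltW //.
  by rewrite ltr_pdivrMl // mulr1.
have := @two_squares _ _ r (s%:C%C *: h) sr.
rewrite starZr sh hsh rr subrK cnorm1 => /(_ erefl) le1.
have {}le1 : cnorm r ^+ 2 <= 1.
  apply: le1; rewrite -scalerAr -scalerAl rc //.
  by rewrite -scalerAl -scalerAr mulrA.
have -> : t%:C%C *: 1 - h * h = t%:C%C *: (r * r).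
  by rewrite rr scalerBr scalerA -rmorphM /= mulfV ?gt_eqF // scale1r.
by rewrite cnormZr cnorm_selfadj_sqr // gtr0_norm //; nra.
Qed.

Lemma pos_neg_sqr_eq0 h t : star h = h -> 0 < t ->
  cnorm (t%:C%C *: 1 + h * h) <= t -> h = 0.
Proof.
move=> sh t0 ht.
(* With [r^2 = 1 - q (t + h^2) / t] for [0 < q < 1], the two squares
   [q h^2 / t] and [r^2] add up to [1 - q]. *)
have bound q : 0 < q -> q < 1 -> q * t^-1 * cnorm h ^+ 2 <= 1 - q.
  move=> q0 q1; have qt : 0 < q * t^-1 by rewrite mulr_gt0 ?invr_gt0.
  pose s := Num.sqrt (q * t^-1); have ss : s * s = q * t^-1.
    by rewrite -expr2 sqr_sqrtr // ltW.
  have hsh : (s%:C%C *: h) * (s%:C%C *: h) = (q * t^-1)%:C%C *: (h * h).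
    by rewrite -scalerAl -scalerAr scalerA -rmorphM ss.
  have [||r [sr rr rc]] :=
    @selfadj_sqrt ((q * t^-1)%:C%C *: (t%:C%C *: 1 + h * h)).
  - by rewrite starZr starD starZr star1 starM sh.
  - rewrite cnormZr gtr0_norm // mulrAC ltr_pdivrMr // mul1r.
    by have := cnorm_ge0 (t%:C%C *: 1 + h * h); nra.
  have := @two_squares _ _ (s%:C%C *: h) r _ sr.
  have -> : (s%:C%C *: h) * (s%:C%C *: h) + r * r = (1 - q)%:C%C *: 1.
    rewrite hsh rr scalerDr scalerA -rmorphM /= mulfVK ?gt_eqF //.
    rewrite opprD [LHS]addrC -addrA subrK.
    by rewrite rmorphB scalerBl rmorph1 scale1r.
  rewrite [cnorm (_ *: 1)]cnormZr cnorm1 mulr1 starZr sh => /(_ erefl).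
  rewrite cnormZr exprMn real_normK ?num_real // expr2 ss.
  rewrite gtr0_norm ?subr_gt0 //; apply.
  rewrite -scalerAr -scalerAl; congr (_ *: _); apply/esym/rc.
  rewrite -scalerAl -scalerAr mulrDl mulrDr mulrA.
  by rewrite -scalerAl -scalerAr mul1r mulr1.
apply: cnorm0_eq0; apply/eqP; rewrite -sqrf_eq0 eq_le sqr_ge0 andbT.
set m := cnorm h ^+ 2 in bound *; rewrite leNgt; apply/negP => m0.
set k := t^-1 * m; have k0 : 0 < k by rewrite mulr_gt0 ?invr_gt0.
have k1 : 0 < 1 + k by lra.
have := bound ((1 + k / 2) / (1 + k)) _ _.
rewrite divr_gt0 ?ltr_pdivrMr //; try lra.
rewrite -[_ * m]mulrA -/k mul1r => le1.
have : (1 + k / 2) / (1 + k) * (1 + k) <= 1.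
  have : (1 + k / 2) / (1 + k) * k <= 1 - (1 + k / 2) / (1 + k).
    by apply: le1 => //; lra.
  by lra.
by rewrite mulfVK ?gt_eqF //; lra.
Qed.

(** The square of each [h i] is positive and is minus a sum of positive
    elements. *)
Lemma sum_sqr_eq0 (I : finType) (h : I -> A) :
  (forall i, star (h i) = h i) -> \sum_i h i * h i = 0 -> forall i, h i = 0.
Proof.
move=> sh sum0 i.
pose t j := cnorm (h j) ^+ 2 + 1.
have t0 j : 0 < t j by rewrite ltr_wpDl ?sqr_ge0.
have sumle (P : pred I) :
    cnorm ((\sum_(j | P j) t j)%:C%C *: 1 - \sum_(j | P j) h j * h j)
      <= \sum_(j | P j) t j.
  elim/big_rec2: _ => [|j y1 y2 _ IH].
    by rewrite subr0 rmorph0 scale0r cnorm0.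
  rewrite rmorphD scalerDl opprD addrACA.
  apply: le_trans (cnormD _ _) _; apply: lerD IH.
  by apply: selfadj_sqr_pos; rewrite // /t ltrDl.
have hi : h i * h i = - \sum_(j | j != i) h j * h j.
  by apply/eqP; rewrite -addr_eq0; move: sum0; rewrite (bigD1 i) //= => ->.
apply: (@pos_neg_sqr_eq0 _ (t i + \sum_(j | j != i) t j)) => //.
  by rewrite ltr_pwDl // sumr_ge0 // => j _; apply: ltW.
rewrite hi rmorphD scalerDl -addrA; apply: le_trans (cnormD _ _) _.
apply: lerD (sumle _); rewrite cnormZr cnorm1 mulr1.
by rewrite gtr0_norm.
Qed.

(** The real and imaginary parts of the [d i] are self-adjoint, and their
    squares add up to half the sum of the two hypotheses. *)
Lemma sum_star_mul_eq0 (I : finType) (d : I -> A) :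
  \sum_i star (d i) * d i = 0 -> \sum_i d i * star (d i) = 0 ->
  forall i, d i = 0.
Proof.
move=> e1 e2 i.
have ci : ('i%R : R[i]%C)^*%R = - 'i%R by rewrite conjCi.
pose h (p : I * bool) := if p.2 then d p.1 + star (d p.1)
                         else 'i%R *: (d p.1 - star (d p.1)).
have hE j : h (j, true) * h (j, true) + h (j, false) * h (j, false) =
    (star (d j) * d j + d j * star (d j)) *+ 2.
  rewrite /h /= -scalerAl -scalerAr scalerA -(expr2 'i%R) sqrCi scaleN1r.
  set x := d j; set y := star x.
  have -> : (x + y) * (x + y) = (x * x + y * y) + (y * x + x * y).
    rewrite mulrDl !mulrDr [y * x + y * y]addrC addrACA; congr (_ + _).
    exact: addrC.
  have -> : (x - y) * (x - y) = (x * x + y * y) - (y * x + x * y).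
    rewrite mulrBl !mulrBr opprB addrACA; congr (_ + _).
    by rewrite opprD addrC.
  by rewrite opprB [LHS]addrC addrA subrK mulr2n.
have hs p : star (h p) = h p.
  case: p => j []; rewrite /h /=; first by rewrite starD starK addrC.
  by rewrite starZ raddfB /= starK ci scaleNr -scalerN opprB.
have h0 : \sum_p h p * h p = 0.
  rewrite (eq_bigr (fun p => (fun j (c : bool) => h (j, c) * h (j, c)) p.1 p.2));
    last by case.
  rewrite -(pair_bigA _ (fun j (c : bool) => h (j, c) * h (j, c))) /=.
  rewrite (eq_bigr (fun j => (star (d j) * d j + d j * star (d j)) *+ 2)).
    by rewrite sumrMnl big_split /= e1 e2 addr0 mul0rn.
  by move=> j _; rewrite big_bool; apply: hE.
have := sum_sqr_eq0 hs h0 (i, true); have := sum_sqr_eq0 hs h0 (i, false).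
rewrite /h /= => /eqP; rewrite scaler_eq0 => /orP[|].
  by rewrite (negbTE (neq0Ci _)).
rewrite subr_eq0 => /eqP <- /eqP; rewrite -mulr2n -scaler_nat scaler_eq0.
by rewrite pnatr_eq0 /= => /eqP.
Qed.

End PositiveSquares.

(** * Linear algebra over the complex numbers *)

Section LinearAlgebra.
Variables (R : realType).
Local Notation C := R[i]%C.

Definition adjmx m n (M : 'M[C]_(m, n)) : 'M[C]_(n, m) :=
  (map_mx Num.conj M)^T.

Lemma adjmxE m n (M : 'M[C]_(m, n)) i j : adjmx M i j = (M j i)^*%R.
Proof. by rewrite !mxE. Qed.

Lemma adjmxK m n (M : 'M[C]_(m, n)) : adjmx (adjmx M) = M.
Proof. by apply/matrixP => i j; rewrite !adjmxE conjCK. Qed.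

Lemma adjmxM m n p (M : 'M[C]_(m, n)) (N : 'M[C]_(n, p)) :
  adjmx (M *m N) = adjmx N *m adjmx M.
Proof. by rewrite /adjmx map_mxM trmx_mul. Qed.

Lemma mulmx_adjmx_eq0 m n (M : 'M[C]_(m, n)) : M *m adjmx M = 0 -> M = 0.
Proof.
move=> MM0; apply/matrixP => i j; rewrite mxE.
have : (M *m adjmx M) i i = 0 by rewrite MM0 mxE.
rewrite mxE => /eqP; rewrite psumr_eq0; last first.
  by move=> k _; rewrite adjmxE mul_conjC_ge0.
move=> /allP/(_ j (mem_index_enum _)) /=.
by rewrite adjmxE mul_conjC_eq0 => /eqP.
Qed.

Lemma submx_annihilator m n p (v : 'M[C]_(p, n)) (M : 'M[C]_(m, n)) :
  (forall c : 'cV[C]_n, M *m c = 0 -> v *m c = 0) -> (v <= M)%MS.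
Proof.
move=> h; rewrite submxE; apply/eqP/matrixP => i j.
move: (cokermx M) (mulmx_coker M) => K MK.
have := h (col j K); rewrite colE !mulmxA MK mul0mx.
by move=> /(_ erefl)/matrixP/(_ i ord0); rewrite -colE mxE => ->; rewrite !mxE.
Qed.

(** By hypothesis, mapping the [r]-th row of [K] to [x r] defines a linear form on
    the row space; it is represented by a row vector of this space because [K] and
    [K *m adjmx K] have the same column space. *)
Lemma riesz_row_space m n (K : 'M[C]_(m, n)) (x : 'cV[C]_m) :
  (forall t : 'rV[C]_m, t *m K = 0 -> t *m x = 0) ->
  exists z : 'rV[C]_m, x = K *m adjmx (z *m K).
Proof.
move=> h; have : (x^T <= (K *m adjmx K)^T)%MS.
  apply: submx_annihilator => c.
  move=> /(congr1 trmx); rewrite !trmx_mul !trmxK trmx0 => cKK.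
  rewrite -[c]trmxK -trmx_mul h ?trmx0 //; apply: mulmx_adjmx_eq0.
  by rewrite adjmxM mulmxA -(mulmxA _ K) cKK mul0mx.
move=> /submxP[w /(congr1 trmx)]; rewrite trmxK trmx_mul trmxK => ->.
by exists (adjmx w^T); rewrite adjmxM adjmxK mulmxA.
Qed.

End LinearAlgebra.

(** * The Haar state on the coefficients of a unitary representation *)

Lemma lin_indep_spanning (R : realType) (A : cstarType R) (s : seq A) :
  exists r (a : 'I_r -> A), lin_indep a /\
    forall y, y \in s -> exists c : 'I_r -> R[i]%C, y = \sum_i c i *: a i.
Proof.
elim: s => [|y s [r [a [ai ha]]]].
  by exists 0%N, (fun=> 0); split=> // c _ [].
have [[c yc]|ny] := pselect (exists c : 'I_r -> R[i]%C, y = \sum_i c i *: a i).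
  exists r, a; split=> // z; rewrite inE => /orP[/eqP->|/ha //].
  by exists c.
pose b i := oapp a y (unlift ord0 i).
have bE (c : 'I_r.+1 -> R[i]%C) : \sum_i c i *: b i =
    c ord0 *: y + \sum_i c (lift ord0 i) *: a i.
  rewrite big_ord_recl /b unlift_none /=; congr (_ + _).
  by apply: eq_bigr => i _; rewrite liftK.
exists r.+1, b; split=> [c|z].
  rewrite bE; have [e|c0] := eqVneq (c ord0) 0.
    rewrite e scale0r add0r => /ai h i.
    by case: (unliftP ord0 i) => [j ->|->] //; apply: h.
  move=> h; case: ny; exists (fun i => - (c ord0)^-1 * c (lift ord0 i)).
  apply: (scalerI c0); rewrite scaler_sumr.
  move/eqP: h; rewrite addr_eq0 => /eqP ->; rewrite -sumrN.
  by apply: eq_bigr => i _; rewrite scalerA mulrA mulrN mulfV // mulN1r scaleNr.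
rewrite inE => /orP[/eqP->|/ha[c ->]].
  exists (fun i => (i == ord0)%:R); rewrite bE eqxx scale1r big1 ?addr0 //.
  by move=> i _; rewrite scale0r.
exists (fun i => oapp c 0 (unlift ord0 i)); rewrite bE unlift_none /=.
by rewrite scale0r add0r; apply: eq_bigr => i _; rewrite liftK.
Qed.

Section HaarProjection.
Variables (R : realType) (A : compact_quantum_group R) (n : nat).
Local Notation C := R[i]%C.
Variable W : 'I_n -> 'I_n -> A.
Hypothesis coprodW : forall i j,
  qg_coprod (W i j) = \sum_m qg_leg1 (W i m) * qg_leg2 (W m j).
Hypothesis starWW : forall i j, \sum_m star (W m i) * W m j = (i == j)%:R.
Hypothesis WstarW : forall i j, \sum_m W m i * star (W m j) = (i == j)%:R.

Definition fixed_vector (v : 'I_n -> C) :=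
  forall i, \sum_j v j *: W i j = (v i)%:A.

(** Put [d i k = sum_j m j k *: W i j - m i k].  Since the columns of [W], and
    those of its conjugate, are orthonormal, the hypothesis yields
    [sum d^* d = sum d d^* = 0], where positivity forces [d = 0]. *)
Lemma fixed_of_inner_product q (m : 'M[C]_(n, q)) :
  \sum_i \sum_k \sum_j ((m i k)^*%R * m j k) *: W i j =
    (\sum_i \sum_k (m i k)^*%R * m i k)%:A ->
  forall k, fixed_vector (fun i => m i k).
Proof.
move=> mWm; pose S : C := \sum_i \sum_k (m i k)^*%R * m i k; rewrite -/S in mWm.
pose y i k := \sum_j m j k *: W i j.
have SE : \sum_(p : 'I_n * 'I_q) (m p.1 p.2)^*%R * m p.1 p.2 = S.
  by rewrite /S (pair_bigA _ (fun i k => (m i k)^*%R * m i k)).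
have my : \sum_(p : 'I_n * 'I_q) (m p.1 p.2)^*%R *: y p.1 p.2 = S%:A.
  rewrite -mWm [RHS](pair_bigA _ (fun i k => \sum_j _ *: W i j)) /=.
  apply: eq_bigr => p _; rewrite /y scaler_sumr.
  by apply: eq_bigr => j _; rewrite scalerA.
have SR : S^*%R = S.
  rewrite -SE rmorph_sum /=; apply: eq_bigr => p _.
  by rewrite rmorphM /= conjCK mulrC.
have ym : \sum_(p : 'I_n * 'I_q) m p.1 p.2 *: star (y p.1 p.2) = S%:A.
  have /(congr1 (@star R A)) := my; rewrite starZ star1 SR => <-.
  rewrite raddf_sum /=; apply: eq_bigr => p _.
  by rewrite starZ conjCK.
have expand (F G : 'I_n -> 'I_q -> A) (f g : 'I_n -> 'I_q -> C) :
    \sum_(p : 'I_n * 'I_q) F p.1 p.2 * G p.1 p.2 = S%:A ->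
    \sum_(p : 'I_n * 'I_q) g p.1 p.2 *: F p.1 p.2 = S%:A ->
    \sum_(p : 'I_n * 'I_q) f p.1 p.2 *: G p.1 p.2 = S%:A ->
    \sum_(p : 'I_n * 'I_q) f p.1 p.2 * g p.1 p.2 = S ->
    \sum_(p : 'I_n * 'I_q) (F p.1 p.2 - (f p.1 p.2)%:A) *
       (G p.1 p.2 - (g p.1 p.2)%:A) = 0.
  move=> FG Fg fG fg.
  under eq_bigr => p _.
    rewrite mulrBl !mulrBr -!scalerAl !mul1r -!scalerAr mulr1 scalerA.
    over.
  rewrite sumrB 2!sumrB FG Fg fG -scaler_suml fg.
  have S0 (x : A) : x - x - (x - x) = 0 by rewrite !subrr.
  exact: (S0 S%:A).
have d0 : forall p : 'I_n * 'I_q, y p.1 p.2 - (m p.1 p.2)%:A = 0.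
  have sd p : star (y p.1 p.2 - (m p.1 p.2)%:A) =
      star (y p.1 p.2) - ((m p.1 p.2)^*%R)%:A.
    by rewrite raddfB /= starZ star1.
  apply: (@sum_star_mul_eq0 _ _ _ (fun p => y p.1 p.2 - (m p.1 p.2)%:A)).
    under eq_bigr => p _ do rewrite sd.
    apply: (@expand (fun i k => star (y i k)) y (fun i k => (m i k)^*%R) m) => //.
    rewrite -SE scaler_suml.
    rewrite -(pair_bigA _ (fun i k => star (y i k) * y i k)) /=.
    rewrite -(pair_bigA _ (fun i k => ((m i k)^*%R * m i k)%:A)) /=.
    rewrite exchange_big [RHS]exchange_big /=; apply: eq_bigr => k _.
    rewrite /y.
    under eq_bigr => i _.
      rewrite raddf_sum mulr_suml.
      under eq_bigr => j _.
        rewrite mulr_sumr.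
        under eq_bigr => l _ do
          rewrite /= starZ -scalerAl -scalerAr scalerA.
        over.
      over.
    rewrite exchange_big /=; apply: eq_bigr => j _.
    rewrite exchange_big /= (bigD1 j) //= -scaler_sumr starWW eqxx.
    rewrite [X in _ + X]big1 ?addr0 // => l lj.
    by rewrite -scaler_sumr starWW eq_sym (negbTE lj) scaler0.
  under eq_bigr => p _ do rewrite sd.
  apply: (@expand y (fun i k => star (y i k)) m (fun i k => (m i k)^*%R)) => //.
    rewrite -SE scaler_suml.
    rewrite -(pair_bigA _ (fun i k => y i k * star (y i k))) /=.
    rewrite -(pair_bigA _ (fun i k => ((m i k)^*%R * m i k)%:A)) /=.
    rewrite exchange_big [RHS]exchange_big /=; apply: eq_bigr => k _.
    rewrite /y.
    under eq_bigr => i _.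
      rewrite raddf_sum mulr_suml.
      under eq_bigr => j _.
        rewrite mulr_sumr.
        under eq_bigr => l _ do
          rewrite /= starZ -scalerAl -scalerAr scalerA.
        over.
      over.
    rewrite exchange_big /=; apply: eq_bigr => j _.
    rewrite exchange_big /= (bigD1 j) //= -scaler_sumr WstarW eqxx.
    rewrite [X in _ + X]big1 ?addr0 1?mulrC // => l lj.
    by rewrite -scaler_sumr WstarW eq_sym (negbTE lj) scaler0.
  by rewrite -SE; apply: eq_bigr => p _; rewrite mulrC.
move=> k i; apply/eqP; rewrite -subr_eq0; apply/eqP.
exact: (d0 (i, k)).
Qed.

Section Decomposition.
Variables (r : nat) (a : 'I_r -> A) (X : 'I_r -> 'M[C]_n) (x : 'I_r -> C).
Hypothesis a_indep : lin_indep a.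
Hypothesis WX : forall i j, W i j = \sum_s X s i j *: a s.
Hypothesis oneX : 1 = \sum_s x s *: a s.

(* By duality, these are the pairs of values of a linear form on [W] and [1]. *)
Let respects (Y : 'M[C]_n) (y : C) := forall (c : 'M[C]_n) (c0 : C),
  \sum_i \sum_j c i j *: W i j + c0%:A = 0 ->
  \sum_i \sum_j c i j * Y i j + c0 * y = 0.

Let scalar_eq (c d : 'I_r -> C) :
  \sum_s c s *: a s = \sum_s d s *: a s -> forall s, c s = d s.
Proof.
move=> /eqP; rewrite -subr_eq0 -sumrB => /eqP cd s.
apply/eqP; rewrite -subr_eq0; apply/eqP.
apply: (@a_indep (fun s => c s - d s)).
by rewrite -[RHS]cd; apply: eq_bigr => k _; rewrite scalerBl.
Qed.

Let sumWX (c : 'M[C]_n) (c0 : C) : \sum_i \sum_j c i j *: W i j + c0%:A =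
  \sum_s (\sum_i \sum_j c i j * X s i j + c0 * x s) *: a s.
Proof.
rewrite {1}oneX scaler_sumr.
under eq_bigr => i _.
  under eq_bigr => j _ do rewrite WX scaler_sumr.
  rewrite exchange_big /=; over.
rewrite exchange_big -big_split /=; apply: eq_bigr => s _.
rewrite scalerDl scalerA scaler_suml; congr (_ + _).
apply: eq_bigr => i _; rewrite scaler_suml; apply: eq_bigr => j _.
by rewrite scalerA.
Qed.

(* Double annihilation in a finite-dimensional space. *)
Let respects_span Y y : respects Y y ->
  exists t : 'I_r -> C, Y = \sum_s t s *: X s /\ y = \sum_s t s * x s.
Proof.
move=> Yy; pose v Z (z : C) : 'rV[C]_(n * n + 1) := row_mx (mxvec Z) (z%:M).
pose M := \matrix_s v (X s) (x s).
have vc (Z : 'M[C]_n) z (c : 'M[C]_n) (c0 : C) :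
    v Z z *m col_mx (mxvec c)^T c0%:M =
    (\sum_i \sum_j c i j * Z i j + c0 * z)%:M.
  rewrite mul_row_col mul_scalar_mx scale_scalar_mx.
  apply/matrixP => i j; rewrite !ord1 !mxE mulr1n eqxx mulr1n [z * _]mulrC.
  congr (_ + _); rewrite pair_bigA /=.
  rewrite (reindex _ (curry_mxvec_bij _ _)) /=; apply: eq_bigr => -[i' j'] _.
  by rewrite !mxE /= !mxvecE mulrC.
have : (v Y y <= M)%MS.
  apply: submx_annihilator => c Mc.
  have [c1 [c2 cE]] : exists (c1 : 'M[C]_n) (c2 : C),
      c = col_mx (mxvec c1)^T c2%:M.
    exists (vec_mx (usubmx c)^T), (dsubmx c 0 0).
    by rewrite vec_mxK trmxK -mx11_scalar vsubmxK.
  rewrite {}cE in Mc *; rewrite vc Yy ?raddf0 // sumWX big1 // => s _.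
  have : row s M *m col_mx (mxvec c1)^T c2%:M = 0 by rewrite -row_mul Mc row0.
  rewrite rowK vc => /matrixP/(_ 0 0).
  rewrite [X in X = _]mxE [X in _ = X]mxE eqxx mulr1n => cX0.
  by rewrite -[RHS](scale0r (a s)); congr (_ *: _); exact: cX0.
move=> /submxP[t vt]; exists (t 0).
have : v Y y = \sum_s t 0 s *: v (X s) (x s).
  rewrite vt mulmx_sum_row; apply: eq_bigr => s _.
  by rewrite rowK.
have -> : \sum_s t 0 s *: v (X s) (x s) =
    v (\sum_s t 0 s *: X s) (\sum_s t 0 s * x s).
  rewrite /v !raddf_sum /=; apply/esym.
  elim/big_ind3: _ => [|u1 u2 v1 v2 w1 w2 <- <-|s _].
  - by rewrite row_mx0.
  - by rewrite add_row_mx.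
  - by rewrite linearZ /= scale_row_mx scale_scalar_mx.
move=> /eq_row_mx[/(can_inj mxvecK) -> /matrixP/(_ 0 0)].
by rewrite !mxE eqxx !mulr1n => ->.
Qed.

(** The coproduct of a linear relation between the coefficients, expanded in
    the [a s] on the left leg, is again a family of linear relations. *)
Let respectsM s Y y : respects Y y -> respects (X s *m Y) (x s * y).
Proof.
move=> Yy c c0 rel.
have [tens _ _] := @qg_tensor2 _ A.
have [[l1_1 l1D l1Z _ _] [l2_1 l2D l2Z _ _] _ tinj] := tens.
have [D1 DD DZ _ _] := @qg_coprod_hom _ A.
have sumhom (E : cstarType R) (f : A -> E) (J : finType) (F : J -> A) :
  (forall x y, setT x -> setT y -> f (x + y) = f x + f y) ->
  (forall (k : C) x, setT x -> f (k *: x) = k *: f x) ->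
  f (\sum_j F j) = \sum_j f (F j).
  move=> fD fZ; elim/big_ind2: _ => [|u1 u2 v1 v2 <- <-|//].
    by have := fZ 0 0 I; rewrite !scale0r.
  by rewrite fD.
pose b s := \sum_i \sum_j (\sum_k c k j * X s k i) *: W i j + (c0 * x s)%:A.
have /tinj : \sum_s qg_leg1 (a s) * qg_leg2 (b s) = 0.
  have /(congr1 (@qg_coprod R A)) := rel.
  have -> : qg_coprod (0 : A) = 0.
    by have := DZ 0 0 I; rewrite !scale0r.
  rewrite DD // DZ // D1 sumhom // => rel2; apply: etrans rel2; apply/esym.
  under eq_bigr => i _.
    rewrite sumhom //.
    under eq_bigr => j _.
      rewrite DZ // coprodW scaler_sumr.
      under eq_bigr => m _.
        rewrite WX sumhom // mulr_suml scaler_sumr.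
        under eq_bigr => k _ do
          rewrite l1Z // -scalerAl scalerA scalerAr -l2Z //.
        over.
      rewrite exchange_big /=; over.
    rewrite exchange_big /=; over.
  rewrite exchange_big /=.
  have -> : (1 : qg_alg2 A) = \sum_s qg_leg1 (x s *: a s) * qg_leg2 1.
    by rewrite -mulr_suml -sumhom // -oneX l1_1 l2_1 mulr1.
  rewrite scaler_sumr -big_split /=; apply: eq_bigr => k _.
  rewrite l1Z // -scalerAl scalerA scalerAr -l2Z //.
  under eq_bigr => i _ do
    (under eq_bigr => j _ do (rewrite -mulr_sumr -sumhom //);
     rewrite -mulr_sumr -sumhom //).
  rewrite -mulr_sumr -sumhom // -mulrDr -l2D //; congr (_ * qg_leg2 (_ + _)).
  under eq_bigr => i _ do rewrite exchange_big /=.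
  rewrite exchange_big /=; apply: eq_bigr => m _.
  rewrite exchange_big /=; apply: eq_bigr => j _.
  by rewrite scaler_suml.
move=> /(_ a_indep)/(_ s) bs.
pose c' : 'M[C]_n := \matrix_(i, j) \sum_k c k j * X s k i.
have /Yy : \sum_i \sum_j c' i j *: W i j + (c0 * x s)%:A = 0.
  rewrite -[RHS]bs; congr (_ + _); apply: eq_bigr => i _.
  by apply: eq_bigr => j _; rewrite mxE.
move=> rel2; apply: etrans rel2; rewrite mulrA; congr (_ + _).
under eq_bigr => i _ do
  under eq_bigr => j _ do rewrite mxE mulr_sumr.
under [RHS]eq_bigr => i _ do
  under eq_bigr => j _ do rewrite mxE mulr_suml.
rewrite [RHS]exchange_big /=.
under [RHS]eq_bigr => i _ do rewrite exchange_big /=.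
rewrite [RHS]exchange_big /=; apply: eq_bigr => i _.
rewrite [LHS]exchange_big /= [LHS]exchange_big /=.
apply: eq_bigr => j _.
by apply: eq_bigr => k _; rewrite mulrA.
Qed.

Variable P : 'M[C]_n.
Hypothesis PP : P *m P = P.
Hypothesis adjP : adjmx P = P.
Hypothesis fixP : forall j, fixed_vector (fun i => P i j).
Hypothesis Pfix : forall v, fixed_vector v ->
  forall i, \sum_j P i j * v j = v i.

Let XP s : X s *m P = x s *: P.
Proof.
apply/matrixP => i j; rewrite !mxE.
have := fixP j i; rewrite oneX scaler_sumr.
under eq_bigr => k _ do rewrite WX scaler_sumr.
rewrite exchange_big /=; under eq_bigr => k _.
  under eq_bigr => l _ do rewrite scalerA mulrC.
  rewrite -scaler_suml; over.
under [RHS]eq_bigr => k _ do rewrite scalerA mulrC.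
by move=> /scalar_eq/(_ s).
Qed.

Let PX s : P *m X s = x s *: P.
Proof.
apply/matrixP => i j; rewrite !mxE.
have Pconj k l : (P k l)^*%R = P l k.
  by rewrite -adjmxE adjP.
have : \sum_m P i m *: W m j = (P i j)%:A.
  (* [W^* v = v] for a fixed vector [v], since [W^* W = 1] *)
  have : \sum_m P m i *: star (W m j) = (P j i)%:A.
    under eq_bigr => m _ do
      rewrite -[star _]mulr1 scalerAr -(fixP i m) mulr_sumr.
    rewrite exchange_big /= (bigD1 j) //= [X in _ + X]big1 ?addr0 => [|k kj].
      under eq_bigr => m _ do rewrite -scalerAr.
      by rewrite -scaler_sumr starWW eqxx.
    under eq_bigr => m _ do rewrite -scalerAr.
    by rewrite -scaler_sumr starWW eq_sym (negbTE kj) scaler0.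
  move=> /(congr1 (@star R A)); rewrite starZ star1 Pconj raddf_sum /= => <-.
  by apply: eq_bigr => m _; rewrite starZ starK Pconj.
rewrite oneX scaler_sumr.
under eq_bigr => k _ do rewrite WX scaler_sumr.
rewrite exchange_big /=; under eq_bigr => k _.
  under eq_bigr => l _ do rewrite scalerA.
  rewrite -scaler_suml; over.
under [RHS]eq_bigr => k _ do rewrite scalerA mulrC.
by move=> /scalar_eq/(_ s).
Qed.

Let respectsX s : respects (X s) (x s).
Proof. by move=> c c0; rewrite sumWX => /a_indep/(_ s). Qed.

Let respects_comb (t : 'I_r -> C) :
  respects (\sum_s t s *: X s) (\sum_s t s * x s).
Proof.
move=> c c0 rel.
suff -> : \sum_i \sum_j c i j * (\sum_s t s *: X s) i j + c0 * (\sum_s t s * x s) =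
    \sum_s t s * (\sum_i \sum_j c i j * X s i j + c0 * x s).
  by rewrite big1 // => s _; rewrite respectsX // mulr0.
under [RHS]eq_bigr => s _ do rewrite mulrDr mulrCA.
rewrite big_split /= -mulr_sumr; congr (_ + _).
under eq_bigr => i _.
  under eq_bigr => j _.
    rewrite summxE mulr_sumr; under eq_bigr => s _ do rewrite mxE mulrCA.
    over.
  rewrite exchange_big /=; under eq_bigr => s _ do rewrite -mulr_sumr.
  over.
by rewrite exchange_big /=; apply: eq_bigr => s _; rewrite mulr_sumr.
Qed.

Let inner (U V : 'M[C]_n) := \sum_i \sum_j U i j * (V i j)^*%R.

Let inner_sum (t : 'I_r -> C) (U : 'I_r -> 'M[C]_n) V :
  inner (\sum_s t s *: U s) V = \sum_s t s * inner (U s) V.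
Proof.
rewrite /inner; under eq_bigr => i _.
  under eq_bigr => j _.
    rewrite summxE mulr_suml; under eq_bigr => s _ do rewrite mxE -mulrA.
    over.
  rewrite exchange_big /=; under eq_bigr => s _ do rewrite -mulr_sumr.
  over.
by rewrite exchange_big /=; apply: eq_bigr => s _; rewrite mulr_sumr.
Qed.

(** If [(P, 1)] is not in the span of the [(X s, x s)], then
    [X s *m (1 - P) |-> x s] is a well-defined linear form, hence an inner product with some [m = Y *m (1 - P)], and multiplicativity turns this
    into [inner (X s *m m) m = x s * inner m m].  So the columns of [m] are
    fixed, although [P *m m = 0]; thus [m = 0], and all [x s] vanish. *)
Let respects_projection : respects P 1.
Proof.
pose Q := 1%:M - P.
have PQ : P *m Q = 0 by rewrite mulmxBr mulmx1 PP subrr.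
pose K := \matrix_s mxvec (X s *m Q); pose xv : 'cV[C]_r := \col_s x s.
have tK (t : 'rV[C]_r) : t *m K = mxvec ((\sum_s t 0 s *: X s) *m Q).
  rewrite mulmx_sum_row mulmx_suml linear_sum; apply: eq_bigr => s _.
  by rewrite rowK -scalemxAl linearZ_LR.
have tx (t : 'rV[C]_r) : (t *m xv) 0 0 = \sum_s t 0 s * x s.
  by rewrite mxE; apply: eq_bigr => s _; rewrite mxE.
have [[t [tK0 tx0]]|nt] := pselect (exists t : 'rV[C]_r,
    t *m K = 0 /\ (t *m xv) 0 0 != 0).
  set y := (t *m xv) 0 0 in tx0.
  have XPy : \sum_s t 0 s *: X s = y *: P.
    have : (\sum_s t 0 s *: X s) *m Q = 0.
      by apply: (can_inj mxvecK); rewrite -tK tK0 linear0.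
    rewrite mulmxBr mulmx1 => /eqP; rewrite subr_eq0 => /eqP ->.
    rewrite mulmx_suml /y tx scaler_suml; apply: eq_bigr => s _.
    by rewrite -scalemxAl XP scalerA.
  move=> c c0 /(respects_comb (t 0)); rewrite XPy -tx -/y => rel.
  apply: (mulfI tx0); rewrite mulr0 -[RHS]rel mulrDr mulr1 [y * c0]mulrC.
  congr (_ + _); rewrite mulr_sumr; apply: eq_bigr => i _.
  by rewrite mulr_sumr; apply: eq_bigr => j _; rewrite mxE mulrCA.
have [t tK0|z xz] := @riesz_row_space _ _ _ K xv.
  apply/matrixP => i j; rewrite !ord1 [RHS]mxE; apply/eqP/negPn/negP => ne.
  by apply: nt; exists t.
pose Y := \sum_s z 0 s *: X s; pose y := \sum_s z 0 s * x s.
pose m := Y *m Q.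
have inm s : inner (X s *m Q) m = x s.
  have /matrixP/(_ s 0) := xz; rewrite tK -/Y -/m [LHS]mxE => ->.
  rewrite mxE /inner pair_bigA /=.
  rewrite [RHS](reindex _ (curry_mxvec_bij _ _)) /=.
  apply: eq_bigr => -[i j] _.
  by rewrite /= [K _ _]mxE mxvecE adjmxE mxvecE.
have mm : inner m m = y.
  rewrite {1}/m /Y mulmx_suml.
  under [X in inner X _]eq_bigr => s _ do rewrite -scalemxAl.
  by rewrite inner_sum; apply: eq_bigr => s _; rewrite inm.
have Xmm s : inner (X s *m m) m = x s * y.
  have [t [XY ->]] := respects_span (respectsM s (respects_comb (z 0))).
  rewrite {1}/m mulmxA XY mulmx_suml.
  under [X in inner X _]eq_bigr => k _ do rewrite -scalemxAl.
  by rewrite inner_sum; apply: eq_bigr => k _; rewrite inm.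
have mfix k : fixed_vector (fun i => m i k).
  apply: fixed_of_inner_product.
  have -> : \sum_i \sum_k (m i k)^*%R * m i k = y.
    by rewrite -mm; do 2!apply: eq_bigr => ? _; rewrite mulrC.
  rewrite [in RHS]oneX scaler_sumr.
  under [RHS]eq_bigr => s _ do rewrite scalerA mulrC -Xmm /inner scaler_suml.
  rewrite [RHS]exchange_big /=; apply: eq_bigr => i _.
  under [RHS]eq_bigr => s _ do rewrite scaler_suml.
  rewrite [RHS]exchange_big /=; apply: eq_bigr => l _.
  under [LHS]eq_bigr => j _ do rewrite WX scaler_sumr.
  rewrite [LHS]exchange_big /=; apply: eq_bigr => s _.
  rewrite [(X s *m m) i l]mxE mulr_suml scaler_suml; apply: eq_bigr => j _.
  rewrite scalerA; congr (_ *: _).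
  by rewrite -[LHS]mulrA [LHS]mulrC [m j l * _]mulrC.
have m0 : m = 0.
  have <- : P *m m = m.
    apply/matrixP => i k; rewrite mxE.
    exact: (Pfix (mfix k)).
  rewrite /m mulmxA /Y mulmx_sumr mulmx_suml big1 // => s _.
  by rewrite -scalemxAr PX -2!scalemxAl PQ !scaler0.
have x0 s : x s = 0.
  rewrite -inm m0 /inner big1 // => i _; rewrite big1 // => j _.
  by rewrite [(0 : 'M[C]_n) i j]mxE conjC0 mulr0.
have /eqP := oneX; rewrite big1 ?oner_eq0 // => s _.
by rewrite x0 scale0r.
Qed.

Lemma respects_projection_of_decomposition (c : 'M[C]_n) (c0 : C) :
  \sum_i \sum_j c i j *: W i j + c0%:A = 0 ->
  \sum_i \sum_j c i j * P i j + c0 = 0.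
Proof. by move=> /respects_projection; rewrite mulr1. Qed.

End Decomposition.

(** The orthogonal projection onto the fixed vectors is the matrix of the Haar
    state, which is thus well defined on the span of the coefficients. *)
Lemma haar_projection (P : 'M[C]_n) : P *m P = P -> adjmx P = P ->
  (forall j, fixed_vector (fun i => P i j)) ->
  (forall v, fixed_vector v -> forall i, \sum_j P i j * v j = v i) ->
  forall (c : 'M[C]_n) (c0 : C),
    \sum_i \sum_j c i j *: W i j + c0%:A = 0 ->
    \sum_i \sum_j c i j * P i j + c0 = 0.
Proof.
move=> PP adjP fixP Pfix.
have [r [a [ai ha]]] :=
  lin_indep_spanning ((1 : A) :: [seq W p.1 p.2 | p <- enum {: 'I_n * 'I_n}]).
have [x oneX] := ha 1 (mem_head _ _).
have hW (p : 'I_n * 'I_n) :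
    exists c : 'I_r -> C, W p.1 p.2 = \sum_i c i *: a i.
  apply: ha; rewrite inE; apply/orP; right.
  by apply/mapP; exists p => //; rewrite mem_enum.
have [X WX] := choice hW.
apply: (@respects_projection_of_decomposition _ a
  (fun s => \matrix_(i, j) X (i, j) s) x) => // i j.
by rewrite (WX (i, j)); apply: eq_bigr => s _; rewrite mxE.
Qed.

End HaarProjection.

(** * Relations between coefficients are determined by self-intertwiners *)

Section Orthonormal.
Variables (R : realType) (n : nat).
Local Notation C := R[i]%C.

(** An orthonormal family of maximal size in [S] is a basis, since otherwise the
    normalised residual of a vector could be added to it. *)
Lemma exists_orthonormal_basis (S : 'rV[C]_n -> Prop) :
  (forall u v, S u -> S v -> S (u + v)) -> (forall c u, S u -> S (c *: u)) ->
  exists d (B : 'M[C]_(d, n)), [/\ forall i, S (row i B), B *m adjmx B = 1%:M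
    & forall v, S v -> v = v *m adjmx B *m B].
Proof.
move=> SD SZ.
pose good d := `[< exists B : 'M[C]_(d, n),
  (forall i, S (row i B)) /\ B *m adjmx B = 1%:M >].
have good0 : good 0%N.
  by apply/asboolP; exists 0; split=> [[]//|]; apply/matrixP => -[].
have goodn d : good d -> (d <= n)%N.
  move=> /asboolP[B [_ BB]]; have := mulmx_max_rank B (adjmx B).
  by rewrite BB mxrank1.
have [d /asboolP[B [SB BB]] dmax] := ex_maxnP (ex_intro (fun d => good d) _ good0) goodn.
exists d, B; split=> // v Sv; apply/eqP; rewrite -subr_eq0; apply/negPn/negP => w0.
set w := v - _ in w0.
have wB : w *m adjmx B = 0 by rewrite mulmxBl -!mulmxA BB mulmx1 subrr.
have Sw : S w.
  apply: (SD) => //; rewrite -scaleN1r; apply: (SZ); rewrite mulmx_sum_row.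
  have S0 : S 0 by rewrite -(scale0r v); apply: (SZ).
  by elim/big_ind: _ => // i _; apply: (SZ).
pose s := (w *m adjmx w) 0 0.
have ws : w *m adjmx w = s%:M by rewrite -mx11_scalar.
have s_ge0 : 0 <= s.
  by rewrite /s mxE sumr_ge0 // => i _; rewrite adjmxE mul_conjC_ge0.
have s_neq0 : s != 0.
  move: w0; apply: contraNneq => s0; apply/eqP/mulmx_adjmx_eq0.
  by rewrite ws s0 raddf0.
pose q := (sqrtC s)^-1; have qR : q^*%R = q.
  by apply/CrealP; rewrite ger0_real // invr_ge0 sqrtC_ge0.
have qqs : q * q * s = 1.
  by rewrite -expr2 exprVn sqrtCK mulVf.
have : (d.+1 <= d)%N; last by rewrite ltnn.
apply: dmax; rewrite -addn1; apply/asboolP; exists (col_mx B (q *: w)); split.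
  move=> i; case: (split_ordP i) => j ->.
    by rewrite rowKu.
  by rewrite rowKd ord1 row_id; apply: SZ.
have adjc : adjmx (col_mx B (q *: w)) = row_mx (adjmx B) (q *: adjmx w).
  rewrite /adjmx map_col_mx tr_col_mx map_mxZ linearZ /=.
  by congr (row_mx _ (_ *: _)).
rewrite adjc mul_col_row -!scalemxAl -!scalemxAr BB wB !scaler0.
have -> : B *m adjmx w = 0.
  by rewrite -[LHS]adjmxK adjmxM adjmxK wB /adjmx map_mx0 trmx0.
rewrite scaler0 ws scalerA scale_scalar_mx qqs.
by rewrite (scalar_mx_block d 1).
Qed.

End Orthonormal.

Section Relations.
Variables (R : realType) (A : compact_quantum_group R) (n : nat).
Local Notation C := R[i]%C.
Variable W : 'I_n -> 'I_n -> A.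
Hypothesis coprodW : forall i j,
  qg_coprod (W i j) = \sum_m qg_leg1 (W i m) * qg_leg2 (W m j).
Hypothesis starWW : forall i j, \sum_m star (W m i) * W m j = (i == j)%:R.
Hypothesis WstarW : forall i j, \sum_m W m i * star (W m j) = (i == j)%:R.
Hypothesis WWstar : forall i j, \sum_m W i m * star (W j m) = (i == j)%:R.

Definition commutes (B : lmodType C) (V : 'I_n -> 'I_n -> B) (T : 'M[C]_n) :=
  forall i j, \sum_k T i k *: V k j = \sum_k T k j *: V i k.

Let pairT : finType := ('I_n * 'I_n)%type.
Let N := #|pairT|.
(* The tensor product of [W] with its conjugate. *)
Let Zp (p q : pairT) : A := W p.1 q.1 * star (W p.2 q.2).
Let Z (i j : 'I_N) : A := Zp (enum_val i) (enum_val j).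
Let ev (T : 'M[C]_n) : 'rV[C]_N :=
  \row_i T (enum_val i).1 (enum_val i).2.
Let ve (v : 'rV[C]_N) : 'M[C]_n := \matrix_(i, j) v 0 (enum_rank (i, j)).

Let veK : cancel ve ev.
Proof.
by move=> v; apply/rowP => i; rewrite !mxE -surjective_pairing enum_valK.
Qed.

Let sumN (M : nmodType) (F : pairT -> M) :
  \sum_(i < N) F (enum_val i) = \sum_i \sum_j F (i, j).
Proof.
rewrite pair_bigA /= (reindex _ (onW_bij _ (@enum_rank_bij pairT))) /=.
by apply: eq_bigr => -[i j] _; rewrite enum_rankK.
Qed.

Let fixedE (T : 'M[C]_n) : fixed_vector Z (fun i => ev T 0 i) <->
  forall i i',
    \sum_j \sum_j' T j j' *: (W i j * star (W i' j')) = (T i i')%:A.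
Proof.
split=> [fT i i'|fT i].
  have := fT (enum_rank (i, i')).
  under eq_bigr => k _ do rewrite /Z /Zp mxE enum_rankK.
  rewrite (sumN (fun p => T p.1 p.2 *: (W i p.1 * star (W i' p.2)))) /= => ->.
  by rewrite mxE enum_rankK.
under eq_bigr => k _ do rewrite /Z /Zp mxE.
rewrite (sumN (fun p => T p.1 p.2 *:
  (W (enum_val i).1 p.1 * star (W (enum_val i).2 p.2)))) /= fT.
by rewrite mxE.
Qed.

Let fixed_commutes (T : 'M[C]_n) :
  fixed_vector Z (fun i => ev T 0 i) <-> commutes W T.
Proof.
rewrite fixedE; split=> [fT i m|cT i i'].
  have : \sum_i' (\sum_j \sum_j' T j j' *: (W i j * star (W i' j'))) * W i' m =
      \sum_i' T i i' *: W i' m.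
    by apply: eq_bigr => i' _; rewrite fT -scalerAl mul1r.
  move=> <-; under eq_bigr => i' _.
    rewrite mulr_suml; under eq_bigr => j _.
      rewrite mulr_suml; under eq_bigr => j' _ do rewrite -scalerAl -mulrA.
      over.
    over.
  rewrite exchange_big /=; apply: eq_bigr => j _.
  rewrite exchange_big /= (bigD1 m) //= [X in _ + X]big1 ?addr0.
    by rewrite -scaler_sumr -mulr_sumr starWW eqxx mulr1.
  move=> j' j'm.
  by rewrite -scaler_sumr -mulr_sumr starWW (negbTE j'm) mulr0 scaler0.
rewrite exchange_big /=.
under eq_bigr => j' _.
  under eq_bigr => j _ do rewrite scalerAl.
  rewrite -mulr_suml -cT mulr_suml; over.
rewrite exchange_big /= (bigD1 i') //= [X in _ + X]big1 ?addr0.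
  under eq_bigr => j' _ do rewrite -scalerAl.
  by rewrite -scaler_sumr WWstar eqxx.
move=> k ki'; under eq_bigr => j' _ do rewrite -scalerAl.
by rewrite -scaler_sumr WWstar (negbTE ki') scaler0.
Qed.

(* [T] commutes with [W] if and only if [W T W^* = T], a condition that is stable
   under adjoints. *)
Let commutes_adj (T : 'M[C]_n) : commutes W T -> commutes W (adjmx T).
Proof.
rewrite -!fixed_commutes !fixedE => fT i i'.
have /(congr1 (@star R A)) := fT i' i.
rewrite starZ star1 adjmxE => <-; rewrite raddf_sum exchange_big /=.
apply: eq_bigr => k _; rewrite raddf_sum; apply: eq_bigr => l _.
by rewrite /= starZ starM starK adjmxE.
Qed.

Let commutesM (S T : 'M[C]_n) :
  commutes W S -> commutes W T -> commutes W (S *m T).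
Proof.
move=> cS cT i j.
under eq_bigr => k _ do rewrite mxE scaler_suml.
rewrite exchange_big /=.
under eq_bigr => l _.
  under eq_bigr => k _ do rewrite -scalerA.
  rewrite -scaler_sumr cT scaler_sumr.
  under eq_bigr => k _ do rewrite scalerA mulrC -scalerA.
  over.
rewrite exchange_big /=.
under eq_bigr => k _ do rewrite -scaler_sumr cS scaler_sumr.
rewrite exchange_big /=; apply: eq_bigr => k _.
rewrite mxE scaler_suml; apply: eq_bigr => l _.
by rewrite scalerA mulrC.
Qed.

Let commutes1 : commutes W 1%:M.
Proof.
move=> i j; rewrite (bigD1 i) //= [RHS](bigD1 j) //= !mxE !eqxx.
rewrite !big1 // => k ki; rewrite mxE ?(negbTE ki) ?scale0r //.
by rewrite eq_sym (negbTE ki) scale0r.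
Qed.

(* The last clause holds because the Haar state vanishes at the product of
   [sum c i j *: W i j] with [star (W k l)]: the projection onto the fixed
   vectors of the tensor product of [W] with its conjugate is [sum_a T a (T a)^*],
   where the [T a] are seen as vectors. *)
Let exists_basis : exists d (T : 'I_d -> 'M[C]_n),
  [/\ forall a, commutes W (T a),
      forall S, commutes W S ->
        S = \sum_a \tr (S *m adjmx (T a)) *: T a
    & forall c : 'M[C]_n, \sum_i \sum_j c i j *: W i j = 0 ->
      forall k l,
        \sum_i \sum_j c i j * \sum_a T a i k * (T a j l)^*%R = 0].
Proof.
pose S (v : 'rV[C]_N) := fixed_vector Z (fun i => v 0 i).
have SD u v : S u -> S v -> S (u + v).
  move=> Su Sv i; rewrite mxE scalerDl -Su -Sv -big_split /=.
  by apply: eq_bigr => j _; rewrite mxE scalerDl.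
have SZ c u : S u -> S (c *: u).
  move=> Su i; rewrite mxE -scalerA -Su scaler_sumr.
  by apply: eq_bigr => j _; rewrite mxE scalerA.
have [d [B [SB BB Bv]]] := exists_orthonormal_basis SD SZ.
have ipE (U V : 'M[C]_n) : (ev U *m adjmx (ev V)) 0 0 = \tr (U *m adjmx V).
  rewrite mxE; under eq_bigr => i _ do rewrite adjmxE !mxE.
  rewrite (sumN (fun p => U p.1 p.2 * (V p.1 p.2)^*%R)) /=.
  apply: eq_bigr => i _; rewrite mxE; apply: eq_bigr => j _.
  by rewrite adjmxE.
have veE a : ev (ve (row a B)) = row a B by exact: veK.
exists d, (fun a => ve (row a B)); split.
- by move=> a; rewrite -fixed_commutes veE; exact: SB.
- move=> U; rewrite -fixed_commutes => /Bv UE.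
  apply/matrixP => i j.
  have /rowP/(_ (enum_rank (i, j))) := UE.
  rewrite mxE enum_rankK /= => ->; rewrite mxE summxE; apply: eq_bigr => a _.
  rewrite mxE -ipE veE !mxE; congr (_ * _).
  by apply: eq_bigr => k _; rewrite !mxE.
move=> c cW k l.
pose P : 'M[C]_N := B^T *m map_mx Num.conj B.
have PE i j : P i j = \sum_a B a i * (B a j)^*%R.
  by rewrite mxE; apply: eq_bigr => a _; rewrite !mxE.
have BBc : map_mx Num.conj B *m B^T = 1%:M.
  rewrite -[LHS]trmxK trmx_mul trmxK -/(adjmx B) BB.
  by rewrite trmx1.
have PP : P *m P = P by rewrite /P mulmxA -(mulmxA _ _ B^T) BBc mulmx1.
have adjP : adjmx P = P.
  apply/matrixP => i j; rewrite adjmxE !PE rmorph_sum /=.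
  by apply: eq_bigr => a _; rewrite rmorphM /= conjCK mulrC.
have fixP j : fixed_vector Z (fun i => P i j).
  have : S (\sum_a (B a j)^*%R *: row a B).
    have S0 : S 0.
      by move=> i; rewrite mxE scale0r big1 // => j' _; rewrite mxE scale0r.
    by elim/big_ind: _ => // a _; apply: (SZ).
  have E i : (\sum_a (B a j)^*%R *: row a B) 0 i = P i j.
    by rewrite summxE PE; apply: eq_bigr => a _; rewrite !mxE mulrC.
  move=> SP i; have := SP i; rewrite E => <-.
  by apply: eq_bigr => i' _; rewrite E.
have Pfix v : fixed_vector Z v -> forall i, \sum_j P i j * v j = v i.
  move=> fv i; have /Bv/rowP/(_ i) : S (\row_i v i).
    move=> i'; rewrite mxE -fv; apply: eq_bigr => j _; by rewrite mxE.
  rewrite mxE => ->; rewrite mxE.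
  under [RHS]eq_bigr => a _.
    rewrite mxE mulr_suml; under eq_bigr => j _ do rewrite adjmxE mxE.
    over.
  rewrite exchange_big /=; apply: eq_bigr => j _.
  rewrite PE mulr_suml; apply: eq_bigr => a _.
  by rewrite mulrC mulrA mulrAC.
have ZZ1 i j : \sum_m star (Z m i) * Z m j = (i == j)%:R.
  rewrite /Z (sumN (fun p => star (Zp p (enum_val i)) * Zp p (enum_val j))).
  rewrite /Zp /=; set p := enum_val i; set q := enum_val j.
  rewrite exchange_big /=.
  under eq_bigr => m' _.
    under eq_bigr => m _ do
      rewrite starM starK -mulrA [star (W m p.1) * _]mulrA.
    rewrite -mulr_sumr -mulr_suml starWW mulr_natl.
    rewrite mulrnAr; over.
  rewrite sumrMnl WstarW.
  rewrite -(inj_eq enum_val_inj) -/p -/q -mulrnA mulnb.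
  by rewrite -pair_eqE /= andbC.
have ZZ2 i j : \sum_m Z m i * star (Z m j) = (i == j)%:R.
  rewrite /Z (sumN (fun p => Zp p (enum_val i) * star (Zp p (enum_val j)))).
  rewrite /Zp /=; set p := enum_val i; set q := enum_val j.
  under eq_bigr => m _.
    under eq_bigr => m' _ do
      rewrite starM starK -mulrA [star (W m' p.2) * _]mulrA.
    rewrite -mulr_sumr -mulr_suml starWW mulr_natl.
    rewrite mulrnAr; over.
  rewrite sumrMnl WstarW.
  rewrite -(inj_eq enum_val_inj) -/p -/q -mulrnA mulnb.
  by rewrite -pair_eqE /= andbC.
have coZ i j : qg_coprod (Z i j) = \sum_m qg_leg1 (Z i m) * qg_leg2 (Z m j).
  have [tens _ _] := @qg_tensor2 _ A; have [l1 l2 comm _] := tens.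
  have [_ _ _ l1M l1s] := l1; have [_ _ _ l2M l2s] := l2.
  have [_ _ _ DM Ds] := @qg_coprod_hom _ A.
  rewrite /Z (sumN (fun p => qg_leg1 (Zp (enum_val i) p) *
    qg_leg2 (Zp p (enum_val j)))) /Zp /= DM // Ds // !coprodW.
  rewrite raddf_sum mulr_suml; apply: eq_bigr => m _.
  rewrite mulr_sumr; apply: eq_bigr => m' _.
  rewrite /= starM -l1s // -l2s // -comm l1M // l2M //.
  by rewrite -!mulrA; congr (_ * _); rewrite !mulrA comm.
pose c' : 'M[C]_N := \matrix_(p, q)
  ((((enum_val p).2 == k) && ((enum_val q).2 == l))%:R *
    c (enum_val p).1 (enum_val q).1).
have collapse (M : lmodType C) (F : 'I_N -> 'I_N -> M) :
    \sum_i \sum_j c' i j *: F i j =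
    \sum_i \sum_j c i j *: F (enum_rank (i, k)) (enum_rank (j, l)).
  pose G p q := (((p.2 == k) && (q.2 == l))%:R * c p.1 q.1) *:
    F (enum_rank p) (enum_rank q).
  transitivity (\sum_(i < N) \sum_(j < N) G (enum_val i) (enum_val j)).
    apply: eq_bigr => i _; apply: eq_bigr => j _.
    by rewrite /G !enum_valK mxE.
  under eq_bigr => i _ do rewrite (sumN (G (enum_val i))).
  rewrite (sumN (fun p => \sum_i \sum_j G p (i, j))).
  apply: eq_bigr => i _; rewrite (bigD1 k) //= [X in _ + X]big1 ?addr0.
    apply: eq_bigr => j _; rewrite (bigD1 l) //= [X in _ + X]big1 ?addr0.
      by rewrite /G /= !eqxx mul1r.
    by move=> q /negbTE ql; rewrite /G /= ql andbF mul0r scale0r.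
  move=> q /negbTE qk; rewrite big1 // => j _; rewrite big1 // => q' _.
  by rewrite /G /= qk mul0r scale0r.
have := @haar_projection R A N Z coZ ZZ1 ZZ2 P PP adjP fixP Pfix c' 0.
rewrite collapse scale0r addr0 addr0 (collapse C^o P).
have -> : \sum_i \sum_j c i j *: Z (enum_rank (i, k)) (enum_rank (j, l)) = 0.
  rewrite /Z /Zp; under eq_bigr => i _.
    under eq_bigr => j _ do rewrite !enum_rankK /= scalerAl.
    rewrite -mulr_suml; over.
  by rewrite -mulr_suml cW mul0r.
move=> /(_ erefl) cP; apply: etrans cP; apply: eq_bigr => i _.
apply: eq_bigr => j _; rewrite PE; congr (_ * _); apply: eq_bigr => a _.
by rewrite !mxE.
Qed.

(** Let [T a] be an orthonormal basis of the commutant of [W].  For a suitable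
    matrix [K], one has [sum_a T a K (T a)^* = 1].  As [V] commutes with the [T a],
    it follows that [V = sum_a T a (V K) (T a)^*], so that [sum c i j *: V i j] is a
    linear combination of the [V l k] whose coefficients are multiples of the
    values of the Haar state at the products of [sum c i j *: W i j] with the
    [star (W l k')]. *)
Lemma relation_transfer (B : lmodType C) (V : 'I_n -> 'I_n -> B) :
  (forall T, commutes W T -> commutes V T) ->
  forall c : 'M[C]_n, \sum_i \sum_j c i j *: W i j = 0 ->
    \sum_i \sum_j c i j *: V i j = 0.
Proof.
move=> WV c cW; have [d [T [WT span /(_ c cW) cT]]] := exists_basis.
(* [Z0] is the Casimir element of the commutant for the inner product given by
   the trace, hence central. *)
pose Z0 := \sum_a T a *m adjmx (T a).
have Z0C S : commutes W S -> S *m Z0 = Z0 *m S.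
  move=> cS; rewrite mulmx_sumr mulmx_suml.
  under eq_bigr => a _.
    rewrite mulmxA {1}(span _ (commutesM cS (WT a))) mulmx_suml.
    under eq_bigr => b _ do rewrite -scalemxAl.
    over.
  rewrite exchange_big /=; apply: eq_bigr => b _.
  rewrite -mulmxA; have -> : adjmx (T b) *m S = adjmx (adjmx S *m T b).
    by rewrite adjmxM adjmxK.
  rewrite (span _ (commutesM (commutes_adj cS) (WT b))) /adjmx.
  rewrite raddf_sum /= raddf_sum /= mulmx_sumr; apply: eq_bigr => a _.
  rewrite map_mxZ linearZ /= -scalemxAr; congr (_ *: _).
  have trC U : (\tr U)^*%R = \tr (adjmx U) :> C.
    by rewrite /adjmx mxtrace_tr trace_map_mx.
  by rewrite trC !adjmxM !adjmxK mulmxA [RHS]mxtrace_mulC mulmxA.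
have Z0unit : Z0 \in unitmx.
  rewrite -row_free_unit -kermx_eq0; apply/eqP/row_matrixP => i.
  rewrite row0; set v := row i _.
  have vZ0 : v *m Z0 = 0 by rewrite -row_mul mulmx_ker row0.
  have vT a : v *m T a = 0.
    apply: mulmx_adjmx_eq0; apply/matrixP => k l; rewrite !ord1 [RHS]mxE.
    have : (v *m Z0 *m adjmx v) 0 0 = 0 by rewrite vZ0 mul0mx mxE.
    rewrite mulmx_sumr mulmx_suml summxE => /eqP; rewrite psumr_eq0.
      move=> /allP/(_ a (mem_index_enum _))/eqP.
      by rewrite adjmxM mulmxA mulmxA.
    move=> b _; rewrite mulmxA -mulmxA -adjmxM mxE sumr_ge0 // => j _.
    by rewrite adjmxE mul_conjC_ge0.
  rewrite -[v]mulmx1 (span _ commutes1) mulmx_sumr big1 // => a _.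
  by rewrite -scalemxAr vT scaler0.
pose K := invmx Z0.
have TK : \sum_a T a *m K *m adjmx (T a) = 1%:M.
  have KC a : T a *m K = K *m T a.
    apply: (can_inj (mulKmx Z0unit)); rewrite mulmxA -Z0C // -!mulmxA.
    by rewrite mulKVmx // mulmxV // mulmx1.
  under eq_bigr => a _ do rewrite KC -mulmxA.
  by rewrite -mulmx_sumr mulVmx.
have VE i j : V i j = \sum_l \sum_k \sum_k'
    (K k k' * \sum_a T a i l * (T a j k')^*%R) *: V l k.
  transitivity (\sum_l (1%:M : 'M[C]_n) l j *: V i l).
    rewrite (bigD1 j) //= mxE eqxx scale1r big1 ?addr0 // => l /negbTE lj.
    by rewrite mxE lj scale0r.
  rewrite -TK.
  transitivity (\sum_a \sum_k \sum_k'
      (K k k' * (T a j k')^*%R) *: \sum_l T a l k *: V i l).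
    under eq_bigr => l _.
      rewrite summxE scaler_suml; under eq_bigr => a _.
        rewrite mxE scaler_suml; under eq_bigr => k' _.
          rewrite mxE mulr_suml scaler_suml.
          under eq_bigr => k _ do
            rewrite adjmxE -mulrA [T a l k * _]mulrC -scalerA.
          over.
        rewrite exchange_big /=; over.
      over.
    rewrite exchange_big /=; apply: eq_bigr => a _.
    rewrite exchange_big /=; apply: eq_bigr => k _.
    rewrite exchange_big /=; apply: eq_bigr => k' _.
    by rewrite scaler_sumr.
  under eq_bigr => a _ do
    under eq_bigr => k _ do
      under eq_bigr => k' _ do rewrite -(WV _ (WT a)) scaler_sumr.
  under [RHS]eq_bigr => l _ do
    under eq_bigr => k _ do
      under eq_bigr => k' _ do rewrite mulr_sumr scaler_suml.
  rewrite [RHS]exchange_big /=.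
  under [RHS]eq_bigr => k _ do rewrite exchange_big /=.
  under [RHS]eq_bigr => k _ do
    under eq_bigr => k' _ do rewrite exchange_big /=.
  under [RHS]eq_bigr => k _ do rewrite exchange_big /=.
  rewrite [RHS]exchange_big /=; apply: eq_bigr => a _.
  apply: eq_bigr => k _; apply: eq_bigr => k' _.
  apply: eq_bigr => l _; rewrite scalerA; congr (_ *: _).
  by rewrite -mulrA [_^*%R * _]mulrC.
transitivity (\sum_l \sum_k \sum_k' (K k k' *
    \sum_i \sum_j c i j * \sum_a T a i l * (T a j k')^*%R) *: V l k).
  under eq_bigr => i _.
    under eq_bigr => j _.
      rewrite VE scaler_sumr; under eq_bigr => l _.
        rewrite scaler_sumr; under eq_bigr => k _ do rewrite scaler_sumr.
        over.
      over.
    rewrite exchange_big /=; over.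
  rewrite exchange_big /=; apply: eq_bigr => l _.
  under eq_bigr => i _ do rewrite exchange_big /=.
  rewrite exchange_big /=; apply: eq_bigr => k _.
  under eq_bigr => i _ do rewrite exchange_big /=.
  rewrite exchange_big /=; apply: eq_bigr => k' _.
  rewrite mulr_sumr scaler_suml; apply: eq_bigr => i _.
  rewrite mulr_sumr scaler_suml; apply: eq_bigr => j _.
  by rewrite scalerA mulrCA.
rewrite big1 // => l _; rewrite big1 // => k _; rewrite big1 // => k' _.
by rewrite cT mulr0 scale0r.
Qed.

End Relations.

(** * Homomorphisms between C*-algebras *)

Section StarHom.
Variables (R : realType) (A D : cstarType R).
Local Notation C := R[i]%C.
Variable f : A -> D.
Hypothesis fhom : star_hom f.

Lemma star_hom1 : f 1 = 1. Proof. by have [] := fhom. Qed.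

Lemma star_homD x y : f (x + y) = f x + f y.
Proof. by have [_ h _ _ _] := fhom; apply: h. Qed.

Lemma star_homZ (c : C) x : f (c *: x) = c *: f x.
Proof. by have [_ _ h _ _] := fhom; apply: h. Qed.

Lemma star_homM x y : f (x * y) = f x * f y.
Proof. by have [_ _ _ h _] := fhom; apply: h. Qed.

Lemma star_hom_star x : f (star x) = star (f x).
Proof. by have [_ _ _ _ h] := fhom; apply: h. Qed.

Lemma star_hom0 : f 0 = 0.
Proof. by have := star_homZ 0 0; rewrite !scale0r. Qed.

Lemma star_hom_sum (I : Type) (r : seq I) (P : pred I) (F : I -> A) :
  f (\sum_(i <- r | P i) F i) = \sum_(i <- r | P i) f (F i).
Proof. exact: (big_morph f star_homD star_hom0). Qed.

End StarHom.

Lemma star_hom_comp (R : realType) (A B D : cstarType R) (g : B -> D)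
  (f : A -> B) : star_hom g -> star_hom f -> star_hom (g \o f).
Proof.
move=> gh fh; split=> [|x y _ _|c x _|x y _ _|x _] /=.
- by rewrite !star_hom1.
- by rewrite !star_homD.
- by rewrite !star_homZ.
- by rewrite !star_homM.
- by rewrite !star_hom_star.
Qed.

Lemma star_hom_can (R : realType) (A B : cstarType R) (f : A -> B)
  (g : B -> A) : star_hom f -> cancel f g -> cancel g f -> star_hom g.
Proof.
move=> fh fK gK; have fI := can_inj fK.
split=> [|x y _ _|c x _|x y _ _|x _]; apply: fI; rewrite gK.
- by rewrite star_hom1.
- by rewrite star_homD // !gK.
- by rewrite star_homZ // !gK.
- by rewrite star_homM // !gK.
- by rewrite star_hom_star // !gK.
Qed.

Lemma star_subalgP (R : realType) (A : cstarType R) (S : set A) :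
  S 1 -> (forall (c : R[i]%C) x y, S x -> S y -> S (c *: x + y)) ->
  (forall x y, S x -> S y -> S (x * y)) -> (forall x, S x -> S (star x)) ->
  star_subalg S.
Proof.
move=> S1 SL SM Ss; split=> //; split=> [|c x y|x y].
- by rewrite inE.
- by rewrite !inE; apply: SL.
- by rewrite !inE; apply: SM.
Qed.

Lemma star_hom_eq_smallest (R : realType) (A D : cstarType R) (f g : A -> D)
    (X : set A) : star_hom f -> star_hom g -> (forall x, X x -> f x = g x) ->
  forall x, smallest (@star_subalg R A) X x -> f x = g x.
Proof.
move=> fh gh fgX; apply: smallest_sub => //.
apply: (@star_subalgP _ _ [set x | f x = g x]%classic) => /=.
- by rewrite !star_hom1.
- by move=> c x y fgx fgy; rewrite !(star_homD, star_homZ) // fgx fgy.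
- by move=> x y fgx fgy; rewrite !star_homM // fgx fgy.
- by move=> x fgx; rewrite !star_hom_star // fgx.
Qed.

Section Extension.
Variables (R : realType) (T T' : cstarType R) (S : set T) (f : T -> T').
Hypothesis Ssub : star_subalg S.
Hypothesis Sdense : norm_dense S.
Hypothesis fhom : star_hom_on S f.
Hypothesis fbound : forall x, S x -> cnorm (f x) <= cnorm x.

Let S1 : S 1.
Proof. by have [[+ _ _] _] := Ssub; rewrite inE. Qed.
Let SL (c : R[i]%C) x y : S x -> S y -> S (c *: x + y).
Proof. by have [[_ h _] _] := Ssub; have := h c x y; rewrite !inE. Qed.
Let SM x y : S x -> S y -> S (x * y).
Proof. by have [[_ _ h] _] := Ssub; have := h x y; rewrite !inE. Qed.
Let S0 : S 0.
Proof. by have := SL (-1) S1 S1; rewrite scaleN1r addNr. Qed.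
Let SZ c x : S x -> S (c *: x).
Proof. by move=> Sx; have := SL c Sx S0; rewrite addr0. Qed.
Let SD x y : S x -> S y -> S (x + y).
Proof. by move=> Sx Sy; have := SL 1 Sx Sy; rewrite scale1r. Qed.
Let SB x y : S x -> S y -> S (x - y).
Proof. by move=> Sx Sy; have := SL (-1) Sy Sx; rewrite scaleN1r addrC. Qed.
Let fB x y : S x -> S y -> f (x - y) = f x - f y.
Proof.
have [_ fD fZ _ _] := fhom => Sx Sy.
rewrite -scaleN1r fD //; last exact: SZ.
by rewrite fZ // scaleN1r.
Qed.

(* The closure of the graph of [f]. *)
Let limit (x : T) (y : T') := forall e : R, 0 < e ->
  exists s, [/\ S s, cnorm (x - s) < e & cnorm (y - f s) < e].

Let limit_unique x y y' : limit x y -> limit x y' -> y = y'.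
Proof.
move=> xy xy'; apply/eqP; rewrite -subr_eq0; apply/eqP.
apply: cnorm_small_eq0 => e e0.
have e4 : 0 < e / 4 by rewrite divr_gt0.
have [s [Ss xs ys]] := xy _ e4; have [t [St xt yt]] := xy' _ e4.
have -> : y - y' = (y - f s) - (y' - f t) + f (s - t).
  rewrite fB // opprB [y - f s + _]addrC -[RHS]addrA.
  by rewrite [y - f s + _]addrA subrK [RHS]addrC addrA subrK.
apply: le_lt_trans (cnormD _ _) _.
have h1 := cnormB (y - f s) (y' - f t); have h2 := fbound (SB Ss St).
have h3 : cnorm (s - t) <= cnorm (x - t) + cnorm (x - s).
  have -> : s - t = (x - t) - (x - s) by rewrite opprB [RHS]addrC addrA subrK.
  exact: cnormB.
by lra.
Qed.

Let inv_small (e : R) : 0 < e -> exists n0, forall n : nat, (n0 <= n)%N ->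
  n.+1%:R^-1 < e.
Proof.
move=> e0; have ge0 : 0 <= e^-1 by rewrite invr_ge0 ltW.
exists (Num.bound e^-1) => n hn; rewrite invf_plt ?posrE ?ltr0n //.
apply: lt_le_trans (archi_boundP ge0) _.
by rewrite ler_nat; apply: leq_trans hn _.
Qed.

Let limit_exists x : exists y, limit x y.
Proof.
have h n : exists s, S s /\ cnorm (x - s) < n.+1%:R^-1.
  by have [|s Ss xs] := @Sdense x n.+1%:R^-1; [rewrite invr_gt0 ltr0n|exists s].
have [s hs] := choice h; have Ss n : S (s n) by have [] := hs n.
have [e e0|y hy] := @cnorm_complete _ _ (f \o s).
  have [|n0 hn0] := @inv_small (e / 2); first by rewrite divr_gt0.
  exists n0 => m n mn0 nn0 /=; rewrite -fB //.
  apply: le_lt_trans (fbound (SB (Ss m) (Ss n))) _.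
  have -> : s m - s n = (x - s n) - (x - s m).
    by rewrite opprB [RHS]addrC addrA subrK.
  apply: le_lt_trans (cnormB _ _) _.
  have [_ h1] := hs m; have [_ h2] := hs n.
  have -> : e = e / 2 + e / 2 by lra.
  by apply: ltrD; [apply: lt_trans h2 (hn0 n nn0)|apply: lt_trans h1 (hn0 m mn0)].
exists y => e e0; have [n0 hn0] := inv_small e0; have [n1 hn1] := hy _ e0.
pose n := maxn n0 n1; exists (s n); split=> //.
  by have [_ h1] := hs n; apply: lt_trans h1 _; apply: hn0; rewrite leq_maxl.
by rewrite cnorm_distC; apply: hn1; rewrite leq_maxr.
Qed.

Let limit_S x : S x -> limit x (f x).
Proof. by move=> Sx e e0; exists x; rewrite !subrr !cnorm0. Qed.

Let limitL (c : R[i]%C) x y x' y' :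
  limit x y -> limit x' y' -> limit (c *: x + x') (c *: y + y').
Proof.
have [_ fD fZ _ _] := fhom.
move=> xy xy' e e0.
have [k ck] : exists k : R, `|c| = k%:C%C.
  by exists (complex.Re `|c|); rewrite RRe_real // normr_real.
have kE (E : cstarType R) (z : E) : cnorm (c *: z) = k * cnorm z.
  by apply: (@complexI R); rewrite cnormZ ck rmorphM.
have k0 : 0 <= k.
  by have := cnorm_ge0 (c *: (1 : T)); rewrite kE cnorm1 mulr1.
have e1 : 0 < e / (2 * (k + 1)) by rewrite divr_gt0 // mulr_gt0 //; lra.
have e2 : 0 < e / 2 by rewrite divr_gt0.
have [s [Ss xs ys]] := xy _ e1; have [t [St xt yt]] := xy' _ e2.
have bnd (E : cstarType R) (a b a' b' : E) :
    cnorm (a - b) < e / (2 * (k + 1)) -> cnorm (a' - b') < e / 2 ->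
    cnorm (c *: a + a' - (c *: b + b')) < e.
  move=> ab ab'; rewrite opprD addrACA -scalerBr.
  apply: le_lt_trans (cnormD _ _) _; rewrite kE.
  have : k * cnorm (a - b) <= e / 2; last by lra.
  apply: le_trans (_ : (k + 1) * (e / (2 * (k + 1))) <= _).
    by apply: ler_pM; rewrite ?cnorm_ge0 // ?ltW //; lra.
  by have -> : (k + 1) * (e / (2 * (k + 1))) = e / 2 by field; lra.
exists (c *: s + t); split; first exact: SL.
  exact: bnd.
by rewrite fD //; [rewrite fZ //; exact: bnd|exact: SZ].
Qed.

Let limitM x y x' y' : limit x y -> limit x' y' -> limit (x * x') (y * y').
Proof.
have [_ _ _ fM _] := fhom.
move=> xy xy' e e0.
pose M := cnorm x + cnorm x' + cnorm y + cnorm y' + 2.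
have M2 : 2 <= M.
  rewrite /M; have := cnorm_ge0 x; have := cnorm_ge0 x'.
  by have := cnorm_ge0 y; have := cnorm_ge0 y'; lra.
pose d := e / (M + e); have Me : 0 < M + e by lra.
have d0 : 0 < d by rewrite divr_gt0.
have d1 : d < 1 by rewrite ltr_pdivrMr // mul1r; lra.
have dM : d * M < e.
  by rewrite /d mulrAC ltr_pdivrMr //; nra.
have [s [Ss xs ys]] := xy _ d0; have [t [St xt yt]] := xy' _ d0.
have bnd (E : cstarType R) (a b a' b' : E) :
    cnorm a + cnorm a' + 1 <= M ->
    cnorm (a - b) < d -> cnorm (a' - b') < d ->
    cnorm (a * a' - b * b') < e.
  move=> aM ab ab'.
  have -> : a * a' - b * b' = (a - b) * a' + b * (a' - b').
    by rewrite mulrBl mulrBr addrA subrK.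
  apply: le_lt_trans (cnormD _ _) _.
  have h1 := cnormM (a - b) a'; have h2 := cnormM b (a' - b').
  have h3 : cnorm b <= cnorm a + 1.
    have -> : b = a - (a - b) by rewrite opprB addrC subrK.
    by apply: le_trans (cnormB _ _) _; lra.
  have h4 : cnorm (a - b) * cnorm a' <= d * cnorm a'.
    by apply: ler_wpM2r; rewrite ?cnorm_ge0 // ltW.
  have h5 : cnorm b * cnorm (a' - b') <= (cnorm a + 1) * d.
    by apply: ler_pM; rewrite ?cnorm_ge0 // ltW.
  have h6 : d * (cnorm a + cnorm a' + 1) <= d * M by rewrite ler_pM2l.
  by lra.
have := cnorm_ge0 x; have := cnorm_ge0 x'.
have := cnorm_ge0 y; have := cnorm_ge0 y' => ? ? ? ?.
exists (s * t); split; first exact: SM.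
  by apply: bnd => //; rewrite /M; lra.
by rewrite fM //; apply: bnd => //; rewrite /M; lra.
Qed.

Let limit_star x y : limit x y -> limit (star x) (star y).
Proof.
have [_ _ _ _ fs] := fhom; have [_ Ss] := Ssub.
move=> xy e e0; have [s [Ss' xs ys]] := xy _ e0.
exists (star s); split; first exact: Ss.
  by rewrite -raddfB /= cnorm_starE.
by rewrite fs // -raddfB /= cnorm_starE.
Qed.

Lemma star_hom_extension :
  exists F : T -> T', star_hom F /\ forall x, S x -> F x = f x.
Proof.
have [F hF] := choice limit_exists; have [f1 _ _ _ _] := fhom.
have FE x y : limit x y -> F x = y by exact: limit_unique (hF x).
have Ff x : S x -> F x = f x by move=> Sx; apply/FE/limit_S.
have F0 : F 0 = 0.
  by rewrite Ff // -[X in f X](subrr 1) fB // subrr.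
exists F; split=> //; split=> [|x y _ _|c x _|x y _ _|x _].
- by rewrite Ff.
- by apply/FE; have := limitL 1 (hF x) (hF y); rewrite !scale1r.
- by apply/FE; have := limitL c (hF x) (hF 0); rewrite F0 !addr0.
- exact/FE/limitM.
- exact/FE/limit_star.
Qed.

End Extension.

Section MinTensorMap.
Variables (R : realType) (A B T A' B' T' : cstarType R).
Local Notation C := R[i]%C.
Variables (i : A -> T) (j : B -> T) (i' : A' -> T') (j' : B' -> T').
Variables (f : A -> A') (g : B -> B').

Lemma tensor_embedding_comp : tensor_embedding i' j' -> star_hom f ->
  star_hom g -> injective f -> injective g ->
  tensor_embedding (i' \o f) (j' \o g).
Proof.
move=> [ih jh ij inj] fh gh fI gI; split; try exact: star_hom_comp.
  by move=> a b; exact: ij.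
move=> n a b ai sum0 m; apply: gI; rewrite (star_hom0 gh).
apply: (@inj n (f \o a) (g \o b)) => // c; rewrite /=.
under eq_bigr => k _ do rewrite -(star_homZ fh).
rewrite -(star_hom_sum fh) => h; apply: ai; apply: fI.
by rewrite h star_hom0.
Qed.

Definition tensor_sum (E : cstarType R) (X Y : Type) (p : X -> E) (q : Y -> E)
    (l : seq (X * Y)) : E :=
  \sum_(t <- l) p t.1 * q t.2.

Lemma tensor_sum_ord (E : cstarType R) (X Y : Type) (p : X -> E) (q : Y -> E)
    (l : seq (X * Y)) :
  tensor_sum p q l = \sum_m p (tnth (in_tuple l) m).1 * q (tnth (in_tuple l) m).2.
Proof. by rewrite /tensor_sum big_tnth. Qed.

End MinTensorMap.

(** The map is given by [f] and [g] on sums of elementary tensors, is well defined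
    there because of the inequality of norms, and extends by continuity. *)
Lemma min_tensor_map (R : realType) (A B T A' B' T' : cstarType R)
    (i : A -> T) (j : B -> T) (i' : A' -> T') (j' : B' -> T')
    (f : A -> A') (g : B -> B') :
  min_tensor i j -> tensor_embedding i' j' ->
  star_hom f -> star_hom g -> injective f -> injective g ->
  (forall l, cnorm (tensor_sum (i' \o f) (j' \o g) l) <= cnorm (tensor_sum i j l)) ->
  exists F, hom_with_legs i j (i' \o f) (j' \o g) F.
Proof.
move=> [emb dense _] emb' fh gh fI gI le.
have [ih jh ij _] := emb.
have [ih' jh' ij' _] := tensor_embedding_comp emb' fh gh fI gI.
set fi := i' \o f in ih' ij' le *; set gj := j' \o g in jh' ij' le *.
pose S : set T := [set x | exists l, x = tensor_sum i j l]%classic.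
pose scale (c : R[i]%C) (l : seq (A * B)) := [seq (c *: t.1, t.2) | t <- l].
pose mul (l l' : seq (A * B)) :=
  [seq (t.1 * t'.1, t.2 * t'.2) | t <- l, t' <- l'].
pose st (l : seq (A * B)) := [seq (star t.1, star t.2) | t <- l].
have evD (E : cstarType R) (p : A -> E) (q : B -> E) l l' :
  tensor_sum p q (l ++ l') = tensor_sum p q l + tensor_sum p q l'.
  by rewrite /tensor_sum big_cat.
have evZ (E : cstarType R) (p : A -> E) (q : B -> E) c l : star_hom p ->
    tensor_sum p q (scale c l) = c *: tensor_sum p q l.
  move=> ph; rewrite /tensor_sum big_map scaler_sumr.
  by apply: eq_bigr => t _; rewrite (star_homZ ph) scalerAl.
have evM (E : cstarType R) (p : A -> E) (q : B -> E) l l' :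
    star_hom p -> star_hom q -> (forall a b, p a * q b = q b * p a) ->
    tensor_sum p q (mul l l') = tensor_sum p q l * tensor_sum p q l'.
  move=> ph qh pq; rewrite /tensor_sum big_allpairs_dep mulr_suml.
  apply: eq_bigr => t _; rewrite mulr_sumr; apply: eq_bigr => t' _ /=.
  rewrite (star_homM ph) (star_homM qh) -!mulrA; congr (_ * _).
  by rewrite !mulrA pq.
have ev_star (E : cstarType R) (p : A -> E) (q : B -> E) l :
    star_hom p -> star_hom q -> (forall a b, p a * q b = q b * p a) ->
    tensor_sum p q (st l) = star (tensor_sum p q l).
  move=> ph qh pq; rewrite /tensor_sum big_map raddf_sum.
  apply: eq_bigr => t _ /=.
  by rewrite starM -(star_hom_star ph) -(star_hom_star qh) pq.
have ev1 (E : cstarType R) (p : A -> E) (q : B -> E) :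
    star_hom p -> star_hom q -> tensor_sum p q [:: (1, 1)] = 1.
  by move=> ph qh; rewrite /tensor_sum big_seq1 (star_hom1 ph) (star_hom1 qh) mulr1.
have eq_ev l l' : tensor_sum i j l = tensor_sum i j l' ->
    tensor_sum fi gj l = tensor_sum fi gj l'.
  move=> ll'; apply/eqP; rewrite -subr_eq0; apply/eqP; apply: cnorm0_eq0.
  apply/le_anti; rewrite cnorm_ge0 andbT.
  have := le (l ++ scale (-1) l').
  by rewrite !evD !evZ // !scaleN1r ll' subrr cnorm0.
pose F0 (x : T) : T' := if pselect (S x) is left h
  then tensor_sum fi gj (sval (cid h)) else 0.
have F0E l : F0 (tensor_sum i j l) = tensor_sum fi gj l.
  rewrite /F0; case: pselect => [h|[]]; last by exists l.
  by apply: eq_ev; case: (cid h) => /= l' ->.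
have Ssub : star_subalg S.
  apply: star_subalgP.
  - by exists [:: (1, 1)]; rewrite ev1.
  - by move=> c _ _ [l ->] [l' ->]; exists (scale c l ++ l'); rewrite evD evZ.
  - by move=> _ _ [l ->] [l' ->]; exists (mul l l'); rewrite evM.
  - by move=> _ [l ->]; exists (st l); rewrite ev_star.
have Sdense : norm_dense S.
  move=> x e e0; have [y [n [a [b ->]]] xy] := dense x e e0.
  exists (\sum_m i (a m) * j (b m)) => //.
  exists [seq (a m, b m) | m <- index_enum 'I_n].
  by rewrite /tensor_sum big_map.
have F0hom : star_hom_on S F0.
  split=> [|_ _ [l ->] [l' ->]|c _ [l ->]|_ _ [l ->] [l' ->]|_ [l ->]].
  - by rewrite -(ev1 _ i j) // F0E ev1.
  - by rewrite -evD !F0E evD.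
  - by rewrite -evZ // !F0E evZ.
  - by rewrite -evM // !F0E evM.
  - by rewrite -ev_star // !F0E ev_star.
have F0le x : S x -> cnorm (F0 x) <= cnorm x.
  by move=> [l ->]; rewrite F0E.
have [F [Fh FF0]] := star_hom_extension Ssub Sdense F0hom F0le.
exists F; split=> // [a|b].
- have -> : i a = tensor_sum i j [:: (a, 1)].
    by rewrite /tensor_sum big_seq1 /= (star_hom1 jh) mulr1.
  rewrite FF0; last by eexists.
  by rewrite F0E /tensor_sum big_seq1 /= (star_hom1 jh') mulr1.
- have -> : j b = tensor_sum i j [:: (1, b)].
    by rewrite /tensor_sum big_seq1 /= (star_hom1 ih) mul1r.
  rewrite FF0; last by eexists.
  by rewrite F0E /tensor_sum big_seq1 /= (star_hom1 ih') mul1r.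
Qed.

(** Both tensor products carry the least C*-norm, and this norm depends only on
    the algebras up to isomorphism. *)
Lemma min_tensor_iso (R : realType) (A B T A' B' T' : cstarType R)
    (i : A -> T) (j : B -> T) (i' : A' -> T') (j' : B' -> T')
    (f : A -> A') (g : B -> B') (f' : A' -> A) (g' : B' -> B) :
  min_tensor i j -> min_tensor i' j' -> star_hom f -> star_hom g ->
  cancel f f' -> cancel f' f -> cancel g g' -> cancel g' g ->
  exists F, hom_with_legs i j (i' \o f) (j' \o g) F.
Proof.
move=> ij ij' fh gh fK f'K gK g'K.
have [emb' _ min'] := ij'.
apply: min_tensor_map => //; [exact: can_inj fK|exact: can_inj gK|].
have f'h := star_hom_can fh fK f'K; have g'h := star_hom_can gh gK g'K.
have [emb _ _] := ij.
have emb2 := tensor_embedding_comp emb f'h g'h (can_inj f'K) (can_inj g'K).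
move=> l; rewrite !tensor_sum_ord.
have := min' _ _ _ emb2 _ (fun m => f (tnth (in_tuple l) m).1)
                          (fun m => g (tnth (in_tuple l) m).2).
under [X in _ <= cnorm X]eq_bigr => m _ do rewrite /= fK gK.
by [].
Qed.

(** * Tensor powers of a representation *)

Section FfunSplit.
Variables (I : finType) (k : nat).

Definition ffun_cons (x : I) (g : {ffun 'I_k -> I}) : {ffun 'I_k.+1 -> I} :=
  [ffun a => oapp g x (unlift ord0 a)].

Definition ffun_tail (f : {ffun 'I_k.+1 -> I}) : {ffun 'I_k -> I} :=
  [ffun a => f (lift ord0 a)].

Lemma ffun_cons0 x g : ffun_cons x g ord0 = x.
Proof. by rewrite ffunE unlift_none. Qed.

Lemma ffun_consK x g : ffun_tail (ffun_cons x g) = g.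
Proof. by apply/ffunP => a; rewrite !ffunE liftK. Qed.

Lemma ffun_cons_eta (f : {ffun 'I_k.+1 -> I}) : ffun_cons (f ord0) (ffun_tail f) = f.
Proof.
by apply/ffunP => a; rewrite ffunE; case: unliftP => [b ->|->] /=; rewrite ?ffunE.
Qed.

Lemma sum_ffun_cons (M : nmodType) (F : {ffun 'I_k.+1 -> I} -> M) :
  \sum_f F f = \sum_x \sum_g F (ffun_cons x g).
Proof.
rewrite pair_bigA /= (reindex (fun p => ffun_cons p.1 p.2)) //=.
exists (fun f : {ffun 'I_k.+1 -> I} => (f ord0, ffun_tail f)) => [[x g] _|f _] /=.
  by rewrite ffun_cons0 ffun_consK.
exact: ffun_cons_eta.
Qed.

Lemma eq_ffun_cons (f g : {ffun 'I_k.+1 -> I}) :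
  (f == g) = (f ord0 == g ord0) && (ffun_tail f == ffun_tail g).
Proof.
apply/eqP/andP => [->|[/eqP e0 /eqP et]] //.
by rewrite -[f]ffun_cons_eta e0 et ffun_cons_eta.
Qed.

End FfunSplit.

Section TensorPower.
Variables (R : realType) (A : compact_quantum_group R) (I : finType).
Local Notation C := R[i]%C.
Implicit Type u : I -> I -> A.

Lemma tensor_powerS u k (i j : {ffun 'I_k.+1 -> I}) :
  tensor_power u i j =
    u (i ord0) (j ord0) * tensor_power u (ffun_tail i) (ffun_tail j).
Proof.
rewrite /tensor_power big_ord_recl; congr (_ * _).
by apply: eq_bigr => a _; rewrite !ffunE.
Qed.

Lemma tensor_power_mul_star u :
  (forall i j, \sum_m u i m * star (u j m) = (i == j)%:R) ->
  forall k (i j : {ffun 'I_k -> I}),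
    \sum_m tensor_power u i m * star (tensor_power u j m) = (i == j)%:R.
Proof.
move=> uu; elim=> [|k IH] i j.
  have ij : i = j by apply/ffunP => -[].
  rewrite ij eqxx (bigD1 j) //= big1 ?addr0.
    by rewrite /tensor_power !big_ord0 star1 mulr1.
  by move=> f /eqP[]; apply/ffunP => -[].
rewrite sum_ffun_cons.
under eq_bigr => x _.
  under eq_bigr => g _.
    rewrite !tensor_powerS !ffun_cons0 !ffun_consK starM -mulrA.
    rewrite [tensor_power u _ _ * _]mulrA; over.
  rewrite -mulr_sumr -mulr_suml IH mulr_natl mulrnAr; over.
by rewrite sumrMnl uu -mulrnA mulnb eq_ffun_cons.
Qed.

Lemma tensor_power_star_mul u :
  (forall i j, \sum_m star (u i m) * u j m = (i == j)%:R) ->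
  forall k (i j : {ffun 'I_k -> I}),
    \sum_m star (tensor_power u i m) * tensor_power u j m = (i == j)%:R.
Proof.
move=> uu; elim=> [|k IH] i j.
  have ij : i = j by apply/ffunP => -[].
  rewrite ij eqxx (bigD1 j) //= big1 ?addr0.
    by rewrite /tensor_power !big_ord0 star1 mulr1.
  by move=> f /eqP[]; apply/ffunP => -[].
rewrite sum_ffun_cons exchange_big /=.
under eq_bigr => g _.
  under eq_bigr => x _.
    rewrite !tensor_powerS !ffun_cons0 !ffun_consK starM -mulrA.
    rewrite [star (u _ _) * _]mulrA; over.
  rewrite -mulr_sumr -mulr_suml uu mulr_natl mulrnAr; over.
by rewrite sumrMnl IH -mulrnA mulnb andbC eq_ffun_cons.
Qed.

Lemma tensor_power_coprod u :
  (forall i j, qg_coprod (u i j) = \sum_m qg_leg1 (u i m) * qg_leg2 (u m j)) ->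
  forall k (i j : {ffun 'I_k -> I}), qg_coprod (tensor_power u i j) =
    \sum_m qg_leg1 (tensor_power u i m) * qg_leg2 (tensor_power u m j).
Proof.
have [[l1 l2 comm _] _ _] := @qg_tensor2 _ A.
move=> uu; elim=> [|k IH] i j.
  rewrite (bigD1 i) //= big1 ?addr0.
    rewrite /tensor_power !big_ord0 (star_hom1 (@qg_coprod_hom _ A)).
    by rewrite (star_hom1 l1) (star_hom1 l2) mulr1.
  by move=> f /eqP[]; apply/ffunP => -[].
rewrite tensor_powerS (star_homM (@qg_coprod_hom _ A)) uu IH sum_ffun_cons.
rewrite mulr_suml; apply: eq_bigr => x _.
rewrite mulr_sumr; apply: eq_bigr => g _.
rewrite !tensor_powerS !ffun_cons0 !ffun_consK (star_homM l1) (star_homM l2).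
by rewrite -!mulrA; congr (_ * _); rewrite !mulrA comm.
Qed.

End TensorPower.

Section DirectSum.
Variables (R : realType) (I : finType) (n : nat).
Local Notation C := R[i]%C.

Definition sum_index : finType := {k : 'I_n.+1 & {ffun 'I_k -> I}}.

Local Notation inj_power := (Tagged (fun k : 'I_n.+1 => {ffun 'I_k -> I})).

Definition direct_sum (A : compact_quantum_group R) (u : I -> I -> A)
    (a b : sum_index) : A :=
  if tag a == tag b then tensor_power u (tagged a) (tagged_as a b) else 0.

Lemma direct_sumE (A : compact_quantum_group R) (u : I -> I -> A) (k : 'I_n.+1) (i j : {ffun 'I_k -> I}) :
  direct_sum u (inj_power i)
    (inj_power j) = tensor_power u i j.
Proof. by rewrite /direct_sum /= eqxx tagged_asE. Qed.

Lemma direct_sum_neq (A : compact_quantum_group R) (u : I -> I -> A) (a b : sum_index) :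
  tag a != tag b -> direct_sum u a b = 0.
Proof. by move=> /negbTE ab; rewrite /direct_sum ab. Qed.

Lemma sum_same_tag (M : nmodType) (F : sum_index -> M) (k : 'I_n.+1) :
  (forall c, tag c != k -> F c = 0) ->
  \sum_c F c =
    \sum_(i : {ffun 'I_k -> I}) F (inj_power i).
Proof.
move=> F0.
transitivity (\sum_l \sum_(i : {ffun 'I_(nat_of_ord l) -> I})
   F (inj_power i)).
  rewrite sig_big_dep /=; apply: eq_bigr => -[l i] _ //.
rewrite (bigD1 k) //= [X in _ + X]big1 ?addr0 // => l lk.
by rewrite big1 // => i _; apply: F0.
Qed.

Section Unitarity.
Variables (A : compact_quantum_group R) (u : I -> I -> A).

Lemma direct_sum_mul_star :
  (forall i j, \sum_m u i m * star (u j m) = (i == j)%:R) ->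
  forall a b, \sum_m direct_sum u a m * star (direct_sum u b m) = (a == b)%:R.
Proof.
move=> uu a b; have [ab|ab] := eqVneq (tag a) (tag b); last first.
  rewrite big1; first by case: (eqVneq a b) ab => [->|//]; rewrite eqxx.
  move=> m _; have [am|am] := eqVneq (tag a) (tag m).
    by rewrite (@direct_sum_neq _ _ b) ?raddf0 ?mulr0 // -am eq_sym.
  by rewrite direct_sum_neq // mul0r.
case: a b ab => k i [l j] /= kl; rewrite -{l}kl in j *.
rewrite (sum_same_tag (k := k)).
  under eq_bigr => m _ do rewrite !direct_sumE.
  by rewrite tensor_power_mul_star // -tag_eqE /tag_eq /= eqxx tagged_asE.
by move=> c ck; rewrite direct_sum_neq ?mul0r // eq_sym.
Qed.

Lemma direct_sum_star_mul :
  (forall i j, \sum_m star (u i m) * u j m = (i == j)%:R) ->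
  forall a b, \sum_m star (direct_sum u a m) * direct_sum u b m = (a == b)%:R.
Proof.
move=> uu a b; have [ab|ab] := eqVneq (tag a) (tag b); last first.
  rewrite big1; first by case: (eqVneq a b) ab => [->|//]; rewrite eqxx.
  move=> m _; have [am|am] := eqVneq (tag a) (tag m).
    by rewrite (@direct_sum_neq _ _ b) ?mulr0 // -am eq_sym.
  by rewrite direct_sum_neq // raddf0 mul0r.
case: a b ab => k i [l j] /= kl; rewrite -{l}kl in j *.
rewrite (sum_same_tag (k := k)).
  under eq_bigr => m _ do rewrite !direct_sumE.
  by rewrite tensor_power_star_mul // -tag_eqE /tag_eq /= eqxx tagged_asE.
by move=> c ck; rewrite direct_sum_neq ?raddf0 ?mul0r // eq_sym.
Qed.

Lemma direct_sum_coprod :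
  (forall i j, qg_coprod (u i j) = \sum_m qg_leg1 (u i m) * qg_leg2 (u m j)) ->
  forall a b, qg_coprod (direct_sum u a b) =
    \sum_m qg_leg1 (direct_sum u a m) * qg_leg2 (direct_sum u m b).
Proof.
have [[l1 l2 _ _] _ _] := @qg_tensor2 _ A.
move=> uu a b; have [ab|ab] := eqVneq (tag a) (tag b); last first.
  rewrite big1.
    by rewrite direct_sum_neq // (star_hom0 (@qg_coprod_hom _ A)).
  move=> m _; have [am|am] := eqVneq (tag a) (tag m).
    by rewrite (@direct_sum_neq _ _ m) ?(star_hom0 l2) ?mulr0 // -am.
  by rewrite direct_sum_neq // (star_hom0 l1) mul0r.
case: a b ab => k i [l j] /= kl; rewrite -{l}kl in j *.
rewrite direct_sumE tensor_power_coprod // (sum_same_tag (k := k)).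
  by apply: eq_bigr => m _; rewrite !direct_sumE.
by move=> c ck; rewrite direct_sum_neq ?(star_hom0 l1) ?mul0r // eq_sym.
Qed.

End Unitarity.

Lemma direct_sum_tr (A : compact_quantum_group R) (u : I -> I -> A) a b :
  direct_sum (fun i j => u j i) a b = direct_sum u b a.
Proof.
have [ab|ab] := eqVneq (tag a) (tag b); last by rewrite !direct_sum_neq // eq_sym.
case: a b ab => k i [l j] /= kl; rewrite -{l}kl in j *.
by rewrite !direct_sumE.
Qed.

Definition fcommutes (J : finType) (B : lmodType C) (V : J -> J -> B)
    (T : J -> J -> C) :=
  forall i j, \sum_k T i k *: V k j = \sum_k T k j *: V i k.

Lemma direct_sum_commutes (A : compact_quantum_group R) (u : I -> I -> A) T :
  fcommutes (direct_sum u) T <->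
  forall (k l : 'I_n.+1),
    intertwiner u ([ffun p => T (inj_power p.1)
      (inj_power p.2)] : tensor_map R I k l).
Proof.
have E (k l : 'I_n.+1) (j : {ffun 'I_l -> I}) (i : {ffun 'I_k -> I}) :
   (\sum_c T (inj_power j) c *:
      direct_sum u c (inj_power i) =
    \sum_c T c (inj_power i) *:
      direct_sum u (inj_power j) c) =
   (\sum_(i' : {ffun 'I_k -> I})
      T (inj_power j)
        (inj_power i') *: tensor_power u i' i =
    \sum_(j' : {ffun 'I_l -> I})
      T (inj_power j')
        (inj_power i) *: tensor_power u j j').
  congr (_ = _).
    rewrite (sum_same_tag (k := k)).
      by apply: eq_bigr => i' _; rewrite direct_sumE.
    by move=> c ck; rewrite direct_sum_neq // scaler0.
  rewrite (sum_same_tag (k := l)).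
    by apply: eq_bigr => j' _; rewrite direct_sumE.
  by move=> c ck; rewrite direct_sum_neq ?scaler0 // eq_sym.
split=> [cT k l j i|iT [l j] [k i]].
  under eq_bigr => i' _ do rewrite ffunE.
  under [RHS]eq_bigr => j' _ do rewrite ffunE.
  by rewrite /= -E; exact: cT.
rewrite E; have := iT k l j i.
under eq_bigr => i' _ do rewrite ffunE.
by under [RHS]eq_bigr => j' _ do rewrite ffunE.
Qed.

End DirectSum.

Lemma frelation_transfer (R : realType) (A : compact_quantum_group R)
    (J : finType) (W : J -> J -> A) (B : lmodType R[i]%C) (V : J -> J -> B) :
  (forall i j, qg_coprod (W i j) = \sum_m qg_leg1 (W i m) * qg_leg2 (W m j)) ->
  (forall i j, \sum_m star (W m i) * W m j = (i == j)%:R) ->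
  (forall i j, \sum_m W m i * star (W m j) = (i == j)%:R) ->
  (forall i j, \sum_m W i m * star (W j m) = (i == j)%:R) ->
  (forall T, fcommutes W T -> fcommutes V T) ->
  forall c : J -> J -> R[i]%C, \sum_i \sum_j c i j *: W i j = 0 ->
    \sum_i \sum_j c i j *: V i j = 0.
Proof.
move=> Wco W1 W2 W3 WV c.
have sumJ (M : nmodType) (F : J -> M) :
    \sum_j F j = \sum_(a < #|J|) F (enum_val a).
  by rewrite (reindex _ (onW_bij _ (@enum_val_bij J))).
have comE (E : lmodType R[i]%C) (U : J -> J -> E) (T : 'M[R[i]%C]_#|J|) :
    commutes (fun a b => U (enum_val a) (enum_val b)) T <->
    fcommutes U (fun i j => T (enum_rank i) (enum_rank j)).
  split=> [cT i j|cT a b].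
    rewrite !sumJ; have := cT (enum_rank i) (enum_rank j); rewrite !enum_rankK.
    by under eq_bigr => k _ do rewrite -{1}(enum_valK k);
       under [RHS]eq_bigr => k _ do rewrite -{1}(enum_valK k).
  have := cT (enum_val a) (enum_val b); rewrite !sumJ !enum_valK.
  by under eq_bigr => k _ do rewrite enum_valK;
     under [RHS]eq_bigr => k _ do rewrite enum_valK.
have sum2 (E : lmodType R[i]%C) (U : J -> J -> E) :
    \sum_i \sum_j c i j *: U i j = \sum_(a < #|J|) \sum_(b < #|J|)
      (\matrix_(a, b) c (enum_val a) (enum_val b)) a b *:
        U (enum_val a) (enum_val b).
  rewrite sumJ; apply: eq_bigr => a _; rewrite sumJ; apply: eq_bigr => b _.
  by rewrite mxE.
rewrite !sum2.
apply: (@relation_transfer _ _ _ (fun a b => W (enum_val a) (enum_val b))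
  _ _ _ _ _ (fun a b => V (enum_val a) (enum_val b))).
- by move=> a b; rewrite Wco sumJ.
- by move=> a b; rewrite -(sumJ _ (fun m => star (W m _) * W m _)) W1 (inj_eq enum_val_inj).
- by move=> a b; rewrite -(sumJ _ (fun m => W m _ * star (W m _))) W2 (inj_eq enum_val_inj).
- by move=> a b; rewrite -(sumJ _ (fun m => W _ m * star (W _ m))) W3 (inj_eq enum_val_inj).
- by move=> T; rewrite !comE; exact: WV.
Qed.

(** * Uniqueness of the universal quantum group with given intertwiners *)

(** Noncommutative polynomials in variables indexed by [I * I]. *)
Definition ncpoly (R : realType) (I : finType) := seq (R[i]%C * seq (I * I)).

Section Eval.
Variables (R : realType) (A : compact_quantum_group R) (I : finType).
Variable u : I -> I -> A.
Local Notation C := R[i]%C.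
Implicit Types (l : ncpoly R I) (s : seq (I * I)).

Definition word_eval s : A := \prod_(p <- s) u p.1 p.2.
Definition poly_eval l : A := \sum_(t <- l) t.1 *: word_eval t.2.

Definition poly_scale (c : C) l : ncpoly R I := [seq (c * t.1, t.2) | t <- l].
Definition poly_mul l l' : ncpoly R I :=
  [seq (t.1 * t'.1, t.2 ++ t'.2) | t <- l, t' <- l'].
Definition poly_star l : ncpoly R I := [seq ((t.1)^*%R, rev t.2) | t <- l].

Lemma poly_eval_cat l l' : poly_eval (l ++ l') = poly_eval l + poly_eval l'.
Proof. by rewrite /poly_eval big_cat. Qed.

Lemma poly_eval_scale c l : poly_eval (poly_scale c l) = c *: poly_eval l.
Proof.
rewrite /poly_eval big_map scaler_sumr.
by apply: eq_bigr => t _; rewrite scalerA.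
Qed.

Lemma poly_eval_mul l l' :
  poly_eval (poly_mul l l') = poly_eval l * poly_eval l'.
Proof.
rewrite /poly_eval big_allpairs_dep mulr_suml; apply: eq_bigr => t _.
rewrite mulr_sumr; apply: eq_bigr => t' _ /=.
by rewrite /word_eval big_cat /= -scalerAl -scalerAr scalerA.
Qed.

Lemma poly_eval1 : poly_eval [:: (1, [::])] = 1.
Proof. by rewrite /poly_eval big_seq1 /word_eval big_nil scale1r. Qed.

Lemma poly_eval_gen i j : poly_eval [:: (1, [:: (i, j)])] = u i j.
Proof. by rewrite /poly_eval big_seq1 /word_eval big_seq1 scale1r. Qed.

Hypothesis u_selfadj : forall i j, star (u i j) = u i j.

Lemma poly_eval_star l : poly_eval (poly_star l) = star (poly_eval l).
Proof.
rewrite /poly_eval big_map raddf_sum; apply: eq_bigr => t _.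
rewrite /= starZ; congr (_ *: _); rewrite /word_eval.
elim: (t.2) => [|p s IH]; first by rewrite !big_nil star1.
by rewrite rev_cons -cats1 big_cat big_seq1 IH big_cons starM u_selfadj.
Qed.

Lemma smallest_star_subalgP x :
  smallest (@star_subalg R A) (coefs u) x <-> exists l, x = poly_eval l.
Proof.
split=> [|[l ->]].
  apply: (@smallest_sub _ _ _ [set x | exists l, x = poly_eval l]%classic).
    apply: star_subalgP => /= [|c _ _ [l ->] [l' ->]|_ _ [l ->] [l' ->]|_ [l ->]].
    - by exists [:: (1, [::])]; rewrite poly_eval1.
    - by exists (poly_scale c l ++ l'); rewrite poly_eval_cat poly_eval_scale.
    - by exists (poly_mul l l'); rewrite poly_eval_mul.
    - by exists (poly_star l); rewrite poly_eval_star.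
  by move=> _ [i [j ->]]; exists [:: (1, [:: (i, j)])]; rewrite poly_eval_gen.
move=> S [[[S1 SL SM] _] Su]; apply: set_mem.
have S0 : 0 \in S by have := SL (-1) 1 1 S1 S1; rewrite scaleN1r addNr.
rewrite /poly_eval; elim: l => [|t l IH]; first by rewrite big_nil.
rewrite big_cons; apply: (SL) => //; rewrite /word_eval.
elim: (t.2) => [|p s IHs]; first by rewrite big_nil.
by rewrite big_cons; apply: (SM) => //; rewrite inE; apply: Su; exists p.1, p.2.
Qed.

End Eval.

Section Uniqueness.
Variables (R : realType) (I : finType) (i0 : I).
Local Notation C := R[i]%C.

Lemma unitary_rep_direct_sum (A : compact_quantum_group R) (u : I -> I -> A) n :
  unitary_rep u -> (forall i j, star (u i j) = u i j) ->
  [/\ forall i j : sum_index I n,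
        \sum_m star (direct_sum u m i) * direct_sum u m j = (i == j)%:R,
      forall i j : sum_index I n,
        \sum_m direct_sum u m i * star (direct_sum u m j) = (i == j)%:R
    & forall i j : sum_index I n,
        \sum_m direct_sum u i m * star (direct_sum u j m) = (i == j)%:R].
Proof.
move=> [uu1 uu2 _] us; split=> i j.
- under eq_bigr => m _ do
    rewrite -[direct_sum u m i]direct_sum_tr -[direct_sum u m j]direct_sum_tr.
  exact: direct_sum_star_mul.
- under eq_bigr => m _ do
    rewrite -[direct_sum u m i]direct_sum_tr -[direct_sum u m j]direct_sum_tr.
  apply: direct_sum_mul_star => a b.
  by under eq_bigr => m _ do rewrite us -[u m a]us.
- exact: direct_sum_mul_star.
Qed.

(** A polynomial of degree [n] in the entries is a linear combination of the
    coefficients of the direct sum of the tensor powers of degree at most [n],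
    and the self-intertwiners of this sum are made of intertwiners between the
    tensor powers. *)
Lemma poly_relation_transfer (A B : compact_quantum_group R)
    (u : I -> I -> A) (w : I -> I -> B) :
  unitary_rep u -> (forall i j, star (u i j) = u i j) ->
  (forall k l (T : tensor_map R I k l), intertwiner u T -> intertwiner w T) ->
  forall l, poly_eval u l = 0 -> poly_eval w l = 0.
Proof.
move=> ur us uw l.
pose n := \max_(t <- l) size t.2.
pose row (e : I * I -> I) (t : C * seq (I * I)) : sum_index I n :=
  Tagged (fun k : 'I_n.+1 => {ffun 'I_k -> I})
    ([ffun a : 'I_(inord (size t.2) : 'I_n.+1) => e (nth (i0, i0) t.2 a)]).
pose c (a b : sum_index I n) := \sum_(t <- l | (row fst t == a) && (row snd t == b)) t.1.
have cE (D : compact_quantum_group R) (v : I -> I -> D) :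
    poly_eval v l = \sum_a \sum_b c a b *: direct_sum v a b.
  transitivity (\sum_(t <- l) t.1 *: direct_sum v (row fst t) (row snd t)).
    rewrite /poly_eval big_seq [RHS]big_seq; apply: eq_bigr => t tl.
    congr (_ *: _); rewrite direct_sumE /tensor_power /word_eval.
    have kE : (inord (size t.2) : 'I_n.+1) = size t.2 :> nat.
      by rewrite inordK // ltnS /n; apply: leq_bigmax_seq.
    under [RHS]eq_bigr => a _ do rewrite !ffunE.
    rewrite -(big_mkord xpredT (fun a => v (nth (i0, i0) t.2 a).1
                                          (nth (i0, i0) t.2 a).2)) kE.
    by rewrite (big_nth (i0, i0)).
  under [RHS]eq_bigr => a _.
    under eq_bigr => b _ do rewrite scaler_suml big_mkcond /=.
    rewrite exchange_big /=; over.
  rewrite [RHS]exchange_big /=; apply: eq_bigr => t _.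
  rewrite (bigD1 (row fst t)) //= [X in _ + X]big1 ?addr0.
    rewrite (bigD1 (row snd t)) //= [X in _ + X]big1 ?addr0 ?eqxx //.
    by move=> b /negbTE ht; rewrite [_ == b]eq_sym ht andbF.
  move=> a /negbTE ht; rewrite big1 // => b _.
  by rewrite [_ == a]eq_sym ht.
have [W1 W2 W3] := unitary_rep_direct_sum n ur us.
rewrite !cE; apply: frelation_transfer => //.
  by have [_ _ uco] := ur; exact: direct_sum_coprod.
move=> T; rewrite !direct_sum_commutes => uT k k'.
exact/uw/uT.
Qed.

Lemma star_hom_on_poly (A B : compact_quantum_group R)
    (u : I -> I -> A) (w : I -> I -> B) :
  (forall i j, star (u i j) = u i j) -> (forall i j, star (w i j) = w i j) ->
  (forall l, poly_eval u l = 0 -> poly_eval w l = 0) ->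
  exists f : A -> B,
    star_hom_on (smallest (@star_subalg R A) (coefs u)) f /\
    forall l, f (poly_eval u l) = poly_eval w l.
Proof.
move=> us ws uw.
have eq_w l l' : poly_eval u l = poly_eval u l' -> poly_eval w l = poly_eval w l'.
  move=> ll'; apply/eqP; rewrite -subr_eq0 -scaleN1r; apply/eqP.
  rewrite -poly_eval_scale -poly_eval_cat; apply: uw.
  by rewrite poly_eval_cat poly_eval_scale scaleN1r ll' subrr.
pose f x := if pselect (exists l, x = poly_eval u l) is left h
  then poly_eval w (sval (cid h)) else 0.
have fE l : f (poly_eval u l) = poly_eval w l.
  rewrite /f; case: pselect => [h|[]]; last by exists l.
  by apply: eq_w; case: (cid h) => /= l' ->.
exists f; split=> //.
split=> [|x y|c x|x y|x]; rewrite ?smallest_star_subalgP //.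
- by rewrite -{1}(poly_eval1 u) fE poly_eval1.
- by move=> [l ->] [l' ->]; rewrite -poly_eval_cat !fE poly_eval_cat.
- by move=> [l ->]; rewrite -poly_eval_scale !fE poly_eval_scale.
- by move=> [l ->] [l' ->]; rewrite -poly_eval_mul !fE poly_eval_mul.
- by move=> [l ->]; rewrite -poly_eval_star // !fE poly_eval_star.
Qed.

Lemma universal_hom_unique (A : compact_quantum_group R) (u : I -> I -> A)
    (D : cstarType R) (f g : A -> D) :
  universal_for u -> star_hom f -> star_hom g ->
  (forall i j, f (u i j) = g (u i j)) -> f = g.
Proof.
move=> uu fh gh fg.
have fgP := star_hom_eq_smallest fh gh
  (fun x xu => let: ex_intro i (ex_intro j e) := xu in
    etrans (congr1 f e) (etrans (fg i j) (congr1 g (esym e)))).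
have [|F [_ Funiq]] := uu D g.
  by case: gh => *; split=> // *; match goal with h : _ |- _ => apply: h end.
by rewrite -(Funiq f) ?(Funiq g).
Qed.

(** Polynomial relations transfer in both directions, so that [u i j |-> w i j]
    extends to a *-homomorphism by universality, as does its inverse.  Both sides
    of the compatibility with the coproducts are *-homomorphisms that agree on
    the generators [u i j]. *)
Theorem universal_isomorphic (A B : compact_quantum_group R)
    (u : I -> I -> A) (w : I -> I -> B) :
  unitary_rep u -> unitary_rep w ->
  (forall i j, star (u i j) = u i j) -> (forall i j, star (w i j) = w i j) ->
  universal_for u -> universal_for w ->
  (forall k l (T : tensor_map R I k l), intertwiner u T <-> intertwiner w T) ->
  cqg_isomorphic A B.
Proof.
move=> ur wr us ws uu wu uw.
have [f [fh fE]] := star_hom_on_poly us ws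
  (poly_relation_transfer ur us (fun k l T => (uw k l T).1)).
have [g [gh gE]] := star_hom_on_poly ws us
  (poly_relation_transfer wr ws (fun k l T => (uw k l T).2)).
have [F [[Fh Ff] _]] := uu B f fh.
have [G [[Gh Gg] _]] := wu A g gh.
have Fu i j : F (u i j) = w i j.
  rewrite Ff; first by rewrite -(poly_eval_gen u) fE poly_eval_gen.
  apply/smallest_star_subalgP => //; exists [:: (1, [:: (i, j)])].
  by rewrite poly_eval_gen.
have Gw i j : G (w i j) = u i j.
  rewrite Gg; first by rewrite -(poly_eval_gen w) gE poly_eval_gen.
  apply/smallest_star_subalgP => //; exists [:: (1, [:: (i, j)])].
  by rewrite poly_eval_gen.
have idh (D : cstarType R) : star_hom (@id D) by [].
have FK : cancel F G.
  move=> x; rewrite -[RHS]/(id x) -[LHS]/((G \o F) x); congr (_ x).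
  apply: (universal_hom_unique uu) => //; first exact: star_hom_comp.
  by move=> i j /=; rewrite Fu Gw.
have GK : cancel G F.
  move=> x; rewrite -[RHS]/(id x) -[LHS]/((F \o G) x); congr (_ x).
  apply: (universal_hom_unique wu) => //; first exact: star_hom_comp.
  by move=> i j /=; rewrite Gw Fu.
exists F; split=> //; first by exists G.
have [F2 F2h] := min_tensor_iso (@qg_tensor2 _ A) (@qg_tensor2 _ B)
  Fh Fh FK GK FK GK.
exists F2 => // a; have [F2hom F2l F2r] := F2h.
rewrite -[LHS]/((F2 \o @qg_coprod _ A) a) -[RHS]/((@qg_coprod _ B \o F) a).
congr (_ a); apply: (universal_hom_unique uu).
- by apply: star_hom_comp => //; exact: qg_coprod_hom.
- by apply: star_hom_comp => //; exact: qg_coprod_hom.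
move=> i j /=; rewrite Fu; have [_ _ ->] := ur; have [_ _ ->] := wr.
rewrite (star_hom_sum F2hom); apply: eq_bigr => m _.
by rewrite (star_homM F2hom) F2l F2r /= !Fu.
Qed.

End Uniqueness.

(** * Entries of the maps of coloured partitions *)

Section MmapEntries.
Variables (R : realType) (K : finGroupType) (N : nat).
Local Notation C := R[i]%C.
Local Notation index := (wr_index K N).

Definition same_colour k l (c : colouring K k l) (w : point k l -> index)
    (x y : point k l) : bool :=
  ((w x).1 * (c x)^-1 == (w y).1 * (c y)^-1)%g && ((w x).2 == (w y).2).

Definition compatible k l (p : {set {set point k l}}) (c : colouring K k l)
    (w : point k l -> index) : bool :=
  [forall B in p, forall x in B, forall y in B, same_colour c w x y].

Lemma compatibleP k l (p : {set {set point k l}}) c w :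
  reflect (forall B x y, B \in p -> x \in B -> y \in B -> same_colour c w x y)
    (compatible p c w).
Proof.
apply: (iffP idP) => [+ B x y Bp xB yB|h].
  move=> /forallP/(_ B)/implyP/(_ Bp)/forallP/(_ x)/implyP/(_ xB).
  by move=> /forallP/(_ y)/implyP/(_ yB).
apply/forallP => B; apply/implyP => Bp; apply/forallP => x; apply/implyP => xB.
by apply/forallP => y; apply/implyP => yB; apply: (h B).
Qed.

(** A tuple of indices with compatible colours is reached from the colours [c]
    by exactly one choice of a group element for each block. *)
Lemma MmapE k l (p : {set {set point k l}}) (c : colouring K k l) ji :
  is_partition p ->
  Mmap R N p c ji = (compatible p c (join_index ji.1 ji.2))%:R :> C.
Proof.
move=> pP; have [/eqP pcover ptriv p0] := and3P pP.
rewrite /Mmap sum_ffunE; set w := join_index _ _.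
pose good (g : {ffun {set point k l} -> K}) :=
  [forall x, (w x).1 == (block_act p g c) x] && delta p (fun x => (w x).2).
have blockE B x : B \in p -> x \in B -> finset.pblock p x = B.
  exact: def_pblock.
have goodc g : good g -> compatible p c w.
  move=> /andP[/forallP gw dw]; apply/compatibleP => B x y Bp xB yB.
  apply/andP; split; last first.
    move: dw => /forallP/(_ B)/implyP/(_ Bp)/forallP/(_ x)/implyP/(_ xB).
    by move=> /forallP/(_ y)/implyP/(_ yB).
  rewrite (eqP (gw x)) (eqP (gw y)) !ffunE (blockE B x) // (blockE B y) //.
  by rewrite !mulgK.
rewrite (eq_bigr (fun g => (good g)%:R)); last first.
  by move=> g _; rewrite ffunE /good -/w.
case: (boolP (compatible p c w)) => [cw|ncw]; last first.
  by rewrite big1 // => g _; case: (boolP (good g)) => // /goodc; rewrite (negbTE ncw).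
pose g0 : {ffun {set point k l} -> K} := [ffun B =>
  if B \in p then oapp (fun x => (w x).1 * (c x)^-1)%g 1%g [pick x in B] else 1%g].
have g0E B x : B \in p -> x \in B -> g0 B = ((w x).1 * (c x)^-1)%g.
  move=> Bp xB; rewrite ffunE Bp; case: pickP => [y yB|/(_ x)]; last by rewrite xB.
  by have /andP[/eqP] := compatibleP _ _ _ cw B y x Bp yB xB.
have covered x : exists2 B, B \in p & x \in B.
  by apply/finset.bigcupP; rewrite -/(finset.cover p) pcover inE.
have g0p : g0 \in pffun_on 1%g (mem p) (predT : pred K).
  apply/pffun_onP; split=> //; apply/fintype.subsetP => B.
  by rewrite inE ffunE; case: ifP => // _; rewrite eqxx.
rewrite (bigD1 g0) //= [X in _ + X]big1 => [|g /andP[gp gg0]].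
  rewrite addr0; suff -> : good g0 by [].
  apply/andP; split.
    apply/forallP => x; have [B Bp xB] := covered x.
    by rewrite [block_act _ _ _ _]ffunE (blockE B x) // (g0E B x) // mulgKV.
  apply/forallP => B; apply/implyP => Bp; apply/forallP => x; apply/implyP => xB.
  apply/forallP => y; apply/implyP => yB.
  by have /andP[] := compatibleP _ _ _ cw B x y Bp xB yB.
case: (boolP (good g)) => // /andP[/forallP gw _].
case/eqP: gg0; apply/ffunP => B.
have [Bp|Bp] := boolP (B \in p); last first.
  move: gp => /pffun_onP[/fintype.subsetP/(_ B) + _].
  rewrite inE ffunE (negbTE Bp).
  by case: eqP => // _ /(_ isT).
have /set0Pn[x xB] : B != finset.set0.
  by apply: contraNneq p0 => <-.
rewrite (g0E B x) // (eqP (gw x)) ffunE (blockE B x) //.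
by rewrite mulgK.
Qed.

End MmapEntries.

Section OneBlock.
Variables (k l : nat).
Hypothesis kl : (0 < k + l)%N.

Definition one_block : {set {set point k l}} := [set [set: point k l]]%SET.

Lemma card_point : #|point k l| = (k + l)%N.
Proof. by rewrite card_sum !card_ord. Qed.

Lemma one_block_partition : is_partition one_block.
Proof.
rewrite /is_partition /finset.partition /one_block finset.cover1 eqxx finset.trivIset1 /=.
rewrite inE eq_sym -card_gt0 cardsT card_point.
by rewrite kl.
Qed.

Lemma one_block_NC : one_block \in NC k l.
Proof.
rewrite inE one_block_partition /=; apply/asboolP.
by move=> B B' a b c d; rewrite !inE => /eqP-> /eqP->.
Qed.

Lemma one_block_NCev : ~~ odd (k + l) -> one_block \in NCev k l.
Proof.
move=> ev; rewrite inE one_block_NC /=; apply/forallP => B; apply/implyP.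
by rewrite inE => /eqP ->; rewrite cardsT card_point.
Qed.

Lemma compatible_one_block (K : finGroupType) (N : nat) (c : colouring K k l)
    (w : point k l -> wr_index K N) :
  reflect (forall x y, same_colour c w x y) (compatible one_block c w).
Proof.
apply: (iffP (compatibleP _ _ _)) => [h x y|h B x y _ _ _]; last exact: h.
by apply: (h [set: point k l]%SET); rewrite ?inE.
Qed.

End OneBlock.

(** * Relations between the coefficients of a partition wreath product *)

Section SmallPowers.
Variables (I : finType) (M : nmodType).

Lemma sum_ffun0 (f0 : {ffun 'I_0 -> I}) (F : {ffun 'I_0 -> I} -> M) :
  \sum_f F f = F f0.
Proof.
rewrite (bigD1 f0) //= big1 ?addr0 // => f /eqP[].
by apply/ffunP => -[].
Qed.

Lemma sum_ffun1 (F : {ffun 'I_1 -> I} -> M) : \sum_f F f = \sum_a F [ffun=> a].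
Proof.
rewrite sum_ffun_cons; apply: eq_bigr => a _.
have f0 : {ffun 'I_0 -> I} by apply: finfun => -[].
rewrite (sum_ffun0 f0); congr F.
by apply/ffunP => x; rewrite ord1 ffun_cons0 ffunE.
Qed.

Definition ffun_pair (a b : I) : {ffun 'I_2 -> I} :=
  [ffun x => if x == ord0 then a else b].

Lemma sum_ffun2 (F : {ffun 'I_2 -> I} -> M) :
  \sum_f F f = \sum_a \sum_b F (ffun_pair a b).
Proof.
rewrite sum_ffun_cons; apply: eq_bigr => a _.
rewrite sum_ffun1; apply: eq_bigr => b _; congr F.
by apply/ffunP => x; rewrite !ffunE; case: unliftP => [y ->|->] //=; rewrite ffunE.
Qed.

End SmallPowers.

Lemma tensor_power0 (R : realType) (A : compact_quantum_group R) (I : finType)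
  (u : I -> I -> A) (i j : {ffun 'I_0 -> I}) : tensor_power u i j = 1.
Proof. by rewrite /tensor_power big_ord0. Qed.

Lemma tensor_power1 (R : realType) (A : compact_quantum_group R) (I : finType)
  (u : I -> I -> A) (i j : {ffun 'I_1 -> I}) :
  tensor_power u i j = u (i ord0) (j ord0).
Proof. by rewrite /tensor_power big_ord1. Qed.

Lemma tensor_power2 (R : realType) (A : compact_quantum_group R) (I : finType)
  (u : I -> I -> A) (i j : {ffun 'I_2 -> I}) :
  tensor_power u i j = u (i ord0) (j ord0) * u (i ord_max) (j ord_max).
Proof.
rewrite /tensor_power !big_ord_recl big_ord0 mulr1.
by rewrite (_ : lift ord0 ord0 = ord_max) //; apply: val_inj.
Qed.

Section WreathRelations.
Variables (R : realType) (K : finGroupType) (N : nat).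
Variables (A : compact_quantum_group R).
Local Notation index := (wr_index K N).
Variable v : index -> index -> A.
Hypothesis v_rep : unitary_rep v.

(** The intertwiner of the one-block partition with two lower points gives
    [v v^T = 1], and [v^* v = 1], so that [v^* = v^T]. *)
Lemma selfadj_of_one_block :
  intertwiner v (Mmap R N (one_block 0 2) [ffun=> 1%g]) ->
  forall a b, star (v a b) = v a b.
Proof.
move=> vcup.
have f0 : {ffun 'I_0 -> index} by apply: finfun => -[].
have vv a b : \sum_m v a m * v b m = (a == b)%:R.
  have := vcup (ffun_pair a b) f0.
  have ME c d : Mmap R N (one_block 0 2) [ffun=> 1%g] (ffun_pair c d, f0) =
      (c == d)%:R :> R[i]%C.
    rewrite MmapE ?one_block_partition //; congr (nat_of_bool _)%:R.
    apply/compatible_one_block/eqP => // [/(_ (inr ord0) (inr ord_max))|-> x y].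
      rewrite /same_colour /= !ffunE /= invg1 !mulg1 => /andP[/eqP ? /eqP ?].
      by apply/eqP; rewrite -pair_eqE /=; apply/andP; split; apply/eqP.
    case: x y => [[]//|x] [[]//|y].
    by rewrite /same_colour /= !ffunE !if_same !eqxx.
  rewrite (sum_ffun0 f0) ME tensor_power0.
  rewrite sum_ffun2; under eq_bigr => c _.
    under eq_bigr => d _ do rewrite ME tensor_power2 !ffunE /=.
    rewrite (bigD1 c) //= eqxx scale1r big1 ?addr0; last first.
      by move=> d /negbTE dc; rewrite eq_sym dc scale0r.
    over.
  by move=> <-; rewrite scaler_nat.
have [_ v2 _] := v_rep => b n.
have : \sum_a star (v a n) * \sum_m v a m * v b m = star (v b n).
  rewrite (bigD1 b) //= vv eqxx mulr1 big1 ?addr0 // => a /negbTE ab.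
  by rewrite vv ab mulr0.
move=> <-; under eq_bigr => a _ do rewrite mulr_sumr.
rewrite exchange_big /= (bigD1 n) //= [X in _ + X]big1 ?addr0.
  under eq_bigr => a _ do rewrite mulrA.
  by rewrite -mulr_suml v2 eqxx mul1r.
move=> m /negbTE mn; under eq_bigr => a _ do rewrite mulrA.
by rewrite -mulr_suml v2 eq_sym mn mul0r.
Qed.

(** The intertwiner at hand is the right translation by [x^-1] of the colours. *)
Lemma translation_of_one_block x :
  intertwiner v (Mmap R N (one_block 1 1)
    [ffun z => if z is inl _ then x else 1%g]) ->
  forall g h i j, v ((g * x)%g, i) ((h * x)%g, j) = v (g, i) (h, j).
Proof.
move=> vid g h i j.
have ME (a b : index) : Mmap R N (one_block 1 1)
      [ffun z => if z is inl _ then x else 1%g] ([ffun=> a], [ffun=> b]) =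
    (b == ((a.1 * x)%g, a.2))%:R :> R[i]%C.
  rewrite MmapE ?one_block_partition //; congr (nat_of_bool _)%:R.
  apply/compatible_one_block/eqP => // [/(_ (inl ord0) (inr ord0))|-> y z].
    rewrite /same_colour /= !ffunE /= invg1 mulg1 => /andP[/eqP <- /eqP <-].
    by rewrite mulgKV -surjective_pairing.
  by case: y z => [y|y] [z|z]; rewrite /same_colour /= !ffunE /= ?invg1 ?mulg1 ?mulgK !eqxx.
have := vid [ffun=> (g, i)] [ffun=> ((h * x)%g, j)].
rewrite !sum_ffun1.
under eq_bigr => a _ do rewrite ME tensor_power1 !ffunE.
under [RHS]eq_bigr => a _ do rewrite ME tensor_power1 !ffunE.
rewrite (bigD1 ((g * x)%g, i)) //= eqxx scale1r big1 ?addr0; last first.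
  by move=> a /negbTE ->; rewrite scale0r.
move=> ->; rewrite (bigD1 (h, j)) //= eqxx scale1r big1 ?addr0 //.
move=> [h' j'] hj; rewrite /= xpair_eqE (inj_eq (mulIg x)) -xpair_eqE eq_sym.
by rewrite (negbTE hj) scale0r.
Qed.

(** The intertwiner at hand is [e_n |-> e_n (x) e_n]. *)
Lemma product_of_one_block :
  intertwiner v (Mmap R N (one_block 1 2) [ffun=> 1%g]) ->
  forall a b n, v a n * v b n = if a == b then v a n else 0.
Proof.
move=> vm a b n.
have ME c d e : Mmap R N (one_block 1 2) [ffun=> 1%g]
    (ffun_pair c d, [ffun=> e]) = ((c == e) && (d == e))%:R :> R[i]%C.
  rewrite MmapE ?one_block_partition //; congr (nat_of_bool _)%:R.
  apply/compatible_one_block/andP => // [h|[/eqP -> /eqP ->] x y].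
    have := h (inr ord0) (inl ord0); have := h (inr ord_max) (inl ord0).
    rewrite /same_colour /= !ffunE /= invg1 !mulg1.
    move=> /andP[/eqP ? /eqP ?] /andP[/eqP ? /eqP ?].
    by split; apply/eqP; rewrite [LHS]surjective_pairing [RHS]surjective_pairing; congr pair.
  by case: x y => [x|x] [y|y]; rewrite /same_colour /= !ffunE ?if_same !eqxx.
have := vm (ffun_pair a b) [ffun=> n].
rewrite sum_ffun1 sum_ffun2.
under eq_bigr => e _ do rewrite ME tensor_power1 !ffunE.
under [RHS]eq_bigr => c _.
  under eq_bigr => d _ do rewrite ME tensor_power2 !ffunE /=.
  over.
rewrite [RHS](bigD1 n) //= [X in _ + X]big1 ?addr0; last first.
  move=> c /negbTE cn; rewrite big1 // => d _.
  by rewrite cn scale0r.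
rewrite [RHS](bigD1 n) //= !eqxx scale1r [X in _ + X]big1 ?addr0; last first.
  by move=> d /negbTE ->; rewrite andbF scale0r.
move=> <-; rewrite (bigD1 a) //= eqxx /= big1 ?addr0.
  by rewrite eq_sym; case: eqP; rewrite ?scale1r ?scale0r.
by move=> e /negbTE; rewrite eq_sym => ->; rewrite scale0r.
Qed.

End WreathRelations.

(** * The odd part of the representation of the larger wreath product *)

Section Sign.
Variables (R : realType).
Local Notation C := R[i]%C.

Definition sgn (s : 'Z_2) : C := (-1) ^+ (s : nat).

Lemma sgn_sqr s : sgn s * sgn s = 1.
Proof. by rewrite /sgn -expr2 sqrr_sign. Qed.

Lemma sgn_conj s : (sgn s)^*%R = sgn s.
Proof. by rewrite /sgn rmorphXn rmorphN1. Qed.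

Lemma sgnS s : sgn (s + 1) = - sgn s.
Proof.
rewrite /sgn; case: s => [[|[|//]] h] /=; rewrite ?modnn ?expr0 ?expr1 ?opprK //.
Qed.

Lemma sgn1 : sgn 1 = -1. Proof. by rewrite /sgn expr1. Qed.

Lemma sum_Z2 (M : nmodType) (F : 'Z_2 -> M) : \sum_s F s = F 0 + F 1.
Proof.
by rewrite !big_ord_recl big_ord0 addr0; congr (F _ + F _); apply: val_inj.
Qed.

Lemma Z2_cases (s : 'Z_2) : s = 0 \/ s = 1.
Proof.
by case: s => [[|[|//]] h]; [left|right]; apply: val_inj.
Qed.

Lemma Z2_add11 : (1 + 1 : 'Z_2) = 0.
Proof. exact: val_inj. Qed.

End Sign.

Section OddPart.
Variables (R : realType) (G : finGroupType) (N : nat).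
Variables (A : compact_quantum_group R).
Local Notation C := R[i]%C.
Local Notation K := (G * 'Z_2)%type.
Local Notation big_index := (wr_index K N).
Local Notation index := (wr_index G N).
Local Notation sgn := (@sgn R).
Variable v : big_index -> big_index -> A.

Definition lift_index (a : index) (s : 'Z_2) : big_index := ((a.1, s), a.2).

(** The matrix of [v] on the subspace spanned by the differences of the basis
    vectors [lift_index a 0] and [lift_index a 1], if [v] commutes with the
    translation by [Z_2]. *)
Definition odd_part (a b : index) : A :=
  v (lift_index a 0) (lift_index b 0) - v (lift_index a 1) (lift_index b 0).

Lemma sum_lift_index (M : nmodType) (F : big_index -> M) :
  \sum_x F x = \sum_a \sum_s F (lift_index a s).
Proof.
rewrite pair_bigA /= (reindex (fun p => lift_index p.1 p.2)) //=.
exists (fun x : big_index => ((x.1.1, x.2), x.1.2)) => [[[g i] s]|[[g s] i]] //.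
Qed.

Hypothesis v_rep : unitary_rep v.
Hypothesis v_selfadj : forall a b, star (v a b) = v a b.
Hypothesis v_shift : forall a b s t,
  v (lift_index a (s + 1)) (lift_index b (t + 1)) =
  v (lift_index a s) (lift_index b t).
Hypothesis v_mul : forall a b n, v a n * v b n = if a == b then v a n else 0.

Let shift01 c d : v (lift_index c 0) (lift_index d 1) =
                  v (lift_index c 1) (lift_index d 0).
Proof. by rewrite -v_shift Z2_add11 add0r. Qed.

Let shift11 c d : v (lift_index c 1) (lift_index d 1) =
                  v (lift_index c 0) (lift_index d 0).
Proof. by rewrite -v_shift Z2_add11. Qed.

Lemma odd_part_right a b t :
  \sum_s sgn s *: v (lift_index a t) (lift_index b s) = sgn t *: odd_part a b.
Proof.
rewrite sum_Z2 sgn1 scale1r scaleN1r; case: (Z2_cases t) => ->.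
  by rewrite shift01 scale1r.
by rewrite shift11 sgn1 scaleN1r opprB.
Qed.

Lemma odd_part_left a b t :
  \sum_s sgn s *: v (lift_index a s) (lift_index b t) = sgn t *: odd_part a b.
Proof.
rewrite sum_Z2 sgn1 scale1r scaleN1r; case: (Z2_cases t) => ->.
  by rewrite scale1r.
by rewrite shift01 shift11 sgn1 scaleN1r opprB.
Qed.

Lemma odd_part_selfadj a b : star (odd_part a b) = odd_part a b.
Proof. by rewrite /odd_part raddfB /= !v_selfadj. Qed.

Let odd_part0 a b :
  odd_part a b = \sum_s sgn s *: v (lift_index a s) (lift_index b 0).
Proof. by rewrite odd_part_left scale1r. Qed.

Lemma eq_lift_index a b s t :
  (lift_index a s == lift_index b t) = (a == b) && (s == t).
Proof.
by case: a b => [g i] [h j]; rewrite /lift_index !xpair_eqE /= andbAC.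
Qed.

(** Twice the sums of products of entries of the odd part are sums with signs of
    those of [v], by [odd_part_left] and [odd_part_right]. *)
Lemma odd_part_unitary : unitary_rep odd_part.
Proof.
have [v1 v2 vco] := v_rep.
have double (x y : A) : x + x = y + y -> x = y.
  rewrite -!mulr2n -(scaler_nat _ x) -(scaler_nat _ y) => /(congr1 (fun z => (2%:R : C)^-1 *: z)).
  by rewrite !scalerA mulVf ?pnatr_eq0 // !scale1r.
have signs (a b : index) : \sum_s \sum_s' (sgn s * sgn s') *:
    ((lift_index a s == lift_index b s')%:R : A) = (a == b)%:R + (a == b)%:R.
  under eq_bigr => s _.
    rewrite (bigD1 s) //= eq_lift_index eqxx andbT sgn_sqr scale1r.
    rewrite big1 ?addr0; last first.
      by move=> t ts; rewrite eq_lift_index [s == t]eq_sym (negbTE ts) andbF scaler0.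
    over.
  by rewrite sum_Z2.
split=> [a b|a b|a b].
- apply: double; rewrite -signs.
  transitivity (\sum_m \sum_t (sgn t *: odd_part a m) *
      star (sgn t *: odd_part b m)).
    rewrite -big_split /=; apply: eq_bigr => m _.
    rewrite sum_Z2 !starZ !sgn_conj -!scalerAl -!scalerAr !scalerA.
    by rewrite !sgn_sqr !scale1r.
  under eq_bigr => m _.
    under eq_bigr => t _.
      rewrite -!odd_part_left raddf_sum mulr_suml.
      under eq_bigr => s _.
        rewrite mulr_sumr.
        under eq_bigr => s' _ do
          rewrite /= starZ sgn_conj -scalerAl -scalerAr scalerA.
        over.
      over.
    over.
  rewrite -(sum_lift_index (fun x => \sum_s \sum_s' (sgn s * sgn s') *:
     (v (lift_index a s) x * star (v (lift_index b s') x)))).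
  rewrite exchange_big /=; apply: eq_bigr => s _.
  rewrite exchange_big /=; apply: eq_bigr => s' _.
  by rewrite -scaler_sumr v1.
- apply: double; rewrite -signs.
  transitivity (\sum_m \sum_t star (sgn t *: odd_part m a) *
      (sgn t *: odd_part m b)).
    rewrite -big_split /=; apply: eq_bigr => m _.
    rewrite sum_Z2 !starZ !sgn_conj -!scalerAl -!scalerAr !scalerA.
    by rewrite !sgn_sqr !scale1r.
  under eq_bigr => m _.
    under eq_bigr => t _.
      rewrite -!odd_part_right raddf_sum mulr_suml.
      under eq_bigr => s _.
        rewrite mulr_sumr.
        under eq_bigr => s' _ do
          rewrite /= starZ sgn_conj -scalerAl -scalerAr scalerA.
        over.
      over.
    over.
  rewrite -(sum_lift_index (fun x => \sum_s \sum_s' (sgn s * sgn s') *: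
     (star (v x (lift_index a s)) * v x (lift_index b s')))).
  rewrite exchange_big /=; apply: eq_bigr => s _.
  rewrite exchange_big /=; apply: eq_bigr => s' _.
  by rewrite -scaler_sumr v2.
- have [[l1 l2 _ _] _ _] := @qg_tensor2 _ A.
  rewrite odd_part0 (star_hom_sum (@qg_coprod_hom _ A)).
  under eq_bigr => s _ do
    rewrite (star_homZ (@qg_coprod_hom _ A)) vco sum_lift_index scaler_sumr.
  rewrite exchange_big /=; apply: eq_bigr => m _.
  under eq_bigr => s _ do rewrite scaler_sumr.
  rewrite exchange_big /= (odd_part0 m) (star_hom_sum l2) mulr_sumr.
  apply: eq_bigr => t _.
  under eq_bigr => s _ do rewrite scalerAl -(star_homZ l1).
  rewrite -mulr_suml -(star_hom_sum l1) odd_part_left.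
  by rewrite (star_homZ l1) (star_homZ l2) -scalerAl -scalerAr.
Qed.

(** The two entries of [v] of which [odd_part a b] is the difference are
    orthogonal projections, so that its square is their sum. *)
Lemma odd_part_recovers a b s :
  v (lift_index a s) (lift_index b 0) =
    (2^-1 : C) *: (odd_part a b * odd_part a b + sgn s *: odd_part a b).
Proof.
have -> : odd_part a b * odd_part a b =
    v (lift_index a 0) (lift_index b 0) + v (lift_index a 1) (lift_index b 0).
  rewrite /odd_part mulrBl !mulrBr !v_mul !eqxx !eq_lift_index !eqxx /=.
  by rewrite subr0 sub0r opprK.
have half (x : A) : (2^-1 : C) *: (x + x) = x.
  by rewrite -mulr2n -(scaler_nat _ x) scalerA mulVf ?pnatr_eq0 // scale1r.
rewrite /odd_part; case: (Z2_cases s) => ->.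
  by rewrite scale1r addrACA subrr addr0 half.
by rewrite sgn1 scaleN1r opprB [v _ _ + v _ _]addrC addrACA subrr addr0 half.
Qed.

Lemma smallest_odd_part :
  smallest (@star_subalg R A) (coefs odd_part) =
  smallest (@star_subalg R A) (coefs v).
Proof.
have memB (S : set A) : star_subalg S -> forall (c : C) x y, S x -> S y -> S (c *: x + y).
  by move=> [[_ SL _] _] c x y; have := SL c x y; rewrite !inE.
have memM (S : set A) : star_subalg S -> forall x y : A, S x -> S y -> S (x * y).
  by move=> [[_ _ SM] _] x y; have := SM x y; rewrite !inE.
have mem0 (S : set A) : star_subalg S -> S (0 : A).
  move=> Ss; have := memB S Ss (-1) 1 1; rewrite scaleN1r addNr; apply.
    by case: Ss => -[]; rewrite inE.
  by case: Ss => -[]; rewrite inE.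
apply/seteqP; split=> x h S [Ss Scoef]; apply: h; split=> // y [a [b ->]].
  have e : odd_part a b =
      (-1 : C) *: v (lift_index a 1) (lift_index b 0) + v (lift_index a 0) (lift_index b 0).
    by rewrite scaleN1r addrC.
  rewrite e; apply: memB => //; apply: Scoef.
    by exists (lift_index a 1), (lift_index b 0).
  by exists (lift_index a 0), (lift_index b 0).
have v0 c d s : S (v (lift_index c s) (lift_index d 0)).
  rewrite odd_part_recovers -[X in S X]addr0; apply: (memB _ Ss) => //; last exact: mem0.
  have Sw : S (odd_part c d) by apply: Scoef; exists c, d.
  rewrite addrC; apply: (memB) => //.
  exact: memM.
have -> : a = lift_index (a.1.1, a.2) a.1.2 by case: a => [[]].
have -> : b = lift_index (b.1.1, b.2) b.1.2 by case: b => [[]].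
move: (b.1.2) => t; case: (Z2_cases t) => ->; first exact: v0.
by rewrite -v_shift Z2_add11; exact: v0.
Qed.

Lemma odd_part_universal : universal_for v -> universal_for odd_part.
Proof. by rewrite /universal_for smallest_odd_part. Qed.

End OddPart.

(** * Intertwiners of the odd part *)

Section OddMap.
Variables (R : realType) (G : finGroupType) (N : nat).
Local Notation C := R[i]%C.
Local Notation K := (G * 'Z_2)%type.
Local Notation big_index := (wr_index K N).
Local Notation index := (wr_index G N).
Local Notation sgn := (@sgn R).

Definition lift_ffun k (i : {ffun 'I_k -> index}) (s : {ffun 'I_k -> 'Z_2})
    : {ffun 'I_k -> big_index} :=
  [ffun a => lift_index (i a) (s a)].

Definition sgn_ffun (T : finType) (s : {ffun T -> 'Z_2}) : C :=
  \prod_a sgn (s a).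

Lemma sgn_ffun_sqr (T : finType) (s : {ffun T -> 'Z_2}) :
  sgn_ffun s * sgn_ffun s = 1.
Proof.
by rewrite /sgn_ffun -big_split big1 // => a _; rewrite /= sgn_sqr.
Qed.

Definition base_ffun k (y : {ffun 'I_k -> big_index}) : {ffun 'I_k -> index} :=
  [ffun a => ((y a).1.1, (y a).2)].
Definition parity_ffun k (y : {ffun 'I_k -> big_index}) : {ffun 'I_k -> 'Z_2} :=
  [ffun a => (y a).1.2].

Lemma lift_ffun_eta k (y : {ffun 'I_k -> big_index}) :
  lift_ffun (base_ffun y) (parity_ffun y) = y.
Proof. by apply/ffunP => a; rewrite !ffunE; case: (y a) => [[? ?] ?]. Qed.

Lemma base_lift_ffun k i s : base_ffun (@lift_ffun k i s) = i.
Proof. by apply/ffunP => a; rewrite !ffunE; case: (i a). Qed.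

Lemma parity_lift_ffun k i s : parity_ffun (@lift_ffun k i s) = s.
Proof. by apply/ffunP => a; rewrite !ffunE. Qed.

Lemma sum_lift_ffun k (M : nmodType) (F : {ffun 'I_k -> big_index} -> M) :
  \sum_x F x = \sum_i \sum_s F (lift_ffun i s).
Proof.
rewrite pair_bigA /= (reindex (fun p => lift_ffun p.1 p.2)) //=.
exists (fun y => (base_ffun y, parity_ffun y)) => [[i s] _|y _] /=.
  by rewrite base_lift_ffun parity_lift_ffun.
exact: lift_ffun_eta.
Qed.

(** With [D] the matrix whose columns are the vectors [lift_index a 0] minus
    [lift_index a 1], the tensor powers of [D] take [T] to [D^* T D] and [D T D^*],
    respectively. *)
Definition odd_map k l (T : tensor_map R big_index k l)
    : tensor_map R index k l :=
  [ffun ji => \sum_s \sum_t sgn_ffun s * sgn_ffun t *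
     T (lift_ffun ji.1 s, lift_ffun ji.2 t)].

Definition even_map k l (T : tensor_map R index k l)
    : tensor_map R big_index k l :=
  [ffun yx => sgn_ffun (parity_ffun yx.1) * sgn_ffun (parity_ffun yx.2) *
     T (base_ffun yx.1, base_ffun yx.2)].

Lemma odd_even_map k l (T : tensor_map R index k l) :
  odd_map (even_map T) = ((2 ^ l * 2 ^ k)%N%:R : C) *: T.
Proof.
apply/ffunP => -[j i]; rewrite !ffunE.
under eq_bigr => s _.
  under eq_bigr => t _.
    rewrite ffunE /= !base_lift_ffun !parity_lift_ffun mulrA mulrACA.
    rewrite !sgn_ffun_sqr !mul1r; over.
  rewrite sumr_const; over.
rewrite sumr_const -mulrnA /GRing.scale /= mulr_natl !card_ffun !card_ord.
by rewrite mulnC.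
Qed.

Section Intertwiners.
Variables (A : compact_quantum_group R).
Variables (v : big_index -> big_index -> A) (w : index -> index -> A).
Hypothesis vw_right : forall a b t,
  \sum_s sgn s *: v (lift_index a t) (lift_index b s) = sgn t *: w a b.
Hypothesis vw_left : forall a b t,
  \sum_s sgn s *: v (lift_index a s) (lift_index b t) = sgn t *: w a b.

Lemma tensor_power_right k (i j : {ffun 'I_k -> index}) t :
  \sum_s sgn_ffun s *: tensor_power v (lift_ffun i t) (lift_ffun j s) =
  sgn_ffun t *: tensor_power w i j.
Proof.
rewrite /sgn_ffun /tensor_power -scaler_prod.
under [RHS]eq_bigr => a _ do rewrite -vw_right.
rewrite bigA_distr_bigA /=; apply: eq_bigr => s _.
by rewrite -scaler_prod; apply: eq_bigr => a _; rewrite !ffunE.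
Qed.

Lemma tensor_power_left k (i j : {ffun 'I_k -> index}) t :
  \sum_s sgn_ffun s *: tensor_power v (lift_ffun i s) (lift_ffun j t) =
  sgn_ffun t *: tensor_power w i j.
Proof.
rewrite /sgn_ffun /tensor_power -scaler_prod.
under [RHS]eq_bigr => a _ do rewrite -vw_left.
rewrite bigA_distr_bigA /=; apply: eq_bigr => s _.
by rewrite -scaler_prod; apply: eq_bigr => a _; rewrite !ffunE.
Qed.

(** In terms of [D], the relations between [v] and [w] read [v D = D w] and
    [D^* v = w D^*], so that [D^* T D w = D^* T v D = D^* v T D = w D^* T D]. *)
Lemma intertwiner_odd_map k l (T : tensor_map R big_index k l) :
  intertwiner v T -> intertwiner w (odd_map T).
Proof.
move=> vT j i.
transitivity (\sum_s \sum_r (sgn_ffun s * sgn_ffun r) *: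
    \sum_x T (lift_ffun j s, x) *: tensor_power v x (lift_ffun i r)).
  under eq_bigr => i' _.
    rewrite ffunE scaler_suml; under eq_bigr => s _.
      rewrite scaler_suml; under eq_bigr => t _.
        rewrite mulrAC -scalerA -tensor_power_right scaler_sumr.
        under eq_bigr => r _ do rewrite scalerA.
        over.
      over.
    over.
  rewrite exchange_big /=; apply: eq_bigr => s _.
  transitivity (\sum_r \sum_i' \sum_t
     (sgn_ffun s * T (lift_ffun j s, lift_ffun i' t) * sgn_ffun r) *:
       tensor_power v (lift_ffun i' t) (lift_ffun i r)).
    rewrite [RHS]exchange_big /=; apply: eq_bigr => i' _.
    by rewrite [RHS]exchange_big.
  apply: eq_bigr => r _; rewrite sum_lift_ffun scaler_sumr.
  apply: eq_bigr => i' _; rewrite scaler_sumr; apply: eq_bigr => t _.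
  by rewrite scalerA mulrAC.
under eq_bigr => s _ do under eq_bigr => r _ do rewrite vT sum_lift_ffun.
under [RHS]eq_bigr => j' _.
  rewrite ffunE scaler_suml; under eq_bigr => t _.
    rewrite scaler_suml; under eq_bigr => r _.
      rewrite -mulrA mulrC -scalerA -tensor_power_left scaler_sumr.
      under eq_bigr => s _ do rewrite scalerA.
      over.
    over.
  over.
transitivity (\sum_s \sum_r \sum_j' \sum_t
   (sgn_ffun s * sgn_ffun r * T (lift_ffun j' t, lift_ffun i r)) *:
      tensor_power v (lift_ffun j s) (lift_ffun j' t)).
  apply: eq_bigr => s _; apply: eq_bigr => r _; rewrite scaler_sumr.
  apply: eq_bigr => j' _; rewrite scaler_sumr; apply: eq_bigr => t _.
  by rewrite scalerA.
under [LHS]eq_bigr => s _ do rewrite exchange_big /=.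
rewrite [LHS]exchange_big /=; apply: eq_bigr => j' _.
under [LHS]eq_bigr => s _ do rewrite exchange_big /=.
rewrite [LHS]exchange_big /=; apply: eq_bigr => t _.
rewrite [LHS]exchange_big /=; apply: eq_bigr => r _; apply: eq_bigr => s _.
by congr (_ *: _); rewrite -mulrA mulrC.
Qed.

Lemma intertwiner_even_map k l (T : tensor_map R index k l) :
  intertwiner w T -> intertwiner v (even_map T).
Proof.
move=> wT y x; rewrite -(lift_ffun_eta y) -(lift_ffun_eta x).
move: (base_ffun y) (parity_ffun y) (base_ffun x) (parity_ffun x).
move=> {y x} j s i r.
have mulC_AC (a b c : C) : a * b * c = a * c * b by rewrite mulrAC.
have mulC_CA (a b c : C) : a * b * c = b * c * a by rewrite -mulrA mulrC.
transitivity ((sgn_ffun s * sgn_ffun r) *: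
    \sum_i' T (j, i') *: tensor_power w i' i).
  rewrite sum_lift_ffun scaler_sumr; apply: eq_bigr => i' _.
  transitivity ((sgn_ffun s * T (j, i')) *:
      (sgn_ffun r *: tensor_power w i' i)).
    rewrite -tensor_power_left scaler_sumr; apply: eq_bigr => t _.
    rewrite ffunE /= !base_lift_ffun !parity_lift_ffun scalerA.
    by congr (_ *: _); exact: mulC_AC.
  by rewrite !scalerA; congr (_ *: _); exact: mulC_AC.
rewrite wT sum_lift_ffun scaler_sumr; apply: eq_bigr => j' _.
transitivity ((sgn_ffun r * T (j', i)) *: (sgn_ffun s *: tensor_power w j j')).
  by rewrite !scalerA; congr (_ *: _); exact: mulC_CA.
rewrite -tensor_power_right scaler_sumr; apply: eq_bigr => t _.
rewrite ffunE /= !base_lift_ffun !parity_lift_ffun scalerA.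
by congr (_ *: _); apply/esym; exact: mulC_CA.
Qed.

End Intertwiners.


Definition parity_compatible k l (p : {set {set point k l}})
    (e s : {ffun point k l -> 'Z_2}) : bool :=
  [forall B in p, forall x in B, forall y in B,
     (s x * (e x)^-1 == s y * (e y)^-1)%g].

Definition parity_weight k l (p : {set {set point k l}})
    (e : {ffun point k l -> 'Z_2}) : C :=
  \sum_(s | parity_compatible p e s) sgn_ffun s.

Definition colour1 k l (c : colouring K k l) : colouring G k l :=
  [ffun x => (c x).1].
Definition colour2 k l (c : colouring K k l) : {ffun point k l -> 'Z_2} :=
  [ffun x => (c x).2].

Lemma compatible_lift k l (p : {set {set point k l}}) (c : colouring K k l)
    (w : point k l -> index) (s : {ffun point k l -> 'Z_2}) :
  compatible p c (fun x => lift_index (w x) (s x)) =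
  compatible p (colour1 c) w && parity_compatible p (colour2 c) s.
Proof.
have E x y : same_colour c (fun x => lift_index (w x) (s x)) x y =
    same_colour (colour1 c) w x y &&
      (s x * (colour2 c x)^-1 == s y * (colour2 c y)^-1)%g.
  by rewrite /same_colour /= !ffunE -pair_eqE /= andbAC.
apply/compatibleP/andP => [h|[/compatibleP h1 h2] B x y Bp xB yB].
  split; first by apply/compatibleP => B x y Bp xB yB; have := h B x y Bp xB yB;
    rewrite E => /andP[].
  apply/forallP => B; apply/implyP => Bp; apply/forallP => x; apply/implyP => xB.
  apply/forallP => y; apply/implyP => yB.
  by have := h B x y Bp xB yB; rewrite E => /andP[].
rewrite E (h1 B) //=.
move: h2 => /forallP/(_ B)/implyP/(_ Bp)/forallP/(_ x)/implyP/(_ xB).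
by move=> /forallP/(_ y)/implyP/(_ yB).
Qed.

Definition join_parity k l (s : {ffun 'I_l -> 'Z_2}) (t : {ffun 'I_k -> 'Z_2})
    : {ffun point k l -> 'Z_2} :=
  [ffun x => match x with inl a => t a | inr b => s b end].

Lemma sgn_join_parity k l (s : {ffun 'I_l -> 'Z_2}) (t : {ffun 'I_k -> 'Z_2}) :
  sgn_ffun (join_parity s t) = sgn_ffun s * sgn_ffun t.
Proof.
rewrite /sgn_ffun big_sumType /= mulrC.
by congr (_ * _); apply: eq_bigr => a _; rewrite ffunE.
Qed.

Lemma sum_join_parity k l (M : nmodType)
    (F : {ffun point k l -> 'Z_2} -> M) :
  \sum_s F s = \sum_s \sum_t F (join_parity s t).
Proof.
rewrite pair_bigA /= (reindex (fun p => join_parity p.1 p.2)) //=.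
exists (fun f => ([ffun b => f (inr b)], [ffun a => f (inl a)])) => [[s t] _|f _].
  by congr pair; apply/ffunP => a; rewrite !ffunE.
by apply/ffunP => -[a|b]; rewrite !ffunE.
Qed.

(** The signs of [odd_map] only see the [Z_2]-components of the indices, on
    which the compatibility condition is independent of that on the rest. *)
Lemma odd_map_Mmap k l (p : {set {set point k l}}) (c : colouring K k l) :
  is_partition p ->
  odd_map (Mmap R N p c) =
    parity_weight p (colour2 c) *: Mmap R N p (colour1 c).
Proof.
move=> pP; apply/ffunP => -[j i]; rewrite !ffunE (@MmapE R G N k l p (colour1 c) _ pP) /=.
have -> (a : C) (b : bool) : a *: (b%:R : C^o) = if b then a else 0.
  by case: b; rewrite ?scaler0 // /GRing.scale /= mulr1.
rewrite /parity_weight [in RHS]big_mkcond sum_join_parity.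
transitivity (\sum_s \sum_t sgn_ffun s * sgn_ffun t *
    (compatible p c (fun x => lift_index (join_index j i x)
        (join_parity s t x)))%:R).
  apply: eq_bigr => s _; apply: eq_bigr => t _; rewrite MmapE //=.
  congr (_ * (nat_of_bool _)%:R); apply/compatibleP/compatibleP => h B x y Bp xB yB;
    have := h B x y Bp xB yB; rewrite /same_colour;
    by case: x y {xB yB} => [x|x] [y|y] /=; rewrite !ffunE.
under eq_bigr => s _ do under eq_bigr => t _ do
  rewrite compatible_lift -sgn_join_parity.
case: ifP => cj /=; last first.
  by rewrite big1 // => s _; rewrite big1 // => t _; rewrite mulr0.
apply: eq_bigr => s _; apply: eq_bigr => t _.
by case: ifP => _; rewrite ?mulr1 ?mulr0.
Qed.

(** Flipping the parities of the points of [B] is an involution on the summands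
    that reverses their sign. *)
Lemma odd_block_weight k l (p : {set {set point k l}}) e B :
  is_partition p -> B \in p -> odd #|B| -> parity_weight p e = 0.
Proof.
move=> /and3P[_ ptriv _] Bp oddB.
pose flip (s : {ffun point k l -> 'Z_2}) : {ffun point k l -> 'Z_2} :=
  [ffun x => if x \in B then s x + 1 else s x].
have flipK : involutive flip.
  move=> s; apply/ffunP => x; rewrite !ffunE; case: (x \in B) => //.
  by rewrite -addrA Z2_add11 addr0.
have flip_sgn s : sgn_ffun (flip s) = - sgn_ffun s.
  rewrite /sgn_ffun (bigID (mem B)) /= [in RHS](bigID (mem B)) /= -mulNr.
  congr (_ * _); last first.
    by apply: eq_bigr => x /negbTE xB; rewrite ffunE xB.
  transitivity (\prod_(x in B) (- 1 * sgn (s x))).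
    by apply: eq_bigr => x xB; rewrite ffunE xB sgnS mulN1r.
  by rewrite big_split /= prodr_const -signr_odd oddB expr1 mulN1r.
have flip_compat s : parity_compatible p e (flip s) = parity_compatible p e s.
  have half t : parity_compatible p e t -> parity_compatible p e (flip t).
    move=> h; apply/forallP => D; apply/implyP => Dp.
    apply/forallP => x; apply/implyP => xD; apply/forallP => y; apply/implyP => yD.
    move: h => /forallP/(_ D)/implyP/(_ Dp)/forallP/(_ x)/implyP/(_ xD).
    move=> /forallP/(_ y)/implyP/(_ yD).
    have addE (a b : 'Z_2) : ((a + 1) * b)%g = (a * b)%g + 1 by exact: addrAC.
    have [DB|DB] := eqVneq D B.
      rewrite DB in xD yD; rewrite !ffunE xD yD !addE.
      by move=> /eqP ->.
    have dis : [disjoint D & B] by apply: (finset.trivIsetP ptriv).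
    by rewrite !ffunE (disjointFr dis xD) (disjointFr dis yD).
  apply/idP/idP => [/half|]; last exact: half.
  by rewrite flipK.
have : parity_weight p e + parity_weight p e = 0.
  rewrite {1}/parity_weight (reindex_inj (inv_inj flipK)) /=.
  under eq_bigl => s do rewrite flip_compat.
  under eq_bigr => s _ do rewrite flip_sgn.
  by rewrite sumrN addNr.
by rewrite -mulr2n => /eqP; rewrite mulrn_eq0 => /eqP.
Qed.

(** All summands are equal to [1], because each block contributes an even power
    of one sign. *)
Lemma even_weight_neq0 k l (p : {set {set point k l}}) :
  is_partition p -> [forall B in p, ~~ odd #|B|] ->
  parity_weight p [ffun=> 1%g] != 0.
Proof.
move=> /and3P[/eqP pcover ptriv _] ev.
have sgn1s s : parity_compatible p [ffun=> 1%g] s -> sgn_ffun s = 1.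
  move=> h; rewrite /sgn_ffun.
  transitivity (\prod_(x in finset.cover p) sgn (s x)).
    by apply: eq_bigl => x; rewrite pcover inE.
  rewrite big_trivIset //= big1 // => B Bp.
  have [->|/set0Pn[x xB]] := eqVneq B finset.set0; first by rewrite big_set0.
  transitivity (\prod_(y in B) sgn (s x)).
    apply: eq_bigr => y yB.
    move: h => /forallP/(_ B)/implyP/(_ Bp)/forallP/(_ x)/implyP/(_ xB).
    move=> /forallP/(_ y)/implyP/(_ yB).
    by rewrite !ffunE invg1 !mulg1 => /eqP ->.
  rewrite prodr_const.
  have := ev; move=> /forallP/(_ B)/implyP/(_ Bp) evB.
  by rewrite -(odd_double_half #|B|) (negbTE evB) add0n -mul2n exprM expr2 sgn_sqr expr1n.
rewrite /parity_weight (eq_bigr (fun=> 1)) // sumr_const pnatr_eq0.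
rewrite -lt0n; apply/card_gt0P; exists [ffun=> 0].
rewrite unfold_in; apply/forallP => B; apply/implyP => _; apply/forallP => x.
apply/implyP => _; apply/forallP => y; apply/implyP => _.
by rewrite !ffunE.
Qed.

End OddMap.

(** * The isomorphism *)

Lemma span_closed (R : realType) (V : vectType R[i]%C) (P : V -> Prop) (X : seq V) :
  P 0 -> (forall (c : R[i]%C) x y, P x -> P y -> P (c *: x + y)) ->
  (forall x, x \in X -> P x) -> forall x, x \in <<X>>%VS -> P x.
Proof.
move=> P0 PL PX x xX; rewrite (@coord_span _ _ _ (in_tuple X) x xX).
elim/big_rec: _ => // i y _ Py; apply: (PL) => //.
by apply: PX; apply: mem_nth.
Qed.

Lemma intertwiner_linear (R : realType) (A : compact_quantum_group R)
    (I : finType) (u : I -> I -> A) k l (c : R[i]%C) (S T : tensor_map R I k l) :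
  intertwiner u S -> intertwiner u T -> intertwiner u (c *: S + T).
Proof.
move=> uS uT j i.
under eq_bigr => i' _ do rewrite !ffunE scalerDl -[(c *: _) *: _]scalerA.
under [RHS]eq_bigr => j' _ do rewrite !ffunE scalerDl -[(c *: _) *: _]scalerA.
by rewrite !big_split /= -!scaler_sumr uS uT.
Qed.

Lemma intertwiner0 (R : realType) (A : compact_quantum_group R)
    (I : finType) (u : I -> I -> A) k l : intertwiner u (0 : tensor_map R I k l).
Proof.
move=> j i; rewrite !big1 // => ? _; by rewrite ffunE scale0r.
Qed.

Lemma odd_map_linear (R : realType) (G : finGroupType) (N k l : nat) (c : R[i]%C)
    (S T : tensor_map R (wr_index (G * 'Z_2)%type N) k l) :
  odd_map (c *: S + T) = c *: odd_map S + odd_map T.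
Proof.
apply/ffunP => -[j i]; rewrite !ffunE /= scaler_sumr -big_split /=.
apply: eq_bigr => s _; rewrite scaler_sumr -big_split /=.
apply: eq_bigr => t _; rewrite !ffunE mulrDr; congr (_ + _).
exact: mulrCA.
Qed.

Definition wreath_maps (R : realType) (K : finGroupType) (N : nat)
    (F : partition_family) k l : seq (tensor_map R (wr_index K N) k l) :=
  [seq Mmap R N pc.1 pc.2 |
   pc <- enum [set pc : {set {set point k l}} * colouring K k l |
               pc.1 \in F k l]]%SET.

Lemma wreath_maps_Mmap R K N (F : partition_family) k l
    (p : {set {set point k l}}) (c : colouring K k l) :
  p \in F k l -> Mmap R N p c \in wreath_maps R K N F k l.
Proof.
by move=> pF; apply/mapP; exists (p, c) => //; rewrite mem_enum inE.
Qed.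

Lemma wreath_mapsP R K N (F : partition_family) k l T :
  T \in wreath_maps R K N F k l ->
  exists p (c : colouring K k l), p \in F k l /\ T = Mmap R N p c.
Proof.
by move=> /mapP[[p c]]; rewrite mem_enum inE => pF ->; exists p, c.
Qed.

Section Main.
Variables (R : realType) (N : nat) (G : finGroupType).
Variables (B : compact_quantum_group R).
Local Notation K := (G * 'Z_2)%type.
Variable v : wr_index K N -> wr_index K N -> B.
Hypothesis v_rep : unitary_rep v.
Hypothesis v_hom : forall k l (T : tensor_map R (wr_index K N) k l),
  intertwiner v T <-> T \in <<wreath_maps R K N NC k l>>%VS.

Let v_Mmap k l (p : {set {set point k l}}) (c : colouring K k l) :
  p \in NC k l -> intertwiner v (Mmap R N p c).
Proof. by move=> pF; apply/v_hom/memv_span/wreath_maps_Mmap. Qed.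

Lemma wreath_selfadj a b : star (v a b) = v a b.
Proof. by apply: selfadj_of_one_block => //; apply/v_Mmap/one_block_NC. Qed.

Lemma wreath_shift (a b : wr_index G N) (s t : 'Z_2) :
  v (lift_index a (s + 1)) (lift_index b (t + 1)) =
  v (lift_index a s) (lift_index b t).
Proof.
have := @translation_of_one_block _ _ _ _ v (1%g, 1) _
  (a.1, s) (b.1, t) a.2 b.2.
rewrite /lift_index => <-; last exact/v_Mmap/one_block_NC.
by congr (v (_, _) (_, _)); apply/eqP; rewrite xpair_eqE mulg1 !eqxx.
Qed.

Lemma wreath_mul a b n : v a n * v b n = if a == b then v a n else 0.
Proof. by apply: product_of_one_block; apply/v_Mmap/one_block_NC. Qed.

(** [odd_map] kills the partitions with an odd block and sends the other ones
    to nonzero multiples of the maps of even partitions. *)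
Lemma odd_part_hom k l (T : tensor_map R (wr_index G N) k l) :
  intertwiner (odd_part v) T <-> T \in <<wreath_maps R G N NCev k l>>%VS.
Proof.
have right := odd_part_right wreath_shift.
have left := odd_part_left wreath_shift.
split=> [/(intertwiner_even_map right left)/v_hom hT|].
  have : odd_map (even_map T) \in <<wreath_maps R G N NCev k l>>%VS.
    move: (even_map T) hT.
    apply: (@span_closed _ _ (fun S => odd_map S \in _)).
    - have -> : odd_map (0 : tensor_map R (wr_index K N) k l) = 0.
        have := @odd_map_linear R G N k l (-1) 0 0.
        by rewrite addr0 scaler0 scaleN1r addNr.
      exact: mem0v.
    - by move=> c x y hx hy; rewrite odd_map_linear memvD // memvZ.
    move=> S /wreath_mapsP[p [c [pNC ->]]].
    have pP : is_partition p by move: pNC; rewrite inE => /andP[].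
    rewrite odd_map_Mmap //.
    have [ev|/forallPn[D]] := boolP [forall D in p, ~~ odd #|D|].
      by apply/memvZ/memv_span/wreath_maps_Mmap; rewrite inE pNC.
    rewrite negb_imply negbK => /andP[Dp oD].
    by rewrite (odd_block_weight _ _ pP Dp oD) scale0r mem0v.
  rewrite odd_even_map; set q : R[i]%C := _%:R => qT.
  have q0 : q != 0 by rewrite pnatr_eq0 muln_eq0 !expn_eq0.
  by have := memvZ q^-1 qT; rewrite scalerA mulVf // scale1r.
apply: span_closed.
- exact: intertwiner0.
- by move=> c x y; apply: intertwiner_linear.
move=> S /wreath_mapsP[p [c [+ ->]]]; rewrite inE => /andP[pNC ev].
have pP : is_partition p by move: pNC; rewrite inE => /andP[].
pose c' : colouring K k l := [ffun x => (c x, 1%g)].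
have c1 : colour1 c' = c by apply/ffunP => x; rewrite !ffunE.
have c2 : colour2 c' = [ffun=> 1%g] by apply/ffunP => x; rewrite !ffunE.
have := intertwiner_odd_map right left (v_Mmap c' pNC).
rewrite odd_map_Mmap // c1 c2; set z := parity_weight _ _ _ => h.
have z0 : z != 0 by apply: even_weight_neq0.
have := intertwiner_linear z^-1 h (@intertwiner0 _ _ _ (odd_part v) k l).
by rewrite addr0 scalerA mulVf // scale1r.
Qed.

End Main.

Local Close Scope ring_scope.

Theorem theorem3p20 (R : realType) (N : nat) (hN : 1 <= N) (G : finGroupType)
    (A B : compact_quantum_group R)
    (hA : is_partition_wreath G N NCev A)
    (hB : is_partition_wreath (G * 'Z_2)%type N NC B) :
  cqg_isomorphic A B.
Proof.
have [u [ur _ uhom uu]] := hA; have [v [vr _ vhom vu]] := hB.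
have vs := wreath_selfadj vr vhom; have vsh := wreath_shift vhom.
have vm := wreath_mul vhom.
have us a b : star (u a b) = u a b.
  apply: selfadj_of_one_block => //; apply/uhom/memv_span/wreath_maps_Mmap.
  exact: one_block_NCev.
have wr := odd_part_unitary vr vsh.
have ws := odd_part_selfadj vs.
have wu := odd_part_universal vsh vm vu.
apply: (universal_isomorphic (1%g, Ordinal hN) ur wr us ws uu wu) => k l T.
by rewrite uhom (odd_part_hom vhom).
Qed.
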